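(* Assume that $M$ is a complete hypersurface in the unit sphere $\mathbb{S}^{n+1}$. If $M$ has at least $n-1$ zero principal curvatures everywhere (that is, at every point of $M$ at least $n-1$ of the $n$ principal curvatures, counted with multiplicity, are zero), then $M$ is totally geodesic.
   Context: A hypersurface $M=M^n$ in $\mathbb{S}^{n+1}$ is a smooth $n$-dimensional manifold immersed in $\mathbb{S}^{n+1}$, equipped with the induced Riemannian metric; complete refers to this metric. The second fundamental form is $h=(h_{ij})$ with respect to a local orthonormal tangent frame and a local unit normal; the principal curvatures at a point are the eigenvalues of the symmetric matrix $(h_{ij})$ there. $M$ is totally geodesic if $h\equiv 0$, i.e. all principal curvatures vanish everywhere.
   Formalization: The dimension n is assumed to be at least 2; for n = 1 the condition on zero principal curvatures is empty and the claim fails, for instance for a small circle in the 2-sphere. *)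

(* Defs.v *)
From mathcomp Require Import all_boot all_order all_algebra.
From mathcomp Require Import all_classical all_reals all_analysis.

Set Implicit Arguments.
Unset Strict Implicit.
Unset Printing Implicit Defensive.

Import Order.TTheory GRing.Theory Num.Theory.
Import numFieldNormedType.Exports.

Local Open Scope classical_set_scope.
Local Open Scope ring_scope.

(* The norm `|u| of 'rV[R]_n in the library is the sup norm, so the Euclidean
   structure is introduced separately; the topologies agree. *)
Definition dot (R : realType) (n : nat) (u v : 'rV[R]_n) : R :=
  \sum_(i < n) u 0 i * v 0 i.

Definition enorm (R : realType) (n : nat) (u : 'rV[R]_n) : R :=
  Num.sqrt (dot u u).

(* Only used for U open and V finite-dimensional, where existence and
   continuity of all iterated directional derivatives of order at most k is
   the usual notion of a C^k map on U. *)
Fixpoint Ck_on (R : realType) (V W : normedModType R) (k : nat) (U : set V)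
    (f : V -> W) : Prop :=
  (forall x, U x -> {for x, continuous f}) /\
  (if k is k'.+1 then
     forall v : V, (forall x, U x -> derivable f x v) /\
                   Ck_on k' U (fun x => 'D_v f x)
   else True).

Definition smooth_on (R : realType) (V W : normedModType R) (U : set V)
    (f : V -> W) : Prop :=
  forall k : nat, Ck_on k U f.

(* The values of [cmap] outside [cdom], and of [cinv] outside [cmap @` cdom],
   are irrelevant. *)
Record chart (R : realType) (n : nat) (M : topologicalType) := Chart {
  cdom : set M;
  cmap : M -> 'rV[R]_n;
  cinv : 'rV[R]_n -> M
}.

Definition cimg (R : realType) (n : nat) (M : topologicalType)
    (c : chart R n M) : set 'rV[R]_n :=
  cmap c @` cdom c.

Definition is_chart (R : realType) (n : nat) (M : topologicalType)
    (c : chart R n M) : Prop :=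
  [/\ open (cdom c),
      open (cimg c),
      forall p, cdom c p -> cinv c (cmap c p) = p,
      forall p, cdom c p -> {for p, continuous (cmap c)} &
      forall u, cimg c u -> {for u, continuous (cinv c)}].

Definition smooth_transition (R : realType) (n : nat) (M : topologicalType)
    (c c' : chart R n M) : Prop :=
  smooth_on (cmap c @` (cdom c `&` cdom c')) (cmap c' \o cinv c).

(* An atlas, not necessarily maximal. Connectedness is not required. *)
Record smooth_manifold (R : realType) (n : nat) := SmoothManifold {
  mspace :> topologicalType;
  atlas : set (chart R n mspace);
  manifold_hausdorff : hausdorff_space mspace;
  manifold_second_countable : @second_countable mspace;
  atlas_chart : forall c, atlas c -> is_chart c;
  atlas_cover : forall p, exists2 c, atlas c & cdom c p;
  atlas_smooth : forall c c', atlas c -> atlas c' -> smooth_transition c c'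
}.

Section Hypersurface.
Context (R : realType) (n : nat) (M : smooth_manifold R n).

Section AnyCodimension.
Context (N : nat) (f : M -> 'rV[R]_N).

Definition param (c : chart R n M) : 'rV[R]_n -> 'rV[R]_N := f \o cinv c.

Definition smooth_map : Prop :=
  forall c, atlas c -> smooth_on (cimg c) (param c).

Definition immersion : Prop :=
  smooth_map /\
  forall c, atlas c -> forall u, cimg c u ->
    forall v : 'rV[R]_n, 'D_v (param c) u = 0 -> v = 0.

(* The induced metric on tangent vectors given by their coordinates v, w in
   the chart c, at the point with coordinates u. *)
Definition induced_metric (c : chart R n M) (u v w : 'rV[R]_n) : R :=
  dot ('D_v (param c) u) ('D_w (param c) u).

Definition C1_curve (a b : R) (g : R -> M) : Prop :=
  exists O : set R,
    [/\ open O,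
        (forall t, a <= t <= b -> O t),
        (forall t, O t -> {for t, continuous g}) &
        forall c, atlas c ->
          Ck_on 1 (O `&` g @^-1` cdom c) (cmap c \o g)].

(* The speed for the induced metric is |df(g'(t))| = |(f \o g)'(t)|. *)
Definition curve_length (a b : R) (g : R -> M) : \bar R :=
  (\int[lebesgue_measure]_(t in `[a, b]) (enorm (derive1 (f \o g) t))%:E)%E.

(* [pw_C1_path p q l]: some piecewise C^1 curve from p to q, given as a chain
   of C^1 pieces, has length l. *)
Inductive pw_C1_path : M -> M -> \bar R -> Prop :=
| PathNil p : pw_C1_path p p 0%E
| PathCons a b g q l :
    a <= b -> C1_curve a b g -> pw_C1_path (g b) q l ->
    pw_C1_path (g a) q (curve_length a b g + l)%E.

(* Equal to +oo when p and q lie in different components of M. *)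
Definition riemannian_distance (p q : M) : \bar R :=
  ereal_inf [set l | pw_C1_path p q l].

Definition riemannian_complete : Prop :=
  forall s : nat -> M,
    (forall e : R, 0 < e -> exists k0 : nat, forall k l : nat,
       (k0 <= k)%N -> (k0 <= l)%N ->
       (riemannian_distance (s k) (s l) < e%:E)%E) ->
    exists p : M, forall e : R, 0 < e -> exists k0 : nat, forall k : nat,
      (k0 <= k)%N -> (riemannian_distance (s k) p < e%:E)%E.

End AnyCodimension.

(* The unit sphere S^{n+1} is the set of unit vectors of R^{n+2}. *)
Context (f : M -> 'rV[R]_n.+2).

Definition immersed_in_sphere : Prop :=
  immersion f /\ forall p, dot (f p) (f p) = 1.

Definition unit_normal (c : chart R n M) (u : 'rV[R]_n) (nu : 'rV[R]_n.+2) :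
    Prop :=
  [/\ dot nu nu = 1,
      dot nu (param f c u) = 0 &
      forall v : 'rV[R]_n, dot nu ('D_v (param f c) u) = 0].

(* The Levi-Civita connection of the sphere along [param f c]: the derivative
   in R^{n+2} of the vector field X, projected to the tangent space of the
   sphere. *)
Definition sphere_connection (c : chart R n M) (v : 'rV[R]_n)
    (X : 'rV[R]_n -> 'rV[R]_n.+2) (u : 'rV[R]_n) : 'rV[R]_n.+2 :=
  'D_v X u - dot ('D_v X u) (param f c u) *: param f c u.

(* h(v, w) is the nu-component of the derivative in direction v of a tangent
   field extending w; h being tensorial, the field with constant coordinates w
   in the chart is used. *)
Definition second_fundamental_form (c : chart R n M) (u : 'rV[R]_n)
    (nu : 'rV[R]_n.+2) (v w : 'rV[R]_n) : R :=
  dot (sphere_connection c v (fun y => 'D_w (param f c) y) u) nu.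

Definition orthonormal_frame (c : chart R n M) (u : 'rV[R]_n)
    (e : 'I_n -> 'rV[R]_n) : Prop :=
  forall i j, induced_metric f c u (e i) (e j) = (i == j)%:R.

(* [h_matrix p H]: H is the matrix (h_ij) at p for some choice of orthonormal
   tangent frame and of unit normal at p. The choices only affect H up to sign
   and orthogonal conjugation. *)
Definition h_matrix (p : M) (H : 'M[R]_n) : Prop :=
  exists c : chart R n M, exists e : 'I_n -> 'rV[R]_n,
  exists nu : 'rV[R]_n.+2,
    [/\ atlas c /\ cdom c p,
        orthonormal_frame c (cmap c p) e,
        unit_normal c (cmap c p) nu &
        H = \matrix_(i, j) second_fundamental_form c (cmap c p) nu (e i) (e j)].

(* The principal curvatures at p are the eigenvalues of H with [h_matrix p H];
   those equal to zero are counted by the multiplicity of 0 as a root of the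
   characteristic polynomial. *)
Definition zero_principal_curvatures_at_least (k : nat) (p : M) : Prop :=
  forall H : 'M[R]_n, h_matrix p H -> (k <= mup 0 (char_poly H))%N.

Definition totally_geodesic : Prop :=
  forall (p : M) (H : 'M[R]_n), h_matrix p H -> H = 0.

End Hypersurface.

(* Main.v *)
(* If some principal curvature is nonzero at a point, exactly one is, and a
   unit null direction e of h issues from there. In the gnomonic chart centred
   at that point the hypersurface is the graph of a function whose Hessian has
   rank at most one, and constancy of the gradient along the null direction
   makes everything explicit: the immersion maps a curve onto the great circle
   cos t x + sin t e, along which the unit normal nu is constant, a fixed
   vector E orthogonal to the circle stays tangent, and
     h(E, E) * (A cos t + B sin t) = 1.
   Lengths along that curve equal t, so by completeness it extends as long as
   t does not reach a zero of A cos t + B sin t: at a limit point the displayed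
   identity survives, so h is still nonzero there and the local construction
   applies again. But A cos t + B sin t vanishes somewhere in (0, pi), a
   contradiction. *)

Require Import Defs.
From mathcomp Require Import all_boot all_order all_algebra.
From mathcomp Require Import all_classical all_reals all_analysis.
From mathcomp Require Import measurable_realfun.
From mathcomp Require Import ring lra.

Set Implicit Arguments.
Unset Strict Implicit.
Unset Printing Implicit Defensive.

Import Order.TTheory GRing.Theory Num.Theory.
Import numFieldNormedType.Exports.

Local Open Scope classical_set_scope.
Local Open Scope ring_scope.

(** * Smooth calculus *)

Section SmoothCalculus.
Context (R : realType).

(** Finding the null curve would normally mean integrating a line field. Under central projection
    from the centre of the sphere, great spheres become affine hyperplanes. Pairing the hypersurface
    with a normal [N] therefore gives, up to a positive factor, an affine function plus a multiple
    of one height function [w], and [h] is a pointwise multiple of the Hessian of [w]. The rank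
    bound reads [w_aa * w_bb = w_ab * w_ab]. Differentiated along [b], it becomes a linear equation
    that forces [w_ab = w_aa = 0] on a segment in the direction [a], and there [1 / w_bb] has zero
    second derivative. So the null curve is a straight segment, and the sinusoid is this affine
    function of [tan t] multiplied by [cos t]. Continuing the curve would normally mean gluing
    pieces into a maximal leaf. Instead, a sequence of local pieces is used, each advancing at least
    half as far as any admissible piece; a leaf through the limit point then offers an advance too
    long for the late terms. Since [f] is locally injective, leaves over the same great circle can
    be compared through their images. *)

Lemma Ck_on_sub (V W : normedModType R) (k : nat) (U U' : set V) (f : V -> W) :
  U' `<=` U -> Ck_on k U f -> Ck_on k U' f.
Proof.
move=> sU; elim: k f => [|k IH] f /= [cf df]; split => //.
- by move=> x /sU; exact: cf.
- by move=> x /sU; exact: cf.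
- by move=> v; have [d1 d2] := df v; split; [move=> x /sU; exact: d1 | exact: IH].
Qed.

Lemma open_near_eq (V W : topologicalType) (U : set V) (f g : V -> W) x :
  open U -> (forall y, U y -> f y = g y) -> U x -> \near x, f x = g x.
Proof. by move=> oU fg Ux; apply: filterS (open_nbhs_nbhs (conj oU Ux)). Qed.

Lemma continuous_near_eq (V W : topologicalType) (U : set V) (f g : V -> W) x :
  open U -> (forall y, U y -> f y = g y) -> U x ->
  {for x, continuous f} -> {for x, continuous g}.
Proof.
move=> oU fg Ux cf; have fgx := fg _ Ux.
suff : g @ x --> g x by [].
rewrite -fgx; apply: cvg_trans cf; apply: near_eq_cvg.
exact: open_near_eq oU fg Ux.
Qed.

Lemma Ck_on_eq (V W : normedModType R) (k : nat) (U : set V) (f g : V -> W) :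
  open U -> (forall x, U x -> f x = g x) -> Ck_on k U f -> Ck_on k U g.
Proof.
move=> oU; elim: k f g => [|k IH] f g fg /= [cf df]; split => //.
- by move=> x Ux; apply: (continuous_near_eq oU fg Ux (cf _ Ux)).
- by move=> x Ux; apply: (continuous_near_eq oU fg Ux (cf _ Ux)).
- move=> v; have [d1 d2] := df v; split.
    move=> x Ux; apply: near_eq_derivable (d1 x Ux).
    exact: open_near_eq oU fg Ux.
  apply: IH d2 => x Ux; apply: near_eq_derive.
  exact: open_near_eq oU fg Ux.
Qed.

Lemma Ck_onW (V W : normedModType R) (k : nat) (U : set V) (f : V -> W) :
  Ck_on k.+1 U f -> Ck_on k U f.
Proof.
elim: k f => [|k IH] f [cf df]; split => //.
by move=> v; have [d1 d2] := df v; split => //; exact: IH.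
Qed.

Lemma smooth_on_derive (V W : normedModType R) (U : set V) (f : V -> W) v :
  smooth_on U f -> smooth_on U ('D_v f).
Proof. by move=> sf k; have [_ /(_ v)[]] := sf k.+1. Qed.

Lemma smooth_on_derivable (V W : normedModType R) (U : set V) (f : V -> W) x v :
  smooth_on U f -> U x -> derivable f x v.
Proof. by move=> sf Ux; have [_ /(_ v)[+ _]] := sf 1%N; exact. Qed.

Lemma smooth_on_continuous (V W : normedModType R) (U : set V) (f : V -> W) x :
  smooth_on U f -> U x -> {for x, continuous f}.
Proof. by move=> sf Ux; have [+ _] := sf 0%N; exact. Qed.

Lemma smooth_on_eq (V W : normedModType R) (U : set V) (f g : V -> W) :
  open U -> (forall x, U x -> f x = g x) -> smooth_on U f -> smooth_on U g.
Proof. by move=> oU fg sf k; exact: Ck_on_eq fg (sf k). Qed.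

Lemma smooth_on_sub (V W : normedModType R) (U U' : set V) (f : V -> W) :
  U' `<=` U -> smooth_on U f -> smooth_on U' f.
Proof. by move=> sU sf k; exact: Ck_on_sub sU (sf k). Qed.

Lemma Ck_on_cst (V W : normedModType R) (k : nat) (U : set V) (c : W) :
  open U -> Ck_on k U (fun _ : V => c).
Proof.
move=> oU; elim: k c => [|k IH] c; split => //.
- by move=> x _; exact: cst_continuous.
- by move=> x _; exact: cst_continuous.
move=> v; split=> [x _|]; first exact: derivable_cst.
by apply: Ck_on_eq (IH 0) => // x _; rewrite (derive_cst c).
Qed.

Lemma Ck_onD (V W : normedModType R) (k : nat) (U : set V) (f g : V -> W) :
  open U -> Ck_on k U f -> Ck_on k U g -> Ck_on k U (fun x => f x + g x).
Proof.
move=> oU; elim: k f g => [|k IH] f g [cf df] [cg dg]; split => //.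
- by move=> x Ux; apply: continuousD; [exact: cf|exact: cg].
- by move=> x Ux; apply: continuousD; [exact: cf|exact: cg].
move=> v; have [f1 f2] := df v; have [g1 g2] := dg v; split.
  by move=> x Ux; apply: derivableD; [exact: f1|exact: g1].
apply: Ck_on_eq (IH _ _ f2 g2) => // x Ux.
by rewrite (deriveD (f1 _ Ux) (g1 _ Ux)).
Qed.

Lemma Ck_onM (V : normedModType R) (k : nat) (U : set V) (f g : V -> R) :
  open U -> Ck_on k U f -> Ck_on k U g -> Ck_on k U (fun x => f x * g x).
Proof.
move=> oU; elim: k f g => [|k IH] f g hf hg.
  case: hf => cf _; case: hg => cg _; split => // x Ux.
  by apply: continuousM; [exact: cf|exact: cg].
have hf' := Ck_onW hf; have hg' := Ck_onW hg.
case: hf => cf df; case: hg => cg dg; split.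
  by move=> x Ux; apply: continuousM; [exact: cf|exact: cg].
move=> v; have [f1 f2] := df v; have [g1 g2] := dg v; split.
  by move=> x Ux; apply: derivableM; [exact: f1|exact: g1].
apply: Ck_on_eq (Ck_onD oU (IH _ _ hf' g2) (IH _ _ hg' f2)) => // x Ux.
by rewrite (deriveM (f1 _ Ux) (g1 _ Ux)).
Qed.

Lemma Ck_onV (V : normedModType R) (k : nat) (U : set V) (f : V -> R) :
  open U -> (forall x, U x -> f x != 0) ->
  Ck_on k U f -> Ck_on k U (fun x => (f x)^-1).
Proof.
move=> oU f0; elim: k f f0 => [|k IH] f f0 hf.
  case: hf => cf _; split => // x Ux.
  by apply: continuousV; [exact: f0|exact: cf].
have hf' := Ck_onW hf.
case: hf => cf df; split.
  by move=> x Ux; apply: continuousV; [exact: f0|exact: cf].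
move=> v; have [f1 f2] := df v; split.
  by move=> x Ux; apply: derivableV; [exact: f0|exact: f1].
have h1 := IH _ f0 hf'.
have hm : Ck_on k U (fun _ : V => - 1 : R) := Ck_on_cst k _ oU.
apply: (Ck_on_eq oU _ (Ck_onM oU hm (Ck_onM oU (Ck_onM oU h1 h1) f2))) => x Ux.
rewrite [RHS](deriveV (f0 _ Ux) (f1 _ Ux)) /GRing.scale /=.
by rewrite mulN1r mulNr expr2 invfM.
Qed.

Lemma Ck_on_sum (V W : normedModType R) (I : Type) (r : seq I) (k : nat)
    (U : set V) (f : I -> V -> W) :
  open U -> (forall i, Ck_on k U (f i)) ->
  Ck_on k U (fun x => \sum_(i <- r) f i x).
Proof.
move=> oU hf; elim: r => [|i r IH].
  by apply: Ck_on_eq (Ck_on_cst k 0 oU) => // x _; rewrite big_nil.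
by apply: Ck_on_eq (Ck_onD oU (hf i) IH) => // x _; rewrite big_cons.
Qed.

Lemma Ck_on_prod (V : normedModType R) (I : Type) (r : seq I) (k : nat)
    (U : set V) (f : I -> V -> R) :
  open U -> (forall i, Ck_on k U (f i)) ->
  Ck_on k U (fun x => \prod_(i <- r) f i x).
Proof.
move=> oU hf; elim: r => [|i r IH].
  have h1 : Ck_on k U (fun _ : V => 1 : R) := Ck_on_cst k _ oU.
  by apply: (Ck_on_eq oU _ h1) => x _; rewrite big_nil.
by apply: Ck_on_eq (Ck_onM oU (hf i) IH) => // x _; rewrite big_cons.
Qed.

Lemma derive_coord (V : normedModType R) m (f : V -> 'rV[R]_m) x v i :
  derivable f x v -> 'D_v (fun y => f y 0 i) x = ('D_v f x) 0 i.
Proof. by move=> df; rewrite (derive_mx df) mxE. Qed.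

Lemma Ck_on_coord (V : normedModType R) m (k : nat) (U : set V)
    (f : V -> 'rV[R]_m) i :
  open U -> Ck_on k U f -> Ck_on k U (fun x => f x 0 i).
Proof.
move=> oU; elim: k f => [|k IH] f [cf df].
  split => // x Ux.
  apply: (@continuous_comp _ _ _ f (fun M : 'rV_m => M 0 i) x (cf x Ux)).
  exact: coord_continuous.
split.
  move=> x Ux.
  apply: (@continuous_comp _ _ _ f (fun M : 'rV_m => M 0 i) x (cf x Ux)).
  exact: coord_continuous.
move=> v; have [f1 f2] := df v; split.
  by move=> x Ux; have /derivable_mxP := f1 _ Ux; exact.
by apply: Ck_on_eq (IH _ f2) => // x Ux; rewrite derive_coord //; exact: f1.
Qed.

Lemma smooth_on_coord (V : normedModType R) m (U : set V)
    (f : V -> 'rV[R]_m) i :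
  open U -> smooth_on U f -> smooth_on U (fun x => f x 0 i).
Proof. by move=> oU sf k; exact: Ck_on_coord. Qed.

Lemma smooth_on_cst (V W : normedModType R) (U : set V) (c : W) :
  open U -> smooth_on U (fun _ : V => c).
Proof. by move=> oU k; exact: Ck_on_cst. Qed.

Lemma smooth_onD (V W : normedModType R) (U : set V) (f g : V -> W) :
  open U -> smooth_on U f -> smooth_on U g -> smooth_on U (fun x => f x + g x).
Proof. by move=> oU sf sg k; exact: Ck_onD. Qed.

Lemma smooth_onM (V : normedModType R) (U : set V) (f g : V -> R) :
  open U -> smooth_on U f -> smooth_on U g -> smooth_on U (fun x => f x * g x).
Proof. by move=> oU sf sg k; exact: Ck_onM. Qed.

Lemma smooth_onV (V : normedModType R) (U : set V) (f : V -> R) :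
  open U -> (forall x, U x -> f x != 0) ->
  smooth_on U f -> smooth_on U (fun x => (f x)^-1).
Proof. by move=> oU f0 sf k; exact: Ck_onV. Qed.

Lemma smooth_on_sum (V W : normedModType R) (I : Type) (r : seq I)
    (U : set V) (f : I -> V -> W) :
  open U -> (forall i, smooth_on U (f i)) ->
  smooth_on U (fun x => \sum_(i <- r) f i x).
Proof. by move=> oU sf k; apply: Ck_on_sum => // i; exact: sf. Qed.

Lemma smooth_on_prod (V : normedModType R) (I : Type) (r : seq I)
    (U : set V) (f : I -> V -> R) :
  open U -> (forall i, smooth_on U (f i)) ->
  smooth_on U (fun x => \prod_(i <- r) f i x).
Proof. by move=> oU sf k; apply: Ck_on_prod => // i; exact: sf. Qed.

Lemma is_derive_line (V W : normedModType R) (f : V -> W) z v (t : R) :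
  derivable f (z + t *: v) v ->
  is_derive t (1 : R) (fun s : R => f (z + s *: v)) ('D_v f (z + t *: v)).
Proof.
move=> df.
have E : (fun h : R => h^-1 *: (((fun s : R => f (z + s *: v)) \o shift t)
    (h *: (1 : R)) - f (z + t *: v))) =
  (fun h : R => h^-1 *: ((f \o shift (z + t *: v)) (h *: v) - f (z + t *: v))).
  apply/funext => h /=; congr (_ *: (f _ - _)).
  have -> : h%:A = h :> R by rewrite /GRing.scale /= mulr1.
  by rewrite scalerDl addrCA.
by split; [rewrite /derivable E|rewrite /derive E].
Qed.

(** Running over [s] in [[0, 1]] with the signed length [c] as a factor treats both orientations of
    the segment at once. *)
Lemma MVT_line (V : normedModType R) (f : V -> R) (U : set V) z v (c : R) :
  (forall s : R, 0 <= s <= 1 -> U (z + (s * c) *: v)) ->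
  (forall x, U x -> derivable f x v) ->
  exists2 s : R, 0 <= s <= 1 &
    f (z + c *: v) - f z = c * 'D_v f (z + (s * c) *: v).
Proof.
move=> hU df.
pose h (s : R) := f (z + (s * c) *: v).
have dh (s : R) : 0 <= s <= 1 -> is_derive s (1 : R) h (c * 'D_v f (z + (s * c) *: v)).
  move=> s01; have := @is_derive_line _ _ f z v (s * c) (df _ (hU _ s01)).
  move=> h1.
  have h2 : is_derive s (1 : R) (fun s : R => s * c) c.
    have -> : (fun s : R => s * c) = c \*: (@id R).
      by apply/funext => y /=; rewrite mulrC.
    by apply: is_derive_eq; rewrite /GRing.scale /= mulr1.
  rewrite mulrC.
  exact: (@is_derive1_comp _ (fun s : R => f (z + s *: v)) (fun s : R => s * c) s _ _ h1 h2).
have [||s s01] := @MVT_segment _ h (fun s => c * 'D_v f (z + (s * c) *: v)) 0 1 ler01.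
- by move=> x; rewrite in_itv /= => /andP[x0 x1]; apply: dh; rewrite !ltW.
- apply: derivable_within_continuous => x; rewrite in_itv /= => x01.
  by have [] := dh _ x01.
rewrite /h subr0 mulr1 mul1r mul0r scale0r addr0 => E.
by exists s; rewrite // -in_itv.
Qed.

End SmoothCalculus.

(** * Strict differentiability, the chain rule and symmetry of second derivatives *)

Section RowVectors.
Context (R : realType).

Lemma rV_norm_leP (m : nat) (u : 'rV[R]_m) (r : R) : 0 <= r ->
  reflect (forall i, `|u 0 i| <= r) (`|u| <= r).
Proof.
move=> r0.
have -> : `|u| = \big[Num.max/0]_ij `|u ij.1 ij.2| by exact: mx_normrE.
apply: (iffP idP) => [h i|h].
  by apply: le_trans h; apply: (le_bigmax _ (fun ij => `|u ij.1 ij.2|) (ord0, i)).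
by apply: bigmax_le => // -[i j] _ /=; rewrite ord1.
Qed.

Lemma rV_coord_le (m : nat) (u : 'rV[R]_m) i : `|u 0 i| <= `|u|.
Proof. exact: (rV_norm_leP u (normr_ge0 u) (lexx _)). Qed.

Lemma open_ballP (V : normedModType R) (U : set V) x : open U -> U x ->
  exists2 r : R, 0 < r & forall y, `|x - y| < r -> U y.
Proof.
move=> oU Ux; have /nbhs_ballP[r r0 h] : nbhs x U by exact: open_nbhs_nbhs.
by exists r => // y xy; apply: h; rewrite -ball_normE.
Qed.

Lemma continuous_ballP (V W : normedModType R) (f : V -> W) x (e : R) :
  {for x, continuous f} -> 0 < e ->
  exists2 r : R, 0 < r & forall y, `|x - y| < r -> `|f x - f y| < e.
Proof.
move=> cf e0; have /nbhs_ballP[r r0 h] : nbhs x [set y | `|f x - f y| < e].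
  have c : f y @[y --> x] --> f x := cf.
  by have /cvgrPdist_lt /(_ _ e0) := c.
by exists r => // y xy; apply: h; rewrite -ball_normE.
Qed.

(** The increment from [u'] to [u] is split into [n] moves along the axes, each handled by the mean
    value theorem and the continuity of one partial derivative. Two arbitrary points near [x] are
    compared, rather than [x] with one point, because the inverse function theorem and the lower
    bounds for immersions require it. *)
Lemma C1_strict_scalar (n : nat) (f : 'rV[R]_n -> R) (U : set 'rV[R]_n) x (e : R) :
  open U -> Ck_on 1 U f -> U x -> 0 < e ->
  exists2 r : R, 0 < r & forall u u', `|x - u| < r -> `|x - u'| < r ->
   `|f u - f u' - \sum_(i < n) (u - u') 0 i * 'D_('e_i) f x| <= e * `|u - u'|.
Proof.
move=> oU [cf df] Ux e0.
have [r1 r10 hr1] := open_ballP oU Ux.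
(* One share of the error for each axis; [n.+1] keeps the quotient positive also when [n = 0]. *)
have e'0 : 0 < e / n.+1%:R by rewrite divr_gt0.
have /choice[rr hrr] : forall i : 'I_n, exists r : R, 0 < r /\
    forall y, `|x - y| < r -> `|'D_('e_i) f x - 'D_('e_i) f y| < e / n.+1%:R.
  move=> i; have [_ [c1 _]] := df 'e_i.
  by have [r r0 hr] := continuous_ballP (c1 _ Ux) e'0; exists r.
pose r := \big[Num.min/r1]_i rr i.
have r0 : 0 < r by apply: lt_bigmin => // i _; have [] := hrr i.
exists r => // u u' xu xu'.
have rr1 : r <= r1 by exact: bigmin_le_id.
have rri i : r <= rr i by exact: bigmin_le.
(* [p k] has taken its first [k] coordinates from [u], so [p 0 = u'] and [p n = u]. All edges of
   this path stay in the ball because the norm is the sup norm. *)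
pose p (k : nat) : 'rV[R]_n := \row_j (if (j < k)%N then u 0 j else u' 0 j).
have ball_p (k : 'I_n) (s : R) : 0 <= s <= 1 ->
    `|x - (p k + (s * (u - u') 0 k) *: 'e_k)| < r.
  move=> /andP[s0 s1].
  have [m mr [m1 m2]] : exists2 m : R, m < r & `|x - u| <= m /\ `|x - u'| <= m.
    exists (Num.max `|x - u| `|x - u'|); first by rewrite gt_max xu xu'.
    by rewrite !le_max !lexx orbT.
  have m0 : 0 <= m by apply: le_trans m1.
  apply: le_lt_trans mr; apply/rV_norm_leP => // j.
  move/rV_norm_leP: m1 => /(_ m0 j); move/rV_norm_leP: m2 => /(_ m0 j).
  rewrite !mxE /= => a1 a2.
  have [jk|jk] := eqVneq j k.
    rewrite jk ltnn mulr1.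
    rewrite jk in a1 a2.
    move: a1 a2; rewrite !ler_norml => /andP[b1 b2] /andP[c1 c2].
    by apply/andP; split; nra.
  by rewrite mulr0 addr0; case: ifP.
have step (k : 'I_n) : `|f (p k.+1) - f (p k) - (u - u') 0 k * 'D_('e_k) f x|
    <= e / n.+1%:R * `|u - u'|.
  have -> : p k.+1 = p k + (u - u') 0 k *: 'e_k.
    apply/rowP => j; rewrite !mxE /= ltnS leq_eqVlt.
    have [->|jk] := eqVneq j k; first by rewrite eqxx ltnn /= mulr1; ring.
    rewrite (_ : (j == k :> nat) = false) /=; last exact/negbTE.
    by rewrite mulr0 addr0.
  have [||s s01 ->] := @MVT_line _ _ f U (p k) 'e_k ((u - u') 0 k).
  - by move=> s s01; apply: hr1; apply: lt_le_trans (ball_p _ _ s01) rr1.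
  - by move=> y Uy; have [d1 _] := df 'e_k; exact: d1.
  rewrite -mulrBr normrM mulrC; apply: ler_pM => //; last exact: rV_coord_le.
  rewrite distrC ltW //; have [_ h] := hrr k; apply: h.
  exact: lt_le_trans (ball_p _ _ s01) (rri k).
have -> : f u - f u' = \sum_(k < n) (f (p k.+1) - f (p k)).
  rewrite -(big_mkord xpredT (fun k => f (p k.+1) - f (p k))) telescope_sumr //.
  by congr (f _ - f _); apply/rowP => j; rewrite !mxE ?ltn_ord.
rewrite -sumrB; apply: le_trans (ler_norm_sum _ _ _) _.
apply: le_trans (_ : \sum_(k < n) e / n.+1%:R * `|u - u'| <= _).
  by apply: ler_sum => k _; exact: step.
rewrite sumr_const card_ord -[X in X <= _]mulr_natl mulrA ler_wpM2r //.
by rewrite mulrCA ger_pMr // ler_pdivrMr ?ltr0n // mul1r ler_nat.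
Qed.

(** [G] need only be differentiable in the single direction [v]: the strict estimate for [f] at
    [G x] controls the increment of [f] along whatever path [G] takes. *)
Lemma is_derive_comp_C1 (V : normedModType R) (n : nat) (f : 'rV[R]_n -> R)
    (U : set 'rV[R]_n) (G : V -> 'rV[R]_n) x v dG :
  open U -> Ck_on 1 U f -> U (G x) -> is_derive x v G dG ->
  is_derive x v (f \o G) (\sum_(i < n) dG 0 i * 'D_('e_i) f (G x)).
Proof.
move=> oU cf UGx [dGx dGE].
set L := fun w : 'rV[R]_n => \sum_(i < n) w 0 i * 'D_('e_i) f (G x).
have hG : (fun h : R => h^-1 *: ((G \o shift x) (h *: v) - G x)) h @[h --> 0^']
    --> dG by rewrite -dGE; exact: dGx.
have LD w w' : L (w - w') = L w - L w'.
  by rewrite /L -sumrB; apply: eq_bigr => i _; rewrite !mxE mulrBl.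
have LZ c w : L (c *: w) = c * L w.
  by rewrite /L mulr_sumr; apply: eq_bigr => i _; rewrite !mxE mulrA.
suff main : (fun h : R => h^-1 *: (((f \o G) \o shift x) (h *: v) - (f \o G) x)) h
    @[h --> 0^'] --> L dG.
  by split; [apply/cvg_ex; exists (L dG)|exact/cvg_lim].
apply/cvgrPdist_lt => e e0.
pose C := \sum_(i < n) `|'D_('e_i) f (G x)| + 1.
have C0 : 0 < C by rewrite ltr_wpDl // sumr_ge0.
have LC w : `|L w| <= C * `|w|.
  apply: le_trans (ler_norm_sum _ _ _) _.
  rewrite mulrDl mul1r mulr_suml -[X in X <= _]addr0 lerD // ler_sum // => i _.
  by rewrite normrM mulrC ler_wpM2l // rV_coord_le.
(* Half of [e] pays for the linear part through the bound [C] of [L]. The other half is [d] times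
   [|dG| + 1]: the strict error on a difference quotient of norm at most [|dG| + 1]. *)
pose d := e / (2 * (`|dG| + 1)).
have d0 : 0 < d by rewrite divr_gt0 // mulr_gt0 // ltr_wpDl.
have [r r0 hr] := C1_strict_scalar oU cf UGx d0.
have e1 : 0 < Num.min 1 (e / (2 * C)) by rewrite lt_min ltr01 divr_gt0 // mulr_gt0.
have r'0 : 0 < r / (`|dG| + 1) by rewrite divr_gt0 // ltr_wpDl.
near=> h.
have h0 : h != 0 by near: h; exact: nbhs_dnbhs_neq.
have hr' : `|h| < r / (`|dG| + 1) by near: h; exact: dnbhs0_lt.
have : `|dG - h^-1 *: (G (h *: v + x) - G x)| < Num.min 1 (e / (2 * C)).
  by near: h; move/cvgrPdist_lt: hG => /(_ _ e1).
rewrite lt_min => /andP[].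
set D := G (h *: v + x) - G x => c2 c3.
have c5 : `|h^-1 *: D| <= `|dG| + 1.
  have -> : h^-1 *: D = dG - (dG - h^-1 *: D) by rewrite opprB addrC subrK.
  by apply: le_trans (ler_normB _ _) _; rewrite lerD2l ltW.
have c1 : `|G x - G (h *: v + x)| < r.
  rewrite distrC -/D -[D]scale1r -(divff h0) -scalerA normrZ.
  apply: le_lt_trans (_ : `|h| * (`|dG| + 1) < _); first by rewrite ler_wpM2l.
  by rewrite -ltr_pdivlMr // ltr_wpDl.
have xx : `|G x - G x| < r by rewrite subrr normr0.
have := hr _ _ c1 xx; rewrite -/D -/(L D) => c4.
rewrite /= /GRing.scale /=.
have -> : L dG - h^-1 * (f (G (h *: v + x)) - f (G x)) =
  L (dG - h^-1 *: D) - h^-1 * (f (G (h *: v + x)) - f (G x) - L D).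
  by rewrite LD LZ; ring.
apply: le_lt_trans (ler_normB _ _) _.
rewrite (splitr e); apply: ltr_leD.
  apply: le_lt_trans (LC _) _.
  by rewrite [C * _]mulrC -ltr_pdivlMr // -mulrA -invfM.
rewrite normrM normfV.
apply: le_trans (_ : `|h|^-1 * (d * `|D|) <= _); first by rewrite ler_wpM2l // invr_ge0.
rewrite mulrCA -normfV -normrZ.
apply: le_trans (_ : d * (`|dG| + 1) <= _); first by rewrite ler_wpM2l // ltW.
by rewrite /d invfM mulrA mulfVK // gt_eqF // ltr_wpDl.
Unshelve. all: by end_near.
Qed.

Lemma derive_dirE (n : nat) (f : 'rV[R]_n -> R) (U : set 'rV[R]_n) x v :
  open U -> Ck_on 1 U f -> U x -> 'D_v f x = \sum_(i < n) v 0 i * 'D_('e_i) f x.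
Proof.
move=> oU cf Ux.
have h1 : is_derive x v (@id 'rV[R]_n) v by apply: is_derive_id.
by have [_ <-] := is_derive_comp_C1 oU cf Ux h1.
Qed.

Lemma derive_dirE_vec (n m : nat) (f : 'rV[R]_n -> 'rV[R]_m)
    (U : set 'rV[R]_n) x v :
  open U -> Ck_on 1 U f -> U x ->
  'D_v f x = \sum_(i < n) v 0 i *: 'D_('e_i) f x.
Proof.
move=> oU cf Ux; apply/rowP => j; rewrite summxE.
have df w : derivable f x w by have [_ /(_ w)[+ _]] := cf; exact.
rewrite -derive_coord // (derive_dirE _ oU (Ck_on_coord j oU cf)) //.
by apply: eq_bigr => i _; rewrite mxE derive_coord.
Qed.

Lemma is_derive_comp_C1_vec (V : normedModType R) (n m : nat)
    (f : 'rV[R]_n -> 'rV[R]_m) (U : set 'rV[R]_n) (G : V -> 'rV[R]_n) x v dG :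
  open U -> Ck_on 1 U f -> U (G x) -> is_derive x v G dG ->
  is_derive x v (f \o G) ('D_dG f (G x)).
Proof.
move=> oU cf UGx hG.
have h i := is_derive_comp_C1 oU (Ck_on_coord i oU cf) UGx hG.
have df w : derivable f (G x) w by have [_ /(_ w)[+ _]] := cf; exact.
have d : derivable (f \o G) x v.
  by apply/derivable_mxP => i j; rewrite ord1; have [] := h j.
split; first exact: d.
apply/rowP => j; rewrite -(derive_coord j d) -(derive_coord j (df dG)).
have [_ ->] := h j.
by rewrite (derive_dirE _ oU (Ck_on_coord j oU cf)).
Qed.

Lemma C1_strict (n m : nat) (f : 'rV[R]_n -> 'rV[R]_m) (U : set 'rV[R]_n) x (e : R) :
  open U -> Ck_on 1 U f -> U x -> 0 < e ->
  exists2 r : R, 0 < r & forall u u', `|x - u| < r -> `|x - u'| < r ->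
   `|f u - f u' - 'D_(u - u') f x| <= e * `|u - u'|.
Proof.
move=> oU cf Ux e0.
have df w : derivable f x w by have [_ /(_ w)[+ _]] := cf; exact.
have /choice[rr hrr] : forall i : 'I_m, exists r : R, 0 < r /\
    forall u u', `|x - u| < r -> `|x - u'| < r ->
   `|f u 0 i - f u' 0 i - \sum_(j < n) (u - u') 0 j * 'D_('e_j) (fun z => f z 0 i) x|
      <= e * `|u - u'|.
  move=> i.
  have [r r0 hr] := C1_strict_scalar oU (Ck_on_coord i oU cf) Ux e0.
  by exists r.
pose r := \big[Num.min/1]_i rr i.
have r0 : 0 < r by apply: lt_bigmin => // i _; have [] := hrr i.
exists r => // u u' xu xu'.
apply/rV_norm_leP => [|i]; first by rewrite mulr_ge0 // ltW.
have rri : r <= rr i by exact: bigmin_le.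
have [_ /(_ u u')] := hrr i.
move=> /(_ (lt_le_trans xu rri) (lt_le_trans xu' rri)).
by rewrite -(derive_dirE _ oU (Ck_on_coord i oU cf)) // derive_coord // !mxE.
Qed.

Lemma derive_comm (V : normedModType R) (f : V -> R) (U : set V) x a b :
  open U -> Ck_on 2 U f -> U x ->
  'D_a ('D_b f) x = 'D_b ('D_a f) x.
Proof.
move=> oU [cf df] Ux.
have [fa [cfa dfa]] := df a; have [fb [cfb dfb]] := df b.
have [fab [cfab _]] := dfb a; have [fba [cfba _]] := dfa b.
apply/eqP; rewrite -subr_eq0 -normr_le0; apply/ler_addgt0Pr => e e0.
rewrite add0r.
have e20 : 0 < e / 2 by rewrite divr_gt0.
have [r0 r00 hr0] := open_ballP oU Ux.
have [r1 r10 hr1] := continuous_ballP (cfab _ Ux) e20.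
have [r2 r20 hr2] := continuous_ballP (cfba _ Ux) e20.
pose r := Num.min r0 (Num.min r1 r2).
have rpos : 0 < r by rewrite !lt_min r00 r10.
pose M := `|a| + `|b| + 1.
have M0 : 0 < M by rewrite ltr_wpDl // addr_ge0.
pose h := r / M.
have h0 : 0 < h by rewrite divr_gt0.
have near_x (s t : R) : 0 <= s <= 1 -> 0 <= t <= 1 ->
    `|x - (x + (s * h) *: a + (t * h) *: b)| < r.
  move=> /andP[s0 s1] /andP[t0 t1].
  rewrite -addrA opprD addrA subrr sub0r normrN.
  apply: le_lt_trans (ler_normD _ _) _; rewrite [`|_ *: a|]normrZ [`|_ *: b|]normrZ.
  rewrite (ger0_norm (mulr_ge0 s0 (ltW h0))) (ger0_norm (mulr_ge0 t0 (ltW h0))).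
  apply: le_lt_trans (_ : h * `|a| + h * `|b| < _).
    by rewrite lerD // ler_wpM2r // ger_pMl.
  rewrite -mulrDr mulrC -ltr_pdivlMr // /h invf_div mulrCA divff ?gt_eqF //.
  by rewrite mulr1 /M ltrDl.
have inU y : `|x - y| < r -> U y.
  by move=> xy; apply: hr0; apply: lt_le_trans xy _; rewrite ge_min lexx.
pose S := f (x + h *: a + h *: b) - f (x + h *: a) - (f (x + h *: b) - f x).
(* The second difference of [f] evaluated by the mean value theorem in the two
   possible orders. *)
have one01 : 0 <= (1 : R) <= 1 by rewrite ler01 lexx.
have zero01 : 0 <= (0 : R) <= 1 by rewrite ler01 lexx.
have [y1 y1r E1] : exists2 y, `|x - y| < r & S = h * (h * 'D_b ('D_a f) y).
  pose g := (fun y => f (y + h *: b) - f y) : V -> R.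
  pose U' := [set y | U y /\ U (y + h *: b)].
  have dg y : U' y -> is_derive y a g ('D_a f (y + h *: b) - 'D_a f y).
    move=> [Uy Uyb]; apply: is_deriveB; last by split=> //; exact: fa.
    have E : (fun k : R => k^-1 *: (((fun z => f (z + h *: b)) \o shift y) (k *: a)
        - f (y + h *: b))) =
      (fun k : R => k^-1 *: ((f \o shift (y + h *: b)) (k *: a) - f (y + h *: b))).
      by apply/funext => k /=; rewrite addrA.
    by split; [rewrite /derivable E; exact: fa|rewrite /derive E].
  have [||s s01 Es] := @MVT_line _ _ g U' x a h.
  - move=> s s01; split.
      by apply: inU; have := near_x s 0 s01 zero01; rewrite mul0r scale0r addr0.
    by apply: inU; have := near_x s 1 s01 one01; rewrite mul1r.
  - by move=> y /dg[].
  have U's : U' (x + (s * h) *: a).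
    split.
      by apply: inU; have := near_x s 0 s01 zero01; rewrite mul0r scale0r addr0.
    by apply: inU; have := near_x s 1 s01 one01; rewrite mul1r.
  have [_ E] := dg _ U's; rewrite E in Es.
  have [||t t01 Et] := @MVT_line _ _ ('D_a f) U (x + (s * h) *: a) b h.
  - by move=> t t01; apply: inU; exact: near_x.
  - by move=> y; exact: fba.
  exists (x + (s * h) *: a + (t * h) *: b); first exact: near_x.
  by rewrite -Et -Es /S /g; ring.
have [y2 y2r E2] : exists2 y, `|x - y| < r & S = h * (h * 'D_a ('D_b f) y).
  pose g := (fun y => f (y + h *: a) - f y) : V -> R.
  pose U' := [set y | U y /\ U (y + h *: a)].
  have dg y : U' y -> is_derive y b g ('D_b f (y + h *: a) - 'D_b f y).
    move=> [Uy Uyb]; apply: is_deriveB; last by split=> //; exact: fb.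
    have E : (fun k : R => k^-1 *: (((fun z => f (z + h *: a)) \o shift y) (k *: b)
        - f (y + h *: a))) =
      (fun k : R => k^-1 *: ((f \o shift (y + h *: a)) (k *: b) - f (y + h *: a))).
      by apply/funext => k /=; rewrite addrA.
    by split; [rewrite /derivable E; exact: fb|rewrite /derive E].
  have U's s : 0 <= s <= 1 -> U' (x + (s * h) *: b).
    move=> s01; split.
      by apply: inU; have := near_x 0 s zero01 s01; rewrite mul0r scale0r addr0.
    by apply: inU; have := near_x 1 s one01 s01; rewrite mul1r addrAC.
  have [||s s01 Es] := @MVT_line _ _ g U' x b h.
  - by move=> s s01; exact: U's.
  - by move=> y /dg[].
  have [_ E] := dg _ (U's _ s01); rewrite E in Es.
  have [||t t01 Et] := @MVT_line _ _ ('D_b f) U (x + (s * h) *: b) a h.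
  - by move=> t t01; apply: inU; rewrite addrAC; exact: near_x.
  - by move=> y; exact: fab.
  exists (x + (t * h) *: a + (s * h) *: b); first exact: near_x.
  rewrite [in RHS]addrAC -Et -Es /S /g [x + h *: b + _]addrAC; ring.
have E : 'D_b ('D_a f) y1 = 'D_a ('D_b f) y2.
  have hh : h != 0 by rewrite gt_eqF.
  exact: (mulfI hh (mulfI hh (etrans (esym E1) E2))).
have B1 : `|'D_a ('D_b f) x - 'D_a ('D_b f) y2| < e / 2.
  by apply: hr1; apply: lt_le_trans y2r _; rewrite !ge_min lexx orbT.
have B2 : `|'D_b ('D_a f) x - 'D_b ('D_a f) y1| < e / 2.
  by apply: hr2; apply: lt_le_trans y1r _; rewrite !ge_min lexx !orbT.
have aux (p q s t : R) : s = t -> `|p - t| < e / 2 -> `|q - s| < e / 2 ->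
    `|p - q| <= e.
  move=> -> h1 h2; rewrite -(subrKA t) -[t - q]opprB (splitr e).
  exact: le_trans (ler_normB _ _) (lerD (ltW h1) (ltW h2)).
exact: aux E B1 B2.
Qed.

End RowVectors.

(** * The inverse function theorem *)

Section InverseFunction.
Context (R : realType).

Lemma continuous_ballI (V W : normedModType R) (f : V -> W) x :
  (forall e : R, 0 < e ->
    exists2 d : R, 0 < d & forall v, `|x - v| < d -> `|f x - f v| < e) ->
  {for x, continuous f}.
Proof.
move=> h; suff : f v @[v --> x] --> f x by [].
apply/cvgrPdist_lt => e /h[d d0 hd].
by apply/nbhs_ballP; exists d => // v; rewrite -ball_normE => /hd.
Qed.

Lemma small_scaling (r m : R) : 0 < r -> 0 <= m -> exists2 h : R, 0 < h & h * m < r.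
Proof.
move=> r0 m0; exists (r / (m + 1)); first by rewrite divr_gt0 // ltr_wpDl.
by rewrite mulrAC ltr_pdivrMr ?ltr_wpDl // ltr_pM2l // ltrDl.
Qed.

Lemma norm_le3 (V : normedModType R) (a b c : V) :
  `|a| <= `|b| + (`|c - b| + `|c - a|).
Proof.
have {1}-> : a = b + (c - b) - (c - a) by rewrite [b + _]addrC subrK subKr.
by apply: le_trans (ler_normB _ _) _; rewrite [X in _ <= X]addrA lerD2r ler_normD.
Qed.

Lemma compact_closed_ball (n : nat) (x : 'rV[R]_n) (r : R) : 0 < r ->
  compact [set u | `|x - u| <= r].
Proof.
move=> r0; apply: bounded_closed_compact; last first.
  rewrite -[X in closed X]/(closed_ball_ Num.Def.normr x r) -closed_ballE //.
  exact: closed_ball_closed.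
exists (`|x| + r); split; first exact: num_real.
move=> M hM u /= xu; apply: le_trans (ltW hM).
have -> : u = x - (x - u) by rewrite subKr.
by apply: le_trans (ler_normB _ _) _; rewrite lerD2l.
Qed.

(** A contraction condition with constant 1/2 on [y - id]: the usual form of the inverse function
    theorem once the differential is normalized to the identity. *)
Definition near_translation (n : nat) (y : 'rV[R]_n -> 'rV[R]_n) u0 (r : R) :=
  forall u u', `|u0 - u| < r -> `|u0 - u'| < r ->
    `|y u - y u' - (u - u')| <= 2^-1 * `|u - u'|.

Lemma near_translation_lower (n : nat) (y : 'rV[R]_n -> 'rV[R]_n) u0 (r : R) u u' :
  near_translation y u0 r -> `|u0 - u| < r -> `|u0 - u'| < r ->
  `|u - u'| <= 2 * `|y u - y u'|.
Proof.
move=> hy hu hu'; have := hy _ _ hu hu' => h.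
have : `|u - u'| <= `|y u - y u'| + `|y u - y u' - (u - u')|.
  have {1}-> : u - u' = (y u - y u') - (y u - y u' - (u - u')) by rewrite subKr.
  exact: ler_normB.
by move: h; lra.
Qed.

Lemma near_translation_upper (n : nat) (y : 'rV[R]_n -> 'rV[R]_n) u0 (r : R) u u' :
  near_translation y u0 r -> `|u0 - u| < r -> `|u0 - u'| < r ->
  `|y u - y u'| <= 2 * `|u - u'|.
Proof.
move=> hy hu hu'; have := hy _ _ hu hu' => h.
have : `|y u - y u'| <= `|u - u'| + `|y u - y u' - (u - u')|.
  have {1}-> : y u - y u' = (u - u') + (y u - y u' - (u - u')).
    by rewrite [RHS]addrC subrK.
  exact: ler_normD.
by have := normr_ge0 (u - u'); move: h; lra.
Qed.

Lemma near_translation_continuous (n : nat) (y : 'rV[R]_n -> 'rV[R]_n) u0 (r : R) u :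
  0 < r -> near_translation y u0 r -> `|u0 - u| < r -> {for u, continuous y}.
Proof.
move=> r0 hy hu; apply: continuous_ballI => e e0.
have [d d0 hd] : exists2 d : R, 0 < d & forall v, `|u - v| < d -> `|u0 - v| < r.
  apply: open_ballP (_ : [set v | `|u0 - v| < r] u) => //.
  by have := ball_open u0 r; rewrite -ball_normE.
exists (Num.min d (e / 2)); first by rewrite lt_min d0 divr_gt0.
move=> v; rewrite lt_min => /andP[hv1 hv2].
apply: le_lt_trans (near_translation_upper hy hu (hd _ hv1)) _.
by rewrite mulrC -ltr_pdivlMr.
Qed.

(* The point of a closed ball whose image is closest to [z] is a preimage. *)
Lemma near_translation_surj (n : nat) (y : 'rV[R]_n -> 'rV[R]_n) u0 (r : R) z :
  0 < r -> near_translation y u0 r -> `|y u0 - z| < r / 8 ->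
  exists2 u, `|u0 - u| < r & y u = z.
Proof.
move=> r0 hy hz.
pose A := [set u | `|u0 - u| <= r / 2].
have r20 : 0 < r / 2 by rewrite divr_gt0.
have Au0 : A u0 by rewrite /A /= subrr normr0 ltW.
have Ar u : A u -> `|u0 - u| < r by rewrite /A /= => h; apply: le_lt_trans h _; lra.
have cA : compact A by exact: compact_closed_ball.
pose N u := `|y u - z|.
have [||c /set_mem Ac hc] := @EVT_min_rV _ _ N A _ cA; first by exists u0.
  apply: continuous_in_subspaceT => u /set_mem Au.
  have cy := near_translation_continuous r0 hy (Ar _ Au).
  apply: (@continuous_ballI 'rV[R]_n R) => e e0.
  have [d d0 hd] := continuous_ballP cy e0.
  exists d => // v /hd; apply: le_lt_trans.
  apply: le_trans (ler_dist_dist _ _) _.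
  by rewrite opprB addrA subrK.
have c0 : N c <= N u0 by apply: hc; exact/mem_set.
(* The minimizer is interior: its distance to [u0] is at most [2 * (N u0 + N c) <= 4 * N u0], and
   [N u0 < r / 8]. *)
have cu : `|u0 - c| < r / 2.
  have xx : `|u0 - u0| < r by rewrite subrr normr0.
  have h1 := near_translation_lower hy xx (Ar _ Ac).
  have h2 : `|y u0 - y c| <= N u0 + N c.
    by rewrite /N -(subrKA z) -[z - y c]opprB; exact: ler_normB.
  by move: hz c0 h1 h2; rewrite -/(N u0); lra.
exists c; first exact: Ar.
apply/eqP; rewrite eq_sym -subr_eq0; apply/negPn/negP => dn0.
set d := z - y c in dn0.
have d0 : 0 < `|d| by rewrite normr_gt0.
(* Moving from [c] by [s *: d] moves [y] by [s *: d] up to an error of half that size, so the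
   distance to [z] drops by at least half of [s * |d|]. The second bound on [s] keeps the new point
   in [A]. *)
pose s := Num.min (1 / 2) ((r / 2 - `|u0 - c|) / `|d|).
have s0 : 0 < s by rewrite lt_min divr_gt0 //= divr_gt0 // subr_gt0.
have s1 : s <= 1 / 2 by rewrite ge_min lexx.
have sd : s * `|d| <= r / 2 - `|u0 - c|.
  by rewrite -ler_pdivlMr // ge_min lexx orbT.
have Ac' : A (c + s *: d).
  rewrite /A /= opprD addrA; apply: le_trans (ler_normB _ _) _.
  by rewrite normrZ gtr0_norm //; move: sd; lra.
have := hc _ (mem_set Ac').
have := hy _ _ (Ar _ Ac') (Ar _ Ac).
clearbody s.
have Ed : c + s *: d - c = s *: d by rewrite addrAC subrr add0r.
rewrite Ed normrZ (gtr0_norm s0) => h.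
have : N (c + s *: d) <= `|y (c + s *: d) - y c - s *: d| + (1 - s) * `|d|.
  have -> : (1 - s) * `|d| = `|(s - 1) *: d|.
    have s11 : 0 <= 1 - s by lra.
    by rewrite normrZ [X in _ = X * _]distrC (ger0_norm s11).
  rewrite /N; have -> : y (c + s *: d) - z = (y (c + s *: d) - y c - s *: d) + (s - 1) *: d.
    rewrite scalerBl scale1r addrA subrK -addrA -opprD /d [y c + _]addrC.
    by rewrite subrK.
  exact: ler_normD.
have -> : N c = `|d| by rewrite /N distrC.
have : 0 < s * `|d| by rewrite mulr_gt0.
by move: h; lra.
Qed.

Lemma smooth_on_det (V : normedModType R) (n : nat) (U : set V)
    (A : V -> 'M[R]_n) : open U ->
  (forall i j, smooth_on U (fun u => A u i j : R)) ->
  smooth_on U (fun u => \det (A u) : R).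
Proof.
move=> oU hA; apply: smooth_on_sum => // s.
apply: smooth_onM => //; first exact: (@smooth_on_cst _ V R).
by apply: smooth_on_prod => // i; exact: hA.
Qed.

Lemma smooth_on_invmx (V : normedModType R) (n : nat) (U : set V)
    (A : V -> 'M[R]_n) i j : open U ->
  (forall u, U u -> A u \in unitmx) ->
  (forall i j, smooth_on U (fun u => A u i j : R)) ->
  smooth_on U (fun u => invmx (A u) i j : R).
Proof.
move=> oU hu hA.
have h1 : smooth_on U (fun u => (\det (A u))^-1 * cofactor (A u) j i : R).
  apply: smooth_onM => //.
    apply: smooth_onV => //; last exact: smooth_on_det.
    by move=> u /hu; rewrite unitmxE unitfE.
  apply: smooth_onM => //; first exact: (@smooth_on_cst _ V R).
  apply: smooth_on_det => // k l.
  apply: smooth_on_eq (hA (lift j k) (lift i l)) => // u _.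
  by rewrite !mxE.
apply: (smooth_on_eq oU _ h1) => u Uu.
by rewrite /invmx hu // mxE [\adj _ _ _]mxE.
Qed.

Definition jacobian_at (n m : nat) (y : 'rV[R]_n -> 'rV[R]_m) (u : 'rV[R]_n) :
    'M[R]_(n, m) :=
  \matrix_(i, j) ('D_('e_i) y u) 0 j.

Lemma jacobian_atE (n m : nat) (y : 'rV[R]_n -> 'rV[R]_m) U u v :
  open U -> Ck_on 1 U y -> U u -> 'D_v y u = v *m jacobian_at y u.
Proof.
move=> oU cy Uu; rewrite (derive_dirE_vec _ oU cy Uu).
apply/rowP => j; rewrite summxE !mxE; apply: eq_bigr => i _.
by rewrite !mxE.
Qed.

(** The differential at [u0] is normalized to the identity, which the gnomonic coordinates satisfy.
    Smoothness of [g] is expressed through all compositions [F \o g], a class closed under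
    differentiation. *)
Lemma inverse_function (n : nat) (y : 'rV[R]_n -> 'rV[R]_n) (U : set 'rV[R]_n) u0 :
  open U -> smooth_on U y -> U u0 -> (forall v, 'D_v y u0 = v) ->
  exists r rho : R, exists g : 'rV[R]_n -> 'rV[R]_n,
    [/\ 0 < r /\ 0 < rho,
        (forall u, `|u0 - u| < r -> U u) /\
        (forall u u', `|u0 - u| < r -> `|u0 - u'| < r ->
          `|u - u'| <= 2 * `|y u - y u'|),
        forall z, `|y u0 - z| < rho -> `|u0 - g z| < r /\ y (g z) = z,
        (forall z d, `|y u0 - z| < rho ->
          exists2 v, is_derive z d g v & 'D_v y (g z) = d) &
        forall F : 'rV[R]_n -> R, smooth_on U F ->
          smooth_on [set z | `|y u0 - z| < rho] (F \o g)].
Proof.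
move=> oU sy Uu0 dy0.
have cy : Ck_on 1 U y by exact: sy.
have [r1 r10 hr1] := open_ballP oU Uu0.
have h20 : 0 < 2^-1 :> R by rewrite invr_gt0.
have [r2 r20 hr2] := C1_strict oU cy Uu0 h20.
pose r := Num.min r1 r2.
have r0 : 0 < r by rewrite lt_min r10.
have rU u : `|u0 - u| < r -> U u.
  by rewrite lt_min => /andP[h _]; exact: hr1.
have hy : near_translation y u0 r.
  move=> u u'; rewrite !lt_min => /andP[_ h1] /andP[_ h2].
  by have := hr2 _ _ h1 h2; rewrite dy0.
pose B := [set u | `|u0 - u| < r].
have oB : open B by have := ball_open u0 r; rewrite -ball_normE.
(* Strictly inside the ball the differential stays within 3/4 of the identity. *)
have dlow u v : B u -> `|v| <= 4 * `|'D_v y u|.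
  move=> Bu.
  have h40 : 0 < 4^-1 :> R by rewrite invr_gt0.
  have [r3 r30 hr3] := C1_strict oU cy (rU _ Bu) h40.
  have [r4 r40 hr4] := open_ballP oB Bu.
  have r340 : 0 < Num.min r3 r4 by rewrite lt_min r30.
  have [h h0] := small_scaling r340 (normr_ge0 v).
  rewrite lt_min => /andP[h3 h4].
  have hN : `|u - (u + h *: v)| = h * `|v|.
    by rewrite opprD addrA subrr sub0r normrN normrZ gtr0_norm.
  have hD : u + h *: v - u = h *: v by rewrite addrAC subrr add0r.
  have Bh : B (u + h *: v) by apply: hr4; rewrite hN.
  have := hy _ _ Bh Bu; rewrite hD => e1.
  have := hr3 (u + h *: v) u; rewrite hN subrr normr0 hD => /(_ h3 r30) e2.
  have E : 'D_(h *: v) y u = h *: 'D_v y u.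
    by rewrite !(jacobian_atE _ oU cy (rU _ Bu)) scalemxAl.
  rewrite E in e2.
  have nh w : `|h *: w| = h * `|w| :> R by rewrite normrZ gtr0_norm.
  have : h * `|v| <= h * `|'D_v y u| + (4^-1 + 2^-1) * (h * `|v|).
    rewrite -!nh.
    apply: le_trans (norm_le3 _ (h *: 'D_v y u) (y (u + h *: v) - y u)) _.
    by rewrite mulrDl lerD2l lerD.
  have -> : h * `|'D_v y u| + (4^-1 + 2^-1) * (h * `|v|) =
    h * (`|'D_v y u| + (4^-1 + 2^-1) * `|v|) by ring.
  by rewrite ler_pM2l //; lra.
have Junit u : B u -> jacobian_at y u \in unitmx.
  move=> Bu; rewrite -row_free_unit -kermx_eq0; apply/eqP/row_matrixP => i.
  rewrite row0; apply/eqP; rewrite -normr_le0.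
  apply: le_trans (dlow _ _ Bu) _.
  rewrite (jacobian_atE _ oU cy (rU _ Bu)) -row_mul mulmx_ker row0.
  by rewrite normr0 mulr0.
pose rho := r / 8.
have rho0 : 0 < rho by rewrite divr_gt0.
have /choice[g hg] : forall z, exists u, `|y u0 - z| < rho -> `|u0 - u| < r /\ y u = z.
  move=> z; case: (ltP `|y u0 - z| rho) => [h|_]; last by exists u0.
  by have [u u1 u2] := near_translation_surj r0 hy h; exists u.
pose Z := [set z | `|y u0 - z| < rho].
have oZ : open Z by have := ball_open (y u0) rho; rewrite -ball_normE.
have gB z : Z z -> B (g z) by move=> /hg[].
have gK z : Z z -> y (g z) = z by move=> /hg[].
have glip z z' : Z z -> Z z' -> `|g z - g z'| <= 2 * `|z - z'|.
  move=> hz hz'.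
  by have := near_translation_lower hy (gB _ hz) (gB _ hz'); rewrite !gK.
have gder z d : Z z -> is_derive z d g (d *m invmx (jacobian_at y (g z))).
  move=> Zz; set v := d *m _.
  have yv : 'D_v y (g z) = d.
    rewrite (jacobian_atE _ oU cy (rU _ (gB _ Zz))).
    by rewrite mulmxKV // Junit //; exact: gB.
  suff main : (fun h : R => h^-1 *: ((g \o shift z) (h *: d) - g z)) h
      @[h --> 0^'] --> v.
    by split; [apply/cvg_ex; exists v|exact/cvg_lim].
  apply/cvgrPdist_lt => e e0.
  (* The lower bound 4 for the differential and the Lipschitz constant 2 of [g] multiply to 8, and
     [8 * |d| < 9 * (|d| + 1)]. *)
  pose e' := e / (9 * (`|d| + 1)).
  have d1 : 0 < `|d| + 1 by rewrite ltr_wpDl.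
  have e'0 : 0 < e' by rewrite divr_gt0 // mulr_gt0.
  have [r3 r30 hr3] := C1_strict oU cy (rU _ (gB _ Zz)) e'0.
  have [r4 r40 hr4] := open_ballP oZ Zz.
  have c0 : 0 < Num.min (r3 / 2) r4 / (`|d| + 1) by rewrite divr_gt0 // lt_min divr_gt0.
  near=> h.
  have h0 : h != 0 by near: h; exact: nbhs_dnbhs_neq.
  have : `|h| < Num.min (r3 / 2) r4 / (`|d| + 1) by near: h; exact: dnbhs0_lt.
  rewrite ltr_pdivlMr // => hh.
  have : `|h *: d| < Num.min (r3 / 2) r4.
    by apply: le_lt_trans hh; rewrite normrZ ler_wpM2l // lerDl.
  rewrite lt_min => /andP[h3 h4].
  rewrite /= [h *: d + z]addrC.
  have zD : `|z + h *: d - z| = `|h *: d| by rewrite addrAC subrr add0r.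
  have Zh : Z (z + h *: d) by apply: hr4; rewrite distrC zD.
  set D := g (z + h *: d) - g z.
  have Dl : `|D| <= 2 * `|h *: d| by rewrite -zD; exact: glip.
  have := hr3 (g (z + h *: d)) (g z).
  rewrite -/D !gK // subrr normr0 [z + _ - _]addrAC subrr add0r.
  have D3 : `|g z - g (z + h *: d)| < r3.
    by rewrite distrC -/D; apply: le_lt_trans Dl _; move: h3; lra.
  move=> /(_ D3 r30).
  have -> : h *: d - 'D_D y (g z) = 'D_(h *: v - D) y (g z).
    rewrite -yv !(jacobian_atE _ oU cy (rU _ (gB _ Zz))).
    by rewrite scalemxAl -[LHS]mulmxBl.
  move=> bnd.
  have b1 := dlow _ (h *: v - D) (gB _ Zz).
  have -> : v - h^-1 *: D = h^-1 *: (h *: v - D).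
    by rewrite [RHS]scalerBr scalerA mulVf // scale1r.
  have ah : 0 < `|h| by rewrite normr_gt0.
  rewrite normrZ normfV mulrC ltr_pdivrMr //.
  apply: le_lt_trans b1 _.
  apply: le_lt_trans (_ : 4 * (e' * (2 * `|h *: d|)) < _).
    by rewrite ler_wpM2l //; apply: le_trans bnd _; rewrite ler_wpM2l // ltW.
  have -> : 4 * (e' * (2 * `|h *: d|)) = (e' * (8 * `|d|)) * `|h|.
    by rewrite normrZ; ring.
  rewrite ltr_pM2r // /e' mulrAC ltr_pdivrMr; last by rewrite mulr_gt0.
  by rewrite ltr_pM2l //; have := normr_ge0 d; lra.
have gcont z : Z z -> {for z, continuous g}.
  move=> Zz; apply: continuous_ballI => e e0.
  have [d d0 hd] := open_ballP oZ Zz.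
  exists (Num.min d (e / 2)); first by rewrite lt_min d0 divr_gt0.
  move=> z'; rewrite lt_min => /andP[h1 h2].
  by apply: le_lt_trans (glip _ _ Zz (hd _ h1)) _; rewrite mulrC -ltr_pdivlMr.
exists r, rho, g; split => //.
- split => // u u'; exact: near_translation_lower.
- move=> z d Zz; exists (d *m invmx (jacobian_at y (g z))); first exact: gder.
  by rewrite (jacobian_atE _ oU cy (rU _ (gB _ Zz))) mulmxKV // Junit //; exact: gB.
suff H k (F : 'rV[R]_n -> R) : smooth_on B F -> Ck_on k Z (F \o g).
  by move=> F sF k; apply: H; exact: smooth_on_sub sF.
(* [D_d (F \o g) = G \o g] with [G] again smooth, so induct on [k]. *)
elim: k F => [|k IH] F sF.
  split => // z Zz; apply: continuous_comp; first exact: gcont.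
  by apply: (smooth_on_continuous sF); exact: gB.
split.
  move=> z Zz; apply: continuous_comp; first exact: gcont.
  by apply: (smooth_on_continuous sF); exact: gB.
move=> d.
pose G u := \sum_(i < n) (d *m invmx (jacobian_at y u)) 0 i * 'D_('e_i) F u.
have sG : smooth_on B G.
  apply: (@smooth_on_sum _ _ R) => // i; apply: smooth_onM => //; last exact: smooth_on_derive.
  have h1 : smooth_on B (fun u => \sum_(j < n) d 0 j * invmx (jacobian_at y u) j i : R).
    apply: smooth_on_sum => // j; apply: smooth_onM => //; first exact: (@smooth_on_cst _ _ R).
    apply: smooth_on_invmx => // k1 k2.
    have h2 := smooth_on_coord k2 oB (smooth_on_derive 'e_k1 (smooth_on_sub rU sy)).
    by apply: (smooth_on_eq oB _ h2) => u _; rewrite mxE.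
  by apply: (smooth_on_eq oB _ h1) => u _; rewrite mxE.
have dF z : Z z -> is_derive z d (F \o g) (G (g z)).
  move=> Zz; apply: (is_derive_comp_C1 oB) (gder _ _ Zz); first exact: sF.
  exact: gB.
split; first by move=> z /dF[].
by apply: Ck_on_eq (IH _ sG) => // z /dF[_ ->].
Unshelve. all: by end_near. Qed.

End InverseFunction.

(** * Graphs with Hessian of rank one *)

Section Developable.
Context (R : realType).

Lemma MVT_origin (q dq : R -> R) (d t : R) : `|t| < d ->
  (forall s, `|s| < d -> is_derive s (1 : R) q (dq s)) ->
  exists2 s, `|s| <= `|t| & q t - q 0 = dq s * t.
Proof.
move=> td hq.
have cq (a b : R) : `|a| < d -> `|b| < d -> {within `[a, b], continuous q}.
  move=> ad bd; apply: derivable_within_continuous => x; rewrite in_itv /= => /andP[ax xb].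
  have [] // := hq x _.
  by move: ad bd; rewrite !ltr_norml => /andP[? ?] /andP[? ?]; apply/andP; split; lra.
have d0 : `|0 : R| < d by rewrite normr0; apply: le_lt_trans td.
have inn (a b x : R) : `|a| < d -> `|b| < d -> x \in `]a, b[ -> `|x| < d.
  rewrite in_itv /= !ltr_norml => /andP[? ?] /andP[? ?] /andP[? ?].
  by apply/andP; split; lra.
case: (lerP 0 t) => t0.
  have [||c] := @MVT_segment _ q dq 0 t t0.
  - by move=> x x0; apply: hq; exact: inn x0.
  - exact: cq.
  rewrite in_itv /= subr0 => /andP[c0 ct] E; exists c => //.
  by rewrite !ger0_norm.
have [||c] := @MVT_segment _ q dq t 0 (ltW t0).
- by move=> x x0; apply: hq; exact: inn x0.
- exact: cq.
rewrite in_itv /= sub0r => /andP[c0 ct] E; exists c.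
  by rewrite ler0_norm // ltr0_norm // lerN2.
by rewrite -opprB E mulrN opprK.
Qed.

(** Gronwall: [q * q * expR (- (2 * C) * s)] has derivative [2 * (p - C)] times itself. It is
    therefore nonincreasing, starts at 0 and cannot be negative. *)
Lemma linear_ode_zero_ge0 (q p : R -> R) (d C t : R) : 0 <= t -> t < d ->
  (forall s, `|s| < d -> is_derive s (1 : R) q (q s * p s)) ->
  (forall s, `|s| < d -> `|p s| <= C) -> q 0 = 0 -> q t = 0.
Proof.
move=> t0 td hq hp q0.
pose E s := q s * q s * expR (- (2 * C) * s).
have hE s : `|s| < d ->
    is_derive s (1 : R) E (q s * q s * expR (- (2 * C) * s) * (2 * (p s - C))).
  move=> sd; have h1 := hq _ sd.
  have h2 : is_derive s (1 : R) (fun s => - (2 * C) * s) (- (2 * C)).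
    have -> : (fun s => - (2 * C) * s) = (- (2 * C)) \*: (@id R) by apply/funext.
    by apply: is_derive_eq; rewrite /GRing.scale /= mulr1.
  have h3 := is_derive1_comp (is_derive_expR (- (2 * C) * s)) h2.
  have h4 := is_deriveM (is_deriveM h1 h1) h3.
  apply: is_derive_eq h4 _; rewrite /GRing.scale /=.
  set X := expR _; change ((q * q) s) with (q s * q s); ring.
have [|s sd] := @MVT_origin E _ d t _ hE; first by rewrite ger0_norm.
rewrite /E q0 !mul0r subr0 => Et.
have : q t * q t * expR (- (2 * C) * t) <= 0.
  rewrite Et mulr_le0_ge0 // mulr_ge0_le0 //.
    by rewrite mulr_ge0 ?expR_ge0 // -expr2 sqr_ge0.
  have : `|p s| <= C by apply: hp; apply: le_lt_trans sd _; rewrite ger0_norm.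
  by rewrite ler_norml => /andP[_]; lra.
rewrite pmulr_lle0 ?expR_gt0 // => h; apply/eqP.
by rewrite -[_ == 0]orbb -mulf_eq0 eq_le h -expr2 sqr_ge0.
Qed.

Lemma linear_ode_zero (q p : R -> R) (d C t : R) : `|t| < d ->
  (forall s, `|s| < d -> is_derive s (1 : R) q (q s * p s)) ->
  (forall s, `|s| < d -> `|p s| <= C) -> q 0 = 0 -> q t = 0.
Proof.
move=> td hq hp q0; case: (lerP 0 t) => t0.
  by apply: linear_ode_zero_ge0 hq hp q0 => //; rewrite -(ger0_norm t0).
have nt0 : 0 <= - t by lra.
have ntd : - t < d by rewrite -(ltr0_norm t0).
rewrite -[t]opprK.
apply: (@linear_ode_zero_ge0 (fun s => q (- s)) (fun s => - p (- s)) d C) => //.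
- move=> s sd.
  have h1 : is_derive s (1 : R) (fun s : R => - s) (- 1).
    exact: is_deriveN.
  rewrite -normrN in sd.
  have := @is_derive1_comp _ q (fun s : R => - s) s _ _ (hq _ sd) h1.
  by move=> h; apply: is_derive_eq h _; ring.
- by move=> s sd; rewrite normrN; apply: hp; rewrite normrN.
- by rewrite oppr0.
Qed.

Lemma zero_derive_cst (q : R -> R) (d t : R) : `|t| < d ->
  (forall s, `|s| < d -> is_derive s (1 : R) q 0) -> q t = q 0.
Proof.
move=> td hq; have [s _ E] := @MVT_origin q (fun=> 0) d t td hq.
by apply/eqP; rewrite -subr_eq0 E mul0r.
Qed.

Lemma is_derive_ray (V : normedModType R) (F : V -> R) a (t : R) :
  derivable F (t *: a) a ->
  is_derive t (1 : R) (fun s : R => F (s *: a)) ('D_a F (t *: a)).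
Proof.
move=> dF; have dF0 : derivable F (0 + t *: a) a by rewrite add0r.
have := is_derive_line dF0; rewrite add0r.
by congr (is_derive _ _ _ _); apply/funext => s; rewrite add0r.
Qed.

Lemma smooth_deriveM (V : normedModType R) (U : set V) (f g : V -> R) x v :
  smooth_on U f -> smooth_on U g -> U x ->
  'D_v (fun y => f y * g y) x = f x * 'D_v g x + g x * 'D_v f x.
Proof.
move=> sf sg Ux.
have df : derivable f x v := smooth_on_derivable sf Ux.
have dg : derivable g x v := smooth_on_derivable sg Ux.
by rewrite [LHS](deriveM df dg).
Qed.

(** The two equations are [A * H = K * K] differentiated once and twice along [b], read where [A]
    and [K] vanish; the suffixes count derivatives along [b]. The first equation kills [Ab], which
    leaves a single relation in the second. *)
Lemma axis_algebra (A H K Ab Abb Hb Hbb Kb Kbb : R) :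
  A = 0 -> K = 0 -> H != 0 ->
  A * Hb + H * Ab = K * Kb + K * Kb ->
  A * Hbb + Hb * Ab + (H * Abb + Ab * Hb) = K * Kbb + Kb * Kb + (K * Kbb + Kb * Kb) ->
  Abb * H = 2 * (Kb * Kb).
Proof.
move=> -> -> Hn; rewrite !mul0r !add0r => e1 e2.
have Ab0 : Ab = 0 by move/eqP: e1; rewrite mulf_eq0 (negbTE Hn) orFb => /eqP.
by move: e2; rewrite Ab0 mulr0 mul0r addr0 add0r mulrC => ->; ring.
Qed.

(* [A], [K], [H] play the roles of w_aa, w_ab, w_bb with w_aa w_bb = w_ab^2. *)
Lemma monge_ampere_axis (V : normedModType R) (U : set V) (A H K : V -> R) a b :
  open U -> U 0 -> smooth_on U A -> smooth_on U H -> smooth_on U K ->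
  (forall z, U z -> A z * H z = K z * K z) ->
  (forall z, U z -> 'D_a K z = 'D_b A z) ->
  (forall z, U z -> 'D_a H z = 'D_b K z) ->
  A 0 = 0 -> H 0 != 0 ->
  exists2 d : R, 0 < d & exists r0 r1 : R, forall t, `|t| < d ->
    [/\ U (t *: a), A (t *: a) = 0, K (t *: a) = 0 &
        H (t *: a) * (r0 + r1 * t) = 1].
Proof.
move=> oU U0 sA sH sK AH DK DH A0 H0.
have cH : {for 0, continuous H} by exact: smooth_on_continuous sH U0.
have nH0 : 0 < `|H 0| by rewrite normr_gt0.
have [r1 r10 hr1] := open_ballP oU U0.
have [r2 r20 hr2] := continuous_ballP cH nH0.
(* Differentiating the equation along [b] and replacing [A] by [K * K / H] gives ['D_b A = K * P].
   Since ['D_a K = 'D_b A], [K] solves a linear equation along the axis whose coefficient [P] is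
   bounded near 0 by continuity. *)
pose P z := (2 * 'D_b K z - K z * 'D_b H z / H z) / H z.
have cP : {for 0, continuous P}.
  have cb F : smooth_on U F -> {for 0, continuous ('D_b F)}.
    by move=> sF; apply: smooth_on_continuous U0; exact: smooth_on_derive.
  have cK := smooth_on_continuous sK U0.
  have cV : {for 0, continuous (fun z => (H z)^-1)} by exact: continuousV.
  apply: continuousM => //; apply: continuousB.
    by apply: continuousM; [exact: cst_continuous|exact: cb].
  by apply: continuousM => //; apply: continuousM => //; exact: cb.
have [r3 r30 hr3] := continuous_ballP cP ltr01.
pose r := Num.min r1 (Num.min r2 r3).
have r0 : 0 < r by rewrite !lt_min r10 r20.
have [d d0 hd] := small_scaling r0 (normr_ge0 a).
have ball t : `|t| < d -> `|0 - t *: a| < r.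
  move=> td; rewrite sub0r normrN normrZ; apply: le_lt_trans hd.
  by rewrite ler_wpM2r // ltW.
have inU t : `|t| < d -> U (t *: a).
  by move=> /ball; rewrite lt_min => /andP[h _]; exact: hr1.
have Hn0 t : `|t| < d -> H (t *: a) != 0.
  move=> /ball; rewrite !lt_min => /and3P[_ h _]; have := hr2 _ h.
  by apply: contraTneq => ->; rewrite subr0 ltxx.
have Pbd t : `|t| < d -> `|P (t *: a)| <= `|P 0| + 1.
  move=> /ball; rewrite !lt_min => /and3P[_ _ h]; have := hr3 _ h => h1.
  have -> : P (t *: a) = P 0 - (P 0 - P (t *: a)) by rewrite subKr.
  by apply: le_trans (ler_normB _ _) _; rewrite lerD2l ltW.
have line (F : V -> R) t : smooth_on U F -> `|t| < d ->
    is_derive t (1 : R) (fun s : R => F (s *: a)) ('D_a F (t *: a)).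
  move=> sF td; apply: is_derive_ray; apply: smooth_on_derivable sF _; exact: inU.
have id1 z : U z -> A z * 'D_b H z + H z * 'D_b A z = K z * 'D_b K z + K z * 'D_b K z.
  move=> Uz; have E := near_eq_derive b (open_near_eq oU AH Uz).
  exact: etrans (esym (smooth_deriveM b sA sH Uz)) (etrans E (smooth_deriveM b sK sK Uz)).
have id2 z : U z -> A z * 'D_b ('D_b H) z + 'D_b H z * 'D_b A z
    + (H z * 'D_b ('D_b A) z + 'D_b A z * 'D_b H z) =
    (K z * 'D_b ('D_b K) z + 'D_b K z * 'D_b K z) + (K z * 'D_b ('D_b K) z + 'D_b K z * 'D_b K z).
  have sA' := smooth_on_derive b sA; have sH' := smooth_on_derive b sH.
  have sK' := smooth_on_derive b sK.
  move=> Uz.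
  have dM (f g : V -> R) : smooth_on U f -> smooth_on U g -> derivable (fun y => f y * g y : R) z b.
    by move=> sf sg; apply: smooth_on_derivable Uz; exact: smooth_onM.
  have E := near_eq_derive b (open_near_eq oU id1 Uz).
  have EL := etrans (deriveD (dM _ _ sA sH') (dM _ _ sH sA'))
    (congr2 +%R (smooth_deriveM b sA sH' Uz) (smooth_deriveM b sH sA' Uz)).
  have ER := etrans (deriveD (dM _ _ sK sK') (dM _ _ sK sK'))
    (congr2 +%R (smooth_deriveM b sK sK' Uz) (smooth_deriveM b sK sK' Uz)).
  exact: etrans (esym EL) (etrans E ER).
have K0 t : `|t| < d -> K (t *: a) = 0.
  move=> td.
  apply: (@linear_ode_zero (fun t => K (t *: a)) (fun t => P (t *: a)) d (`|P 0| + 1)) => //.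
    move=> s sd; apply: is_derive_eq (line _ _ sK sd) _.
    have Us := inU _ sd; have Hs := Hn0 _ sd.
    rewrite DK // /P.
    have := id1 _ Us; have := AH _ Us.
    move: (A _) (H _) (K _) ('D_b H _) ('D_b A _) ('D_b K _) Hs.
    move=> A1 H1 K1 Hb Ab Kb Hs e1 e2.
    have A1E : A1 = K1 * K1 / H1 by rewrite -e1 mulfK.
    have -> : Ab = (K1 * Kb + K1 * Kb - A1 * Hb) / H1.
      by rewrite -e2 addrAC subrr add0r mulrAC divff // mul1r.
    by rewrite A1E; field.
  rewrite scale0r; have := AH _ U0; rewrite A0 mul0r => /esym/eqP.
  by rewrite mulf_eq0 orbb => /eqP.
have A0' t : `|t| < d -> A (t *: a) = 0.
  move=> td; have := AH _ (inU _ td); rewrite K0 // mul0r => /eqP.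
  by rewrite mulf_eq0 (negbTE (Hn0 _ td)) orbF => /eqP.
have sH' := smooth_on_derive a sH.
(* Symmetry of derivatives turns [Abb] and [Kb] into the second and first derivatives of [H] along
   [a]. The relation then says that [1 / H] has zero second derivative along the axis; [N] below is
   minus its first derivative. *)
have crit t : `|t| < d ->
    'D_a ('D_a H) (t *: a) * H (t *: a) = 2 * ('D_a H (t *: a) * 'D_a H (t *: a)).
  move=> td; have Ut := inU _ td.
  have Abb : 'D_b ('D_b A) (t *: a) = 'D_a ('D_a H) (t *: a).
    have -> : 'D_a ('D_a H) (t *: a) = 'D_a ('D_b K) (t *: a).
      by apply: near_eq_derive; exact: open_near_eq DH Ut.
    rewrite (derive_comm _ _ oU (sK 2%N) Ut); apply: near_eq_derive.
    by apply: open_near_eq Ut => // z Uz; rewrite DK.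
  have := @axis_algebra _ _ _ _ _ _ _ _ _ (A0' _ td) (K0 _ td) (Hn0 _ td)
    (id1 _ Ut) (id2 _ Ut).
  by rewrite Abb -(DH _ Ut).
pose N t := 'D_a H (t *: a) * ((H (t *: a))^-1 * (H (t *: a))^-1).
have dV t : `|t| < d -> is_derive t (1 : R) (fun s : R => (H (s *: a))^-1)
    (- N t).
  move=> td.
  have h1 := line _ _ sH td.
  have := @is_deriveV R (fun s : R => H (s *: a)) t _ (1 : R) (Hn0 _ td) h1.
  move=> h2; apply: is_derive_eq h2 _.
  rewrite /N /GRing.scale /= -exprVn expr2; ring.
have dN t : `|t| < d -> is_derive t (1 : R) N 0.
  move=> td.
  have h1 := line _ _ sH' td.
  have h2 := dV _ td.
  have h3 := is_deriveM h1 (is_deriveM h2 h2).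
  apply: is_derive_eq h3 _.
  have := crit _ td; have := Hn0 _ td; rewrite /N /GRing.scale /=.
  move: ('D_a ('D_a H) _) ('D_a H _) => Haa Ha.
  set Ht := H _ => Ht0 e1.
  have -> : Haa = 2 * (Ha * Ha) / Ht by rewrite -e1 mulfK.
  transitivity (Ha * (Ht^-1 * - (Ha * (Ht^-1 / Ht)) + Ht^-1 * - (Ha * (Ht^-1 / Ht)))
    + (Ht^-1 * Ht^-1) * (2 * (Ha * Ha) / Ht)); first by [].
  by field.
exists d => //; exists (H 0)^-1, (- N 0) => t td; split; rewrite ?A0' ?K0 //; first exact: inU.
have Nc s : `|s| < d -> N s = N 0 by move=> sd; exact: zero_derive_cst sd dN.
have dW s : `|s| < d -> is_derive s (1 : R) (fun s : R => (H (s *: a))^-1 + N 0 * s) 0.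
  move=> sd.
  have h2 : is_derive s (1 : R) (fun s => N 0 * s) (N 0).
    have -> : (fun s => N 0 * s) = (N 0) \*: (@id R) by apply/funext.
    by apply: is_derive_eq; rewrite /GRing.scale /= mulr1.
  have h3 := is_deriveD (dV _ sd) h2.
  by apply: is_derive_eq h3 _; rewrite (Nc _ sd) addNr.
have := zero_derive_cst td dW; rewrite scale0r mulr0 addr0 => E.
have -> : (H 0)^-1 + - N 0 * t = (H (t *: a))^-1 by rewrite -E mulNr addrK.
by rewrite divff // Hn0.
Qed.

End Developable.

(** * Euclidean linear algebra *)

Section Euclidean.
Context (R : realType).

Lemma dotE (n : nat) (u v : 'rV[R]_n) : dot u v = (u *m v^T) 0 0.
Proof. by rewrite !mxE; apply: eq_bigr => i _; rewrite mxE. Qed.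

Lemma dotC (n : nat) (u v : 'rV[R]_n) : dot u v = dot v u.
Proof. by apply: eq_bigr => i _; rewrite mulrC. Qed.

Lemma dotDl (n : nat) (u v w : 'rV[R]_n) : dot (u + v) w = dot u w + dot v w.
Proof. by rewrite -big_split /=; apply: eq_bigr => i _; rewrite mxE mulrDl. Qed.

Lemma dotZl (n : nat) a (u v : 'rV[R]_n) : dot (a *: u) v = a * dot u v.
Proof. by rewrite mulr_sumr; apply: eq_bigr => i _; rewrite mxE mulrA. Qed.

Lemma dotNl (n : nat) (u v : 'rV[R]_n) : dot (- u) v = - dot u v.
Proof. by rewrite -scaleN1r dotZl mulN1r. Qed.

Lemma dotBl (n : nat) (u v w : 'rV[R]_n) : dot (u - v) w = dot u w - dot v w.
Proof. by rewrite dotDl dotNl. Qed.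

Lemma dot0l (n : nat) (u : 'rV[R]_n) : dot 0 u = 0.
Proof. by rewrite -(scale0r u) dotZl mul0r. Qed.

Lemma dotDr (n : nat) (u v w : 'rV[R]_n) : dot w (u + v) = dot w u + dot w v.
Proof. by rewrite !(dotC w) dotDl. Qed.

Lemma dotZr (n : nat) a (u v : 'rV[R]_n) : dot v (a *: u) = a * dot v u.
Proof. by rewrite !(dotC v) dotZl. Qed.

Lemma dotNr (n : nat) (u v : 'rV[R]_n) : dot v (- u) = - dot v u.
Proof. by rewrite !(dotC v) dotNl. Qed.

Lemma dotBr (n : nat) (u v w : 'rV[R]_n) : dot w (u - v) = dot w u - dot w v.
Proof. by rewrite !(dotC w) dotBl. Qed.

Lemma dot_ge0 (n : nat) (u : 'rV[R]_n) : 0 <= dot u u.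
Proof. by apply: sumr_ge0 => i _; rewrite -expr2 sqr_ge0. Qed.

Lemma dot_eq0 (n : nat) (u : 'rV[R]_n) : dot u u = 0 -> u = 0.
Proof.
move=> /eqP; rewrite psumr_eq0 => [/allP h|i _]; last by rewrite -expr2 sqr_ge0.
apply/rowP => i; rewrite mxE; have := h i (mem_index_enum _).
by rewrite mulf_eq0 orbb => /eqP.
Qed.

Lemma dot_gt0 (n : nat) (u : 'rV[R]_n) : u != 0 -> 0 < dot u u.
Proof.
by move=> u0; rewrite lt_neqAle dot_ge0 andbT eq_sym; apply: contra_neq u0 => /dot_eq0.
Qed.

Lemma cauchy_schwarz_dot (n : nat) (u v : 'rV[R]_n) :
  dot u v * dot u v <= dot u u * dot v v.
Proof.
have [->|u0] := eqVneq u 0; first by rewrite !dot0l !mul0r.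
have uu := dot_gt0 u0.
have := dot_ge0 (dot u u *: v - dot u v *: u).
rewrite dotBl !dotBr !dotZl !dotZr (dotC v u) => h.
have : 0 <= dot u u * (dot u u * dot v v - dot u v * dot u v).
  by move: h; congr (0 <= _); ring.
by rewrite pmulr_rge0 // subr_ge0.
Qed.

Lemma unit_multiple (n : nat) (u : 'rV[R]_n) : u != 0 ->
  exists2 c : R, 0 < c & dot (c *: u) (c *: u) = 1.
Proof.
move=> /dot_gt0 uu; exists (Num.sqrt (dot u u))^-1; first by rewrite invr_gt0 sqrtr_gt0.
by rewrite dotZl dotZr mulrA -invfM -expr2 sqr_sqrtr ?ltW // mulVf // gt_eqF.
Qed.

Lemma kernel_vector (n k : nat) (A : 'M[R]_(n, k)) : (k < n)%N ->
  exists2 v : 'rV[R]_n, v != 0 & v *m A = 0.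
Proof.
move=> kn.
have kn0 : kermx A != 0.
  by rewrite kermx_eq0 /row_free neq_ltn (leq_ltn_trans (rank_leq_col A) kn).
exists (nz_row (kermx A)); first by rewrite nz_row_eq0.
by apply/sub_kermxP; exact: nz_row_sub.
Qed.

(** Gram-Schmidt without projections: the next row is any nonzero vector annihilated by the pairing
    with the [k] rows already found. It exists as long as [k < n], and is rescaled so that its image
    has length one. *)
Lemma orthonormal_rows (n N : nat) (J : 'M[R]_(n, N)) :
  (forall v : 'rV[R]_n, v *m J = 0 -> v = 0) ->
  exists E : 'M[R]_n, (E *m J) *m (E *m J)^T = 1%:M.
Proof.
move=> injJ.
suff H k : (k <= n)%N -> exists E : 'M[R]_(k, n), (E *m J) *m (E *m J)^T = 1%:M.
  exact: H.
elim: k => [|k IH] kn; first by exists 0; apply/matrixP => -[].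
have [E hE] := IH (ltnW kn).
have [v v0 hv] := @kernel_vector n k (J *m (E *m J)^T) kn.
have vJ0 : v *m J != 0 by apply: contra_neq v0; exact: injJ.
have [c c0 hc] := unit_multiple vJ0.
rewrite -(add1n k); exists (col_mx (c *: v) E).
rewrite mul_col_mx -scalemxAl tr_col_mx mul_col_row hE.
have -> : c *: (v *m J) *m (c *: (v *m J))^T = 1%:M.
  by apply/matrixP => i j; rewrite !ord1 -dotE hc mxE.
have z : c *: (v *m J) *m (E *m J)^T = 0 by rewrite -scalemxAl -mulmxA hv scaler0.
have -> : E *m J *m (c *: (v *m J))^T = 0.
  by rewrite -[LHS]trmxK trmx_mul trmxK z trmx0.
by rewrite z -scalar_mx_block.
Qed.

(** If [X = H *m Y] and [H *m X = 0], symmetry gives [X^T *m X = Y^T *m H *m X = 0], hence [X = 0]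
    over the reals. Each step removes one factor [H] in this way. *)
Lemma symmetric_power_cancel (n m k : nat) (H : 'M[R]_n) (B : 'M[R]_(n, m)) :
  H^T = H -> iter k.+1 (mulmx H) B = 0 -> H *m B = 0.
Proof.
move=> sH; elim: k => [//|k IH] h; apply: IH.
set X := iter k.+1 _ B in h *.
have XX : X^T *m X = 0.
  rewrite {1}/X /= trmx_mul sH -mulmxA.
  by move: h; rewrite /= -/X => ->; rewrite mulmx0.
apply/matrixP => i j; rewrite [RHS]mxE.
have : dot (\row_l X l j) (\row_l X l j) = 0.
  have := congr1 (fun M : 'M[R]_m => M j j) XX; rewrite !mxE => <-.
  by apply: eq_bigr => l _; rewrite !mxE.
by move=> /dot_eq0 /rowP /(_ i); rewrite !mxE.
Qed.

(** Diagonalization is avoided. The multiplicity makes the characteristic polynomial the product of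
    ['X - t] and a power of ['X]; Cayley-Hamilton and cancellation of powers give [H *m H = t *: H],
    from which rank one follows by looking at principal minors. *)
Lemma symmetric_rank_one (n : nat) (H : 'M[R]_n) : H^T = H -> (1 < n)%N ->
  (n - 1 <= mup 0 (char_poly H))%N ->
  exists mu : R, exists c : 'rV[R]_n, forall i j, H i j = mu * c 0 i * c 0 j.
Proof.
case: n H => [//|[//|n]] H sH _.
have pn0 : char_poly H != 0 by rewrite monic_neq0 // char_poly_monic.
rewrite subn1 /= mup_geq // subr0 => /dvdpP[q hq].
have qn0 : q != 0 by apply: contraNneq pn0 => q0; rewrite hq q0 mul0r.
have sq : size q = 2%N.
  have := size_char_poly H; rewrite hq size_mulXn // => h.
  by apply: (@addnI n.+1); rewrite h addn2.
pose t := - q`_0.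
have q1 : q`_1 = 1.
  have := char_poly_monic H; rewrite hq monicE lead_coefM lead_coefXn mulr1.
  by rewrite lead_coefE sq => /eqP.
have qE : q = 'X - t%:P.
  apply/polyP => -[|[|i]]; rewrite coefB coefX coefC /=.
  - by rewrite sub0r opprK.
  - by rewrite q1 subr0.
  - by rewrite subr0 nth_default // sq.
have trH : \tr H = t.
  have := @char_poly_trace _ n.+2 H isT.
  by rewrite hq /= coefMXn ltnn subnn /t => ->; rewrite opprK.
have symH i j : H i j = H j i by rewrite -[in LHS]sH mxE.
have HH : H *m H = t *: H.
  have CH := Cayley_Hamilton H.
  move: CH; rewrite hq qE mulrC rmorphM rmorphB /= rmorphXn /= horner_mx_X horner_mx_C.
  move=> CH.
  have iterE k (B : 'M[R]_n.+2) : iter k (mulmx H) B = H ^+ k * B.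
    by elim: k => [|k IH]; rewrite ?expr0 ?mul1r // iterS IH exprS -mulrA.
  have h1 : iter n.+1 (mulmx H) (H - t%:M) = 0 by rewrite iterE.
  have := symmetric_power_cancel sH h1.
  by rewrite mulmxBr mul_mx_scalar => /eqP; rewrite subr_eq0 => /eqP.
have rows i j : dot (row i H) (row j H) = t * H i j.
  have := congr1 (fun M : 'M[R]_n.+2 => M i j) HH; rewrite !mxE => <-.
  by apply: eq_bigr => k _; rewrite !mxE (symH j k).
(* When [t = 0] every row of [H] has zero length. *)
have [t0|tn0] := eqVneq t 0.
  exists 0, 0 => i j; rewrite !mul0r.
  have := rows i i; rewrite t0 mul0r => /dot_eq0 /rowP /(_ j).
  by rewrite !mxE.
(* These principal minors are nonnegative by Cauchy-Schwarz for the rows, whose Gram matrix is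
   [t *: H]. They add up to the square of the trace minus [t] times the trace, which is 0, so each
   of them vanishes. *)
pose D i j := H i i * H j j - H i j * H i j.
have D0 i j : 0 <= D i j.
  have := cauchy_schwarz_dot (row i H) (row j H); rewrite !rows => h.
  have : 0 <= (t * t) * D i j by move: h; rewrite /D -subr_ge0; congr (0 <= _); ring.
  by rewrite pmulr_rge0 // lt_neqAle eq_sym mulf_neq0 //= -expr2 sqr_ge0.
have sumD : \sum_i \sum_j D i j = 0.
  have h1 i : \sum_j D i j = H i i * t - t * H i i.
    rewrite /D sumrB -mulr_sumr -trH; congr (_ - _).
    by rewrite trH -rows; apply: eq_bigr => j _; rewrite !mxE.
  by under eq_bigr do rewrite h1 mulrC subrr; rewrite big1.
have minors i j : H i i * H j j = H i j * H i j.
  move/eqP: sumD; rewrite psumr_eq0 => [/allP /(_ i (mem_index_enum _))|k _]; last exact: sumr_ge0.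
  rewrite psumr_eq0 // => /allP /(_ j (mem_index_enum _)).
  by rewrite subr_eq0 => /eqP.
have [i0 hi0] : exists i0, H i0 i0 != 0.
  apply/existsP; apply: contraNT tn0 => /existsPn h.
  by rewrite -trH; apply/eqP; apply: big1 => i _; have := h i; rewrite negbK => /eqP.
have prop i : row i H = (H i i0 / H i0 i0) *: row i0 H.
  apply/eqP; rewrite -subr_eq0; apply/eqP; apply: dot_eq0.
  rewrite dotBl !dotBr !dotZl !dotZr !rows (symH i0 i).
  have -> : H i i = H i i0 * H i i0 / H i0 i0 by rewrite -minors mulfK.
  by field.
exists (H i0 i0), (\row_i (H i i0 / H i0 i0)) => i j; rewrite !mxE.
have := prop i => /rowP /(_ j); rewrite !mxE (symH i0 j) => ->.
by field.
Qed.

End Euclidean.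

(** * Maps into row vectors and Hessians under composition *)

Section Patches.
Context (R : realType).

Lemma Ck_on_rows (V : normedModType R) m k (U : set V) (f : V -> 'rV[R]_m) :
  open U -> (forall i, Ck_on k U (fun x => f x 0 i : R)) -> Ck_on k U f.
Proof.
move=> oU; elim: k f => [|k IH] f hf.
  split => // x Ux; apply: continuous_ballI => e e0.
  have /choice[rr hrr] : forall i : 'I_m, exists r : R, 0 < r /\
      forall y, `|x - y| < r -> `|f x 0 i - f y 0 i| < e / 2.
    have e20 : 0 < e / 2 by rewrite divr_gt0.
    move=> i; have [c1 _] := hf i.
    by have [r r0 hr] := continuous_ballP (c1 _ Ux) (e20 : 0 < e / 2); exists r.
  exists (\big[Num.min/1]_i rr i).
    by apply: lt_bigmin => // i _; have [] := hrr i.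
  move=> y xy; apply: (@le_lt_trans _ _ (e / 2)); last by lra.
  apply/rV_norm_leP => [|i]; first by lra.
  rewrite !mxE; apply/ltW; have [_ h] := hrr i; apply: h.
  by apply: lt_le_trans xy _; exact: bigmin_le.
have cf : forall x, U x -> {for x, continuous f}.
  have h0 : Ck_on k U f by apply: IH => i; exact: Ck_onW.
  by case: k {IH hf} h0 => [|k] [].
split => // v.
have df x : U x -> derivable f x v.
  move=> Ux; apply/derivable_mxP => i j; rewrite ord1.
  by have [_ /(_ v)[h _]] := hf j; exact: h.
split => //; apply: IH => i.
have [_ /(_ v)[_ h]] := hf i; apply: Ck_on_eq h => // x Ux.
by rewrite (derive_coord i (df _ Ux)).
Qed.

Lemma smooth_on_rows (V : normedModType R) m (U : set V) (f : V -> 'rV[R]_m) :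
  open U -> (forall i, smooth_on U (fun x => f x 0 i : R)) -> smooth_on U f.
Proof. by move=> oU h k; apply: Ck_on_rows => // i; exact: h. Qed.

Lemma continuous_sum_for (V : topologicalType) (I : Type) (r : seq I) (x : V)
    (f : I -> V -> R) :
  (forall i, {for x, continuous (f i)}) ->
  {for x, continuous (fun y => \sum_(i <- r) f i y)}.
Proof.
move=> h; elim: r => [|i r IH].
  have -> : (fun y => \sum_(i <- [::]) f i y) = (fun=> 0).
    by apply/funext => y; rewrite big_nil.
  exact: cst_continuous.
have -> : (fun y => \sum_(j <- i :: r) f j y) =
    (fun y => f i y + \sum_(j <- r) f j y).
  by apply/funext => y; rewrite big_cons.
by apply: continuousD; [exact: h|exact: IH].
Qed.

Lemma C1_comp (V : normedModType R) n m (O : set V) (U : set 'rV[R]_n)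
    (G : V -> 'rV[R]_n) (f : 'rV[R]_n -> 'rV[R]_m) :
  open O -> open U -> (forall x, O x -> U (G x)) -> Ck_on 1 O G -> Ck_on 1 U f ->
  Ck_on 1 O (f \o G).
Proof.
move=> oO oU GU cG cf; apply: Ck_on_rows => // j.
have cfj := Ck_on_coord j oU cf.
have [contG dG] := cG; have [contf df] := cfj.
have cc (h : 'rV[R]_n -> R) x : O x -> (forall y, U y -> {for y, continuous h}) ->
    {for x, continuous (h \o G)}.
  move=> Ox ch; apply: (@continuous_comp _ _ _ G h x); first exact: contG.
  by apply: ch; exact: GU.
split; first by move=> x Ox; exact: cc Ox contf.
move=> v; have [dG1 [dG2 _]] := dG v.
have h x : O x -> is_derive x v ((fun y => f y 0 j) \o G)
    (\sum_(i < n) ('D_v G x) 0 i * 'D_('e_i) (fun y => f y 0 j) (G x)).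
  move=> Ox; apply: (is_derive_comp_C1 oU cfj (GU _ Ox)).
  by split => //; exact: dG1.
split; first by move=> x /h[].
split => // x Ox.
apply: (@continuous_near_eq _ _ O _ _ _ oO _ Ox); first by move=> y /h[_ ->].
apply: continuous_sum_for => i; apply: continuousM.
  apply: (@continuous_comp _ _ _ ('D_v G) (fun M : 'rV_n => M 0 i) x (dG2 _ Ox)).
  exact: coord_continuous.
apply: (cc ('D_('e_i) (fun y => f y 0 j))) => // y Uy.
by have [_ [c _]] := df 'e_i; exact: c.
Qed.

Lemma C1_real (W : normedModType R) (O : set R) (f f' : R -> W) :
  open O -> (forall t, O t -> is_derive t (1 : R) f (f' t)) ->
  (forall t, O t -> {for t, continuous f'}) -> Ck_on 1 O f.
Proof.
move=> oO hf cf'.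
have df t : O t -> differentiable f t.
  by move=> /hf[h _]; apply/derivable1_diffP.
split; first by move=> t Ot; exact: differentiable_continuous (df _ Ot).
move=> v; split; first by move=> t Ot; apply: diff_derivable; exact: df.
split => // t Ot.
have E s : O s -> v *: f' s = 'D_v f s.
  move=> Os; rewrite (deriveE v (df _ Os)).
  have [_ <-] := hf _ Os; rewrite (deriveE (1 : R) (df _ Os)) -linearZ /=.
  by congr ('d f s _); rewrite /GRing.scale /= mulr1.
apply: (continuous_near_eq oO E Ot).
by apply: continuousZr; exact: cf'.
Qed.

Lemma is_derive_bigsum (V : normedModType R) (n : nat) (h : 'I_n -> V -> R) x v
    (dh : 'I_n -> R) : (forall i, is_derive x v (h i) (dh i)) ->
  is_derive x v (fun y => \sum_(i < n) h i y) (\sum_(i < n) dh i).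
Proof.
move=> hd; have := is_derive_sum hd.
by congr (is_derive _ _ _ _); apply/funext => y; rewrite fct_sumE.
Qed.

(** Coordinates make explicit the bilinearity in [p] and [q], used for rescaling, and the joint
    continuity in all arguments, used for limits. *)
Lemma derive2_dirE n (U : set 'rV[R]_n) (l : 'rV[R]_n -> R) x p q :
  open U -> smooth_on U l -> U x ->
  'D_p ('D_q l) x =
    \sum_(i < n) q 0 i * \sum_(j < n) p 0 j * 'D_('e_j) ('D_('e_i) l) x.
Proof.
move=> oU sl Ux.
have E z : U z -> 'D_q l z = \sum_(i < n) q 0 i * 'D_('e_i) l z.
  by move=> Uz; exact: derive_dirE oU (sl 1%N) Uz.
have -> : 'D_p ('D_q l) x = 'D_p (fun z => \sum_(i < n) q 0 i * 'D_('e_i) l z) x.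
  exact: near_eq_derive p (open_near_eq oU E Ux).
have h i : is_derive x p (fun z => q 0 i * 'D_('e_i) l z)
    (q 0 i * \sum_(j < n) p 0 j * 'D_('e_j) ('D_('e_i) l) x).
  have sli := smooth_on_derive 'e_i sl.
  rewrite -(derive_dirE _ oU (sli 1%N) Ux).
  have d := derivableP (smooth_on_derivable (v := p) sli Ux).
  by have := is_deriveZ (q 0 i) d.
by have [_ ->] := is_derive_bigsum h.
Qed.

(* At a common zero of a function and its differential the Hessian behaves
   tensorially, also after multiplication by a function [s]. *)
Lemma critical_hessian n m (U : set 'rV[R]_n) (Z : set 'rV[R]_m)
    (s : 'rV[R]_n -> R) (y : 'rV[R]_n -> 'rV[R]_m) (l : 'rV[R]_m -> R) u a b :
  open U -> open Z -> (forall x, U x -> Z (y x)) ->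
  smooth_on U s -> smooth_on U y -> smooth_on Z l -> U u ->
  l (y u) = 0 -> (forall d, 'D_d l (y u) = 0) ->
  'D_a ('D_b (fun x => s x * l (y x))) u =
    s u * 'D_('D_a y u) ('D_('D_b y u) l) (y u).
Proof.
move=> oU oZ yZ ss sy sl Uu l0 dl0.
have sly : forall k : 'rV[R]_m -> R, smooth_on Z k -> forall x v, U x ->
    is_derive x v (k \o y) (\sum_(i < m) ('D_v y x) 0 i * 'D_('e_i) k (y x)).
  move=> k sk x v Ux; apply: (is_derive_comp_C1 oZ (sk 1%N) (yZ _ Ux)).
  by split => //; exact: smooth_on_derivable sy Ux.
have ds x v : U x -> derivable s x v by move=> Ux; exact: smooth_on_derivable ss Ux.
pose Db x := \sum_(i < m) ('D_b y x) 0 i * 'D_('e_i) l (y x).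
have E x : U x -> s x * Db x + l (y x) * 'D_b s x = 'D_b (fun x => s x * l (y x)) x.
  move=> Ux; have [d1 d2] := sly _ sl x b Ux.
  by rewrite [RHS](deriveM (ds x b Ux) d1) [X in _ = _ *: X + _]d2.
have E2 : 'D_a (fun x => s x * Db x + l (y x) * 'D_b s x) u =
    'D_a ('D_b (fun x => s x * l (y x))) u.
  exact: near_eq_derive a (open_near_eq oU E Uu).
rewrite -E2.
have dyb i : is_derive u a (fun x => ('D_b y x) 0 i) (('D_a ('D_b y) u) 0 i).
  have d : derivable ('D_b y) u a.
    exact: smooth_on_derivable (smooth_on_derive b sy) Uu.
  split; last exact: derive_coord.
  by have /derivable_mxP := d; exact.
have dDb : is_derive u a Db (\sum_(i < m) ('D_b y u) 0 i *
    (\sum_(j < m) ('D_a y u) 0 j * 'D_('e_j) ('D_('e_i) l) (y u))).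
  have h i : is_derive u a (fun x => ('D_b y x) 0 i * 'D_('e_i) l (y x))
     (('D_b y u) 0 i * (\sum_(j < m) ('D_a y u) 0 j * 'D_('e_j) ('D_('e_i) l) (y u))).
    have h1 := is_deriveM (dyb i) (sly _ (smooth_on_derive 'e_i sl) u a Uu).
    apply: is_derive_eq h1 _; rewrite /GRing.scale /=.
    by rewrite dl0 mul0r addr0.
  exact: is_derive_bigsum h.
have Db0 : Db u = 0 by apply: big1 => i _; rewrite dl0 mulr0.
have dly : is_derive u a (l \o y) 0.
  apply: is_derive_eq (sly _ sl u a Uu) _.
  by apply: big1 => i _; rewrite dl0 mulr0.
have dbs : derivable ('D_b s) u a.
  exact: smooth_on_derivable (smooth_on_derive b ss) Uu.
have h := is_deriveD (is_deriveM (derivableP (ds u a Uu)) dDb)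
  (is_deriveM dly (derivableP dbs)).
have [_ ->] := h; rewrite /GRing.scale /= l0 Db0 !mul0r mulr0 !addr0.
by rewrite (derive2_dirE _ _ oZ sl (yZ _ Uu)).
Qed.

End Patches.

(** * Parametrized hypersurfaces of the sphere *)

Section SphericalPatches.
Context (R : realType).

(** When [nu] is orthogonal to [phi u], this is the second fundamental form of the hypersurface in
    the sphere: the radial component removed by [sphere_connection] does not pair with [nu]. *)
Definition hess n m (phi : 'rV[R]_n -> 'rV[R]_m) nu u a b : R :=
  dot ('D_a ('D_b phi) u) nu.

Definition normal_to n m (phi : 'rV[R]_n -> 'rV[R]_m) u nu : Prop :=
  dot nu (phi u) = 0 /\ forall v, dot nu ('D_v phi u) = 0.

Definition spherical_patch n m (U : set 'rV[R]_n) (phi : 'rV[R]_n -> 'rV[R]_m) :=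
  [/\ open U, smooth_on U phi,
      (forall u v, U u -> 'D_v phi u = 0 -> v = 0) &
      (forall u, U u -> dot (phi u) (phi u) = 1)].

(** Vanishing of all these discriminants says that the symmetric form has rank at most one; in this
    shape it passes directly to a Monge-Ampere equation. *)
Definition rank_le1 n m (U : set 'rV[R]_n) (phi : 'rV[R]_n -> 'rV[R]_m) :=
  forall u nu a b, U u -> dot nu nu = 1 -> normal_to phi u nu ->
    hess phi nu u a a * hess phi nu u b b = hess phi nu u a b * hess phi nu u a b.

Lemma is_derive_dot n m (phi : 'rV[R]_n -> 'rV[R]_m) u v nu :
  derivable phi u v -> is_derive u v (fun x => dot (phi x) nu) (dot ('D_v phi u) nu).
Proof.
move=> d; apply: is_derive_bigsum => i.
have di : derivable (fun x => phi x 0 i) u v by have /derivable_mxP := d; exact.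
have h := is_deriveM (derivableP di) (is_derive_cst (nu 0 i) u v).
apply: is_derive_eq h _; rewrite /GRing.scale /= mulr0 add0r (derive_coord i d) mulrC.
by [].
Qed.

Lemma smooth_on_dot n m (U : set 'rV[R]_n) (phi : 'rV[R]_n -> 'rV[R]_m) nu :
  open U -> smooth_on U phi -> smooth_on U (fun x => dot (phi x) nu : R).
Proof.
move=> oU sphi; apply: (@smooth_on_sum _ _ R) => // i; apply: smooth_onM => //.
  exact: smooth_on_coord.
exact: (@smooth_on_cst _ _ R).
Qed.

Lemma hess_dot n m (U : set 'rV[R]_n) (phi : 'rV[R]_n -> 'rV[R]_m) nu u a b :
  open U -> smooth_on U phi -> U u ->
  hess phi nu u a b = 'D_a ('D_b (fun x => dot (phi x) nu)) u.
Proof.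
move=> oU sphi Uu.
have E x : U x -> dot ('D_b phi x) nu = 'D_b (fun x => dot (phi x) nu) x.
  move=> Ux; have d := smooth_on_derivable (v := b) sphi Ux.
  by have [_ ->] := is_derive_dot nu d.
rewrite -(near_eq_derive a (open_near_eq oU E Uu)) /hess.
have d := smooth_on_derivable (v := a) (smooth_on_derive b sphi) Uu.
by have [_ ->] := is_derive_dot nu d.
Qed.

Section Frame.
Context (n : nat) (U : set 'rV[R]_n) (phi : 'rV[R]_n -> 'rV[R]_n.+2).
Hypothesis patch : spherical_patch U phi.

Lemma patch_derivative_orth u v : U u -> dot (phi u) ('D_v phi u) = 0.
Proof.
have [oU sphi _ nphi] := patch => Uu.
have d := smooth_on_derivable (v := v) sphi Uu.
have h : is_derive u v (fun x => dot (phi x) (phi x))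
    (\sum_i (phi u 0 i * ('D_v phi u) 0 i + phi u 0 i * ('D_v phi u) 0 i)).
  apply: is_derive_bigsum => i.
  have di : derivable (fun x => phi x 0 i) u v by have /derivable_mxP := d; exact.
  have h := is_deriveM (derivableP di) (derivableP di).
  by apply: is_derive_eq h _; rewrite (derive_coord i d).
have c : 'D_v (fun x => dot (phi x) (phi x)) u = 0.
  have <- : 'D_v (fun _ : 'rV[R]_n => 1 : R) u = 0 by exact: derive_cst.
  by apply: near_eq_derive; exact: open_near_eq nphi Uu.
have [_] := h; rewrite c big_split /= -/(dot (phi u) ('D_v phi u)) => /esym/eqP.
by rewrite -mulr2n mulrn_eq0 /= => /eqP.
Qed.

Lemma unit_normal_exists u : U u ->
  exists2 nu, dot nu nu = 1 & normal_to phi u nu.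
Proof.
have [oU sphi _ _] := patch => Uu.
pose A := col_mx (phi u) (jacobian_at phi u).
have [v v0 hv] := @kernel_vector R n.+2 (1 + n) A^T (ltnSn _).
have [c c0 hc] := unit_multiple v0.
have hv' : v *m row_mx (phi u)^T (jacobian_at phi u)^T = 0 by rewrite -tr_col_mx.
rewrite mul_mx_row -row_mx0 in hv'; have [v1 v2] := eq_row_mx hv'.
exists (c *: v) => //; split; first by rewrite dotZl dotE v1 mxE mulr0.
move=> w; rewrite dotZl dotE (jacobian_atE _ oU (sphi 1%N) Uu) trmx_mul mulmxA v2.
by rewrite mul0mx mxE mulr0.
Qed.

(* [L] gives the coordinates of the tangential part of an ambient vector. *)
Lemma tangent_projection u nu : U u -> dot nu nu = 1 -> normal_to phi u nu ->
  exists L : 'M[R]_(n.+2, n),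
    [/\ jacobian_at phi u *m L = 1%:M, phi u *m L = 0, nu *m L = 0 &
        forall z, z = dot z (phi u) *: phi u + 'D_(z *m L) phi u + dot z nu *: nu].
Proof.
have [oU sphi imm nphi] := patch => Uu nu1 [nu2 nu3].
have DE v : 'D_v phi u = v *m jacobian_at phi u := jacobian_atE v oU (sphi 1%N) Uu.
set J := jacobian_at phi u in DE *; set x := phi u.
have [E hE] : exists E : 'M[R]_n, (E *m J) *m (E *m J)^T = 1%:M.
  by apply: orthonormal_rows => v; rewrite -DE; exact: imm.
have orthJ z : (forall v, dot z ('D_v phi u) = 0) -> z *m J^T = 0.
  move=> h; apply/rowP => i; rewrite [RHS]mxE.
  have := h 'e_i; rewrite DE -rowE dotE tr_row.
  by rewrite -[z *m col i _]/(z *m col i J^T) colE mulmxA -colE !mxE.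
have xJ : x *m J^T = 0 by apply: orthJ => v; exact: patch_derivative_orth.
have nJ : nu *m J^T = 0 by exact: orthJ.
have xEJ : x *m (E *m J)^T = 0 by rewrite trmx_mul mulmxA xJ mul0mx.
have nEJ : nu *m (E *m J)^T = 0 by rewrite trmx_mul mulmxA nJ mul0mx.
have EJ1 : J *m (E *m J)^T *m E = 1%:M.
  by apply: mulmx1C; rewrite mulmxA.
(* The rows of [E *m J] are an orthonormal tangent basis; pairing with them and then applying [E]
   returns to chart coordinates. *)
exists ((E *m J)^T *m E); split.
- by rewrite mulmxA.
- by rewrite mulmxA xEJ mul0mx.
- by rewrite mulmxA nEJ mul0mx.
(* [phi u], [nu] and the tangent basis form a square matrix with orthonormal rows, hence an
   orthogonal one, so only 0 is orthogonal to all of them. *)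
have complete z : dot z x = 0 -> dot z nu = 0 -> z *m (E *m J)^T = 0 -> z = 0.
  move=> z1 z2 z3.
  pose C := col_mx (col_mx x nu) (E *m J).
  have CC : C *m C^T = 1%:M.
    have c (a b : 'rV[R]_n.+2) : a *m b^T = (dot a b)%:M.
      by apply/matrixP => i j; rewrite !ord1 -dotE !mxE.
    have EJx (a : 'rV[R]_n.+2) : a *m (E *m J)^T = 0 -> E *m J *m a^T = 0.
      by move=> h; rewrite -[LHS]trmxK trmx_mul trmxK h trmx0.
    rewrite /C tr_col_mx mul_col_row tr_col_mx mul_col_row hE !c.
    rewrite mul_col_mx mul_mx_row xEJ nEJ !EJx // nphi // nu1 nu2 (dotC x nu) nu2.
    by rewrite !raddf0 col_mx0 row_mx0 -!scalar_mx_block.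
  have zC : z *m C^T = 0.
    rewrite /C !tr_col_mx !mul_mx_row z3.
    have -> : z *m x^T = 0 by apply/rowP => i; rewrite !ord1 -dotE z1 mxE.
    have -> : z *m nu^T = 0 by apply/rowP => i; rewrite !ord1 -dotE z2 mxE.
    by rewrite !row_mx0.
  pose B : 'M[R]_n.+2 := C.
  have BB : B *m B^T = 1%:M by exact: CC.
  have zB : z *m B^T = 0 by exact: zC.
  by rewrite -[z]mulmx1 -(mulmx1C BB) mulmxA zB mul0mx.
have xnu : dot x nu = 0 by rewrite dotC.
have xx : dot x x = 1 by exact: nphi.
have Dx w : dot ('D_w phi u) x = 0 by rewrite dotC patch_derivative_orth.
have Dnu w : dot ('D_w phi u) nu = 0 by rewrite dotC nu3.
move=> z; apply/eqP; rewrite -subr_eq0; apply/eqP; apply: complete.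
- by rewrite dotBl !dotDl !dotZl xx nu2 Dx mulr1 mulr0 !addr0 subrr.
- by rewrite dotBl !dotDl !dotZl xnu nu1 Dnu mulr1 mulr0 !add0r subrr.
rewrite mulmxBl !mulmxDl -!scalemxAl xEJ nEJ !scaler0 add0r addr0 DE.
move: hE; set T := (E *m J)^T => hE'.
by rewrite -!mulmxA (mulmxA E) hE' mulmx1 subrr.
Qed.

Lemma tangent_vector u nu z : U u -> dot nu nu = 1 -> normal_to phi u nu ->
  dot z (phi u) = 0 -> dot z nu = 0 -> exists a, 'D_a phi u = z.
Proof.
move=> Uu nu1 nun zx znu.
have [L [_ _ _ h]] := tangent_projection Uu nu1 nun.
by exists (z *m L); rewrite [in RHS](h z) zx znu !scale0r add0r addr0.
Qed.

Lemma mulmx_bounded m k (A : 'M[R]_(m, k)) :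
  exists2 C : R, 0 < C & forall z : 'rV[R]_m, `|z *m A| <= C * `|z|.
Proof.
pose C := \sum_(i < m) \sum_(j < k) `|A i j| + 1.
have C0 : 0 < C by rewrite ltr_wpDl // sumr_ge0 // => i _; rewrite sumr_ge0.
exists C => // z; apply/rV_norm_leP => [|j]; first by rewrite mulr_ge0 // ltW.
rewrite mxE; apply: le_trans (ler_norm_sum _ _ _) _.
apply: le_trans (_ : (\sum_(i < m) \sum_(j < k) `|A i j|) * `|z| <= _).
  rewrite mulr_suml; apply: ler_sum => i _; rewrite normrM mulrC.
  apply: ler_pM => //; last exact: rV_coord_le.
  by rewrite (bigD1 j) //= lerDl sumr_ge0.
by rewrite ler_wpM2r // lerDl.
Qed.

(** One constant and one ball serve both differences and differentials. With [C] bounding the left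
    inverse [L], half of [C^-1] survives the strict error at [u], and half of that survives a second
    estimate at nearby points. The bound gives local injectivity of the immersion and compares
    displacement in the sphere with chart coordinates. *)
Lemma patch_lower_bound u : U u -> exists m r : R, [/\ 0 < m, 0 < r,
  (forall x, `|u - x| < r -> U x),
  (forall x y, `|u - x| < r -> `|u - y| < r -> m * `|x - y| <= `|phi x - phi y|) &
  (forall x v, `|u - x| < r -> m * `|v| <= `|'D_v phi x|)].
Proof.
have [oU sphi _ _] := patch => Uu.
have [nu nu1 nun] := unit_normal_exists Uu.
have [L [JL _ _ _]] := tangent_projection Uu nu1 nun.
have [C C0 hC] := mulmx_bounded L.
have low v : `|v| <= C * `|'D_v phi u|.
  by rewrite -{1}[v]mulmx1 -JL mulmxA (jacobian_atE _ oU (sphi 1%N) Uu).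
have e0 : 0 < (2 * C)^-1 by rewrite invr_gt0 mulr_gt0.
have [r1 r10 hr1] := C1_strict oU (sphi 1%N) Uu e0.
have [r2 r20 hr2] := open_ballP oU Uu.
pose r := Num.min r1 r2.
have r0 : 0 < r by rewrite lt_min r10.
have rU x : `|u - x| < r -> U x by rewrite lt_min => /andP[_]; exact: hr2.
have b1 x y : `|u - x| < r -> `|u - y| < r -> (2 * C)^-1 * `|x - y| <= `|phi x - phi y|.
  rewrite !lt_min => /andP[x1 _] /andP[y1 _].
  have h1 := hr1 _ _ x1 y1; have h2 := low (x - y).
  have : `|'D_(x - y) phi u| <= `|phi x - phi y| + `|phi x - phi y - 'D_(x - y) phi u|.
    by rewrite -{1}['D_(x - y) phi u](subKr (phi x - phi y)); exact: ler_normB.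
  move: h1 h2; set p := `|x - y|; set q := `|'D_(x - y) phi u|.
  move=> h1 h2 h3.
  have : C^-1 * p <= q by rewrite mulrC ler_pdivrMr // mulrC.
  have -> : C^-1 = (2 * C)^-1 + (2 * C)^-1 by field; rewrite gt_eqF.
  by rewrite mulrDl; move: h1 h3; lra.
have m0 : 0 < (4 * C)^-1 by rewrite invr_gt0 mulr_gt0.
exists (4 * C)^-1, r; split => //.
  move=> x y x1 y1; apply: le_trans (b1 _ _ x1 y1).
  rewrite ler_wpM2r // lef_pV2 ?posrE ?mulr_gt0 //.
  by move: C0; lra.
move=> x v xr.
have [r3 r30 hr3] := C1_strict oU (sphi 1%N) (rU _ xr) m0.
have [r4 r40 hr4] : exists2 d : R, 0 < d & forall y, `|x - y| < d -> `|u - y| < r.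
  apply: open_ballP (_ : [set v | `|u - v| < r] x) => //.
  by have := ball_open u r; rewrite -ball_normE.
have r340 : 0 < Num.min r3 r4 by rewrite lt_min r30.
have [h h0] := small_scaling r340 (normr_ge0 v).
rewrite lt_min => /andP[h3 h4].
have hN : `|x - (x + h *: v)| = h * `|v|.
  by rewrite opprD addrA subrr sub0r normrN normrZ gtr0_norm.
have hD : x + h *: v - x = h *: v by rewrite addrAC subrr add0r.
have hN' : `|h *: v| = h * `|v| by rewrite normrZ gtr0_norm.
have := b1 (x + h *: v) x; rewrite hD hN' => /(_ _ xr) e1.
have {}e1 : (2 * C)^-1 * (h * `|v|) <= `|phi (x + h *: v) - phi x|.
  by apply: e1; apply: hr4; rewrite hN.
have := hr3 (x + h *: v) x; rewrite hN subrr normr0 hD hN' => /(_ h3 r30).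
have -> : 'D_(h *: v) phi x = h *: 'D_v phi x.
  by rewrite !(jacobian_atE _ oU (sphi 1%N) (rU _ xr)) scalemxAl.
move=> e2.
have : `|phi (x + h *: v) - phi x| <= h * `|'D_v phi x| + (4 * C)^-1 * (h * `|v|).
  have -> : h * `|'D_v phi x| = `|h *: 'D_v phi x| by rewrite normrZ gtr0_norm.
  rewrite -{1}[phi (x + h *: v) - phi x](subrK (h *: 'D_v phi x)) addrC.
  by apply: le_trans (ler_normD _ _) _; rewrite lerD2l.
move=> e3; rewrite -(ler_pM2l h0).
have -> : h * ((4 * C)^-1 * `|v|) = (4 * C)^-1 * (h * `|v|) by ring.
have E : (2 * C)^-1 = (4 * C)^-1 + (4 * C)^-1 by field; rewrite gt_eqF.
by move: e1 e3; rewrite E mulrDl; lra.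
Qed.

End Frame.
End SphericalPatches.

(** * Null directions under reparametrization and limits *)

Section NullityData.
Context (R : realType).

(* [e] is a null direction of the second fundamental form in the direction [nu]
   and [1 / rho] its value on [E], all read off at the parameter [u]. *)
Definition nullity_data n m (phi : 'rV[R]_n -> 'rV[R]_m) u e E nu (rho : R) :=
  [/\ normal_to phi u nu,
      (forall a, 'D_a phi u = e -> hess phi nu u a a = 0) &
      (forall b, 'D_b phi u = E -> hess phi nu u b b * rho = 1)].

(** A Hessian is not invariant under a change of parameters in general. Here the function
    [dot (phi' x) nu] of [x] has both a zero and a critical point at [sigma u], so
    [critical_hessian] applies with the factor 1. *)
Lemma nullity_data_reparam n p m (U : set 'rV[R]_n) (U' : set 'rV[R]_p)
    (phi : 'rV[R]_n -> 'rV[R]_m) (phi' : 'rV[R]_p -> 'rV[R]_m)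
    (sigma : 'rV[R]_n -> 'rV[R]_p) u e E nu rho :
  open U -> open U' -> smooth_on U phi -> smooth_on U' phi' -> smooth_on U sigma ->
  (forall x, U x -> U' (sigma x)) -> (forall x, U x -> phi' (sigma x) = phi x) ->
  U u -> nullity_data phi' (sigma u) e E nu rho -> nullity_data phi u e E nu rho.
Proof.
move=> oU oU' sphi sphi' ss UU' phiE Uu [[n1 n2] he hE].
have DE v : 'D_v phi u = 'D_('D_v sigma u) phi' (sigma u).
  have ds : is_derive u v sigma ('D_v sigma u).
    by split=> //; exact: smooth_on_derivable ss Uu.
  have [_ <-] := is_derive_comp_C1_vec oU' (sphi' 1%N) (UU' _ Uu) ds.
  by apply/esym; apply: near_eq_derive; exact: open_near_eq phiE Uu.
have HE a : hess phi nu u a a =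
    hess phi' nu (sigma u) ('D_a sigma u) ('D_a sigma u).
  rewrite (hess_dot _ _ _ oU sphi Uu) (hess_dot _ _ _ oU' sphi' (UU' _ Uu)).
  have one : smooth_on U (fun _ : 'rV[R]_n => 1 : R) by exact: (@smooth_on_cst _ _ R).
  have h := @critical_hessian R n p U U' _ sigma (fun x => dot (phi' x) nu) u a a
    oU oU' UU' one ss (smooth_on_dot nu oU' sphi') Uu.
  rewrite -[RHS]mul1r -h; last 2 first.
  - by rewrite dotC.
  - move=> d; have dd := smooth_on_derivable (v := d) sphi' (UU' _ Uu).
    by have [_ ->] := is_derive_dot nu dd; rewrite dotC n2.
  have EE x : U x -> dot (phi x) nu = 1 * dot (phi' (sigma x)) nu.
    by move=> Ux; rewrite mul1r phiE.
  have E2 x : U x -> 'D_a (fun x => dot (phi x) nu) x =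
      'D_a (fun x => 1 * dot (phi' (sigma x)) nu) x.
    by move=> Ux; exact: near_eq_derive a (open_near_eq oU EE Ux).
  exact: near_eq_derive a (open_near_eq oU E2 Uu).
split.
- by split=> [|v]; [rewrite -phiE|rewrite DE].
- by move=> a; rewrite DE HE; exact: he.
- by move=> b; rewrite DE HE; exact: hE.
Qed.

Lemma cvg_bigsum (n : nat) (f : 'I_n -> nat -> R) (l : 'I_n -> R) :
  (forall i, f i k @[k --> \oo] --> l i) ->
  (fun k => \sum_(i < n) f i k) k @[k --> \oo] --> \sum_(i < n) l i.
Proof.
move=> h; elim: (index_enum 'I_n) => [|i r IH].
  rewrite big_nil; have -> : (fun k => \sum_(i <- [::]) f i k) = (fun=> 0).
    by apply/funext => k; rewrite big_nil.
  exact: cvg_cst.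
rewrite big_cons.
have -> : (fun k => \sum_(j <- i :: r) f j k) = (fun k => f i k + \sum_(j <- r) f j k).
  by apply/funext => k; rewrite big_cons.
by apply: cvgD; [exact: h|exact: IH].
Qed.

Lemma cvg_seqP (V : normedModType R) (x : nat -> V) (l : V) :
  x k @[k --> \oo] --> l <->
  (forall e : R, 0 < e -> exists k0, forall k, (k0 <= k)%N -> `|l - x k| < e).
Proof.
split=> [/cvgrPdist_lt h e e0|h].
  by have [k0 _ hk] := h _ e0; exists k0.
by apply/cvgrPdist_lt => e /h[k0 hk]; exists k0.
Qed.

Lemma cvg_at_continuous (V W : normedModType R) (F : V -> W) (x : nat -> V) (l : V) :
  {for l, continuous F} -> x k @[k --> \oo] --> l -> F (x k) @[k --> \oo] --> F l.
Proof. by move=> cF cx; exact: continuous_cvg cF cx. Qed.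

(** The uniform lower bound on the differentials lets the convergence of image vectors be pulled
    back to the chart vectors [ak]. *)
Lemma tangent_limit n m (U : set 'rV[R]_n) (phi : 'rV[R]_n -> 'rV[R]_m) u a
    (uk ak : nat -> 'rV[R]_n) (c r : R) :
  open U -> smooth_on U phi -> U u -> 0 < c -> 0 < r ->
  (forall x, `|u - x| < r -> U x) ->
  (forall x v, `|u - x| < r -> c * `|v| <= `|'D_v phi x|) ->
  uk k @[k --> \oo] --> u -> 'D_(ak k) phi (uk k) @[k --> \oo] --> 'D_a phi u ->
  ak k @[k --> \oo] --> a.
Proof.
move=> oU sphi Uu c0 r0 rU low cu cD; apply/cvg_seqP => e e0.
have ce : 0 < c * e / 2 by rewrite divr_gt0 // mulr_gt0.
have [k1 h1] := (cvg_seqP _ _).1 cu _ r0.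
have [k2 h2] := (cvg_seqP _ _).1 cD _ ce.
have cda := smooth_on_continuous (smooth_on_derive a sphi) Uu.
have [d d0 hd] := continuous_ballP cda ce.
have [k3 h3] := (cvg_seqP _ _).1 cu _ d0.
exists (maxn k1 (maxn k2 k3)) => k; rewrite !geq_max => /and3P[kk1 kk2 kk3].
have := low _ (a - ak k) (h1 _ kk1).
have Uk := rU _ (h1 _ kk1).
have -> : 'D_(a - ak k) phi (uk k) = 'D_a phi (uk k) - 'D_(ak k) phi (uk k).
  by rewrite !(jacobian_atE _ oU (sphi 1%N) Uk) mulmxBl.
have := h2 _ kk2; have := hd _ (h3 _ kk3).
move: ('D_a phi u) ('D_a phi (uk k)) ('D_(ak k) phi (uk k)) => p q s e1 e2 e3.
have : `|q - s| <= `|p - q| + `|p - s|.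
  by rewrite (distrC p q) -(subrKA p); exact: ler_normD.
by rewrite -(ltr_pM2l c0) => e4; move: e1 e2 e3 e4; lra.
Qed.

Lemma hess_limit n m (U : set 'rV[R]_n) (phi : 'rV[R]_n -> 'rV[R]_m) nu u a
    (uk ak : nat -> 'rV[R]_n) :
  open U -> smooth_on U phi -> U u -> (forall k, U (uk k)) ->
  uk k @[k --> \oo] --> u -> ak k @[k --> \oo] --> a ->
  hess phi nu (uk k) (ak k) (ak k) @[k --> \oo] --> hess phi nu u a a.
Proof.
move=> oU sphi Uu Uk cu ca.
have sl := smooth_on_dot nu oU sphi.
have -> : (fun k => hess phi nu (uk k) (ak k) (ak k)) = (fun k =>
   \sum_(i < n) (ak k) 0 i * \sum_(j < n) (ak k) 0 j *
     'D_('e_j) ('D_('e_i) (fun x => dot (phi x) nu)) (uk k)).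
  apply/funext => k; rewrite (hess_dot _ _ _ oU sphi (Uk k)).
  exact: derive2_dirE oU sl (Uk k).
rewrite (hess_dot _ _ _ oU sphi Uu) (derive2_dirE _ _ oU sl Uu).
have cc i : (ak k) 0 i @[k --> \oo] --> a 0 i.
  apply: (@cvg_at_continuous _ R (fun M : 'rV[R]_n => M 0 i)) => //.
  exact: coord_continuous.
apply: cvg_bigsum => i; apply: cvgM; first exact: cc.
apply: cvg_bigsum => j; apply: cvgM; first exact: cc.
have sl2 := smooth_on_derive 'e_j (smooth_on_derive 'e_i sl).
exact: cvg_at_continuous (smooth_on_continuous sl2 Uu) cu.
Qed.

(** The conditions speak of chart vectors mapped to [ek] and [E]. Such vectors exist by tangency and
    converge by [tangent_limit], so the Hessian values converge; written as a product equal to 1,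
    the curvature condition is closed. *)
Lemma nullity_data_limit n (U : set 'rV[R]_n) (phi : 'rV[R]_n -> 'rV[R]_n.+2) u e E nu rho
    (uk : nat -> 'rV[R]_n) (ek : nat -> 'rV[R]_n.+2) (rk : nat -> R) :
  spherical_patch U phi -> U u -> (forall k, U (uk k)) -> dot nu nu = 1 ->
  uk k @[k --> \oo] --> u -> ek k @[k --> \oo] --> e -> rk k @[k --> \oo] --> rho ->
  (forall k, nullity_data phi (uk k) (ek k) E nu (rk k)) ->
  (forall k, dot (ek k) (phi (uk k)) = 0 /\ dot (ek k) nu = 0) ->
  (forall k, dot E (phi (uk k)) = 0) -> dot E nu = 0 ->
  nullity_data phi u e E nu rho.
Proof.
move=> patch Uu Uk nu1 cu ce cr hk eorth Eorth Enu.
have [oU sphi _ _] := patch.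
have cdot (f : 'rV[R]_n -> 'rV[R]_n.+2) : smooth_on U f ->
    dot (f (uk k)) nu @[k --> \oo] --> dot (f u) nu.
  move=> sf; apply: (@cvg_at_continuous _ R (fun x => dot (f x) nu)) => //.
  exact: smooth_on_continuous (smooth_on_dot nu oU sf) Uu.
have lim0 (f : 'rV[R]_n -> 'rV[R]_n.+2) : smooth_on U f ->
    (forall k, dot nu (f (uk k)) = 0) -> dot nu (f u) = 0.
  move=> sf h; have := cdot _ sf.
  have -> : (fun k => dot (f (uk k)) nu) = (fun=> 0) by apply/funext => k; rewrite dotC h.
  by move=> /(cvg_unique _ (cvg_cst _)) h'; rewrite dotC -h'.
have [m [r [m0 r0 rU _ low]]] := patch_lower_bound patch Uu.
split.
- split; first by apply: lim0 => // k; have [[]] := hk k.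
  move=> v; apply: (lim0 ('D_v phi)); first exact: smooth_on_derive.
  by move=> k; have [[_ h]] := hk k.
- move=> a ha.
  have /choice[ak hak] k : exists a, 'D_a phi (uk k) = ek k.
    have [hn _ _] := hk k; have [h1 h2] := eorth k.
    have tv := tangent_vector patch (Uk k) nu1 hn h1 h2.
    exact: tv.
  have ca : ak k @[k --> \oo] --> a.
    apply: tangent_limit oU sphi Uu m0 r0 rU low cu _.
    by rewrite ha (_ : (fun k => _) = ek) //; apply/funext => k.
  have := @hess_limit _ _ U phi nu u a uk ak oU sphi Uu Uk cu ca.
  have -> : (fun k => hess phi nu (uk k) (ak k) (ak k)) = (fun=> 0).
    by apply/funext => k; have [_ h _] := hk k; exact: h.
  by move=> /(cvg_unique _ (cvg_cst _)) h'; rewrite -h'.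
move=> b hb.
have /choice[bk hbk] k : exists b, 'D_b phi (uk k) = E.
  have [hn _ _] := hk k.
  have tv := tangent_vector patch (Uk k) nu1 hn (Eorth k) Enu.
  exact: tv.
have cb : bk k @[k --> \oo] --> b.
  apply: tangent_limit oU sphi Uu m0 r0 rU low cu _.
  rewrite hb (_ : (fun k => _) = (fun=> E)); first exact: cvg_cst.
  by apply/funext => k.
have ch := @hess_limit _ _ U phi nu u b uk bk oU sphi Uu Uk cu cb.
have : hess phi nu (uk k) (bk k) (bk k) * rk k @[k --> \oo] --> hess phi nu u b b * rho.
  exact: cvgM.
have -> : (fun k => hess phi nu (uk k) (bk k) (bk k) * rk k) = (fun=> 1).
  by apply/funext => k; have [_ _ h] := hk k; exact: h.
by move=> /(cvg_unique _ (cvg_cst _)) h'; rewrite -h'.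
Qed.

End NullityData.

(** * The gnomonic chart *)

Section Gnomonic.
Context (R : realType).

Lemma open_preimage_in (V W : topologicalType) (B : set V) (Z : set W) (y : V -> W) :
  open B -> open Z -> (forall u, B u -> {for u, continuous y}) ->
  open [set u | B u /\ Z (y u)].
Proof.
move=> oB oZ cy; rewrite openE => u [Bu Zu]; apply: filterI.
  exact: open_nbhs_nbhs.
by apply: (cy _ Bu); exact: open_nbhs_nbhs.
Qed.

Lemma is_derive_inv (V : normedModType R) (f : V -> R) x v df : f x != 0 ->
  is_derive x v f df -> is_derive x v (fun y => (f y)^-1) (- ((f x)^-1 ^+ 2 * df)).
Proof.
move=> fx [d <-]; split; first exact: derivableV.
by rewrite [LHS](deriveV fx d) /GRing.scale /= exprVn mulNr.
Qed.

Lemma minor_scale (c k p q t : R) : c != 0 -> k != 0 ->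
  c * (k * p) * (c * (k * q)) = c * (k * t) * (c * (k * t)) -> p * q = t * t.
Proof.
move=> c0 k0 h; have ck : c * k * (c * k) != 0 by rewrite !mulf_neq0.
by apply: (mulfI ck); move: h; congr (_ = _); ring.
Qed.

Lemma cos_gt0_lt1 (t : R) : `|t| < 1 -> 0 < cos t.
Proof.
rewrite ltr_norml => /andP[h1 h2]; have := pi_ge2 R => hpi.
by apply: cos_gt0_pihalf; apply/andP; split; lra.
Qed.

Lemma C1_tan n (O : set R) (a : 'rV[R]_n) : open O ->
  (forall t, O t -> cos t != 0) -> Ck_on 1 O (fun t => tan t *: a).
Proof.
move=> oO hc; apply: Ck_on_rows => // i.
have h : Ck_on 1 O (fun t => tan t * a 0 i : R).
  apply: (@C1_real R R O _ (fun t => cos t ^- 2 * a 0 i)) => // t Ot.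
    have h := is_deriveM (is_derive_tan (hc _ Ot)) (is_derive_cst (a 0 i) t 1).
    by apply: is_derive_eq h _; rewrite /GRing.scale /= mulr0 add0r mulrC.
  apply: continuousM; last exact: cst_continuous.
  apply: continuousV; first by rewrite expf_neq0 // hc.
  by apply: continuousM; exact: continuous_cos.
by apply: Ck_on_eq h => // t _; rewrite mxE.
Qed.

Lemma eq_cos_tan (c t : R) : 0 < cos t -> 0 < c ->
  c * c * (1 + tan t * tan t) = 1 -> c = cos t.
Proof.
move=> ct c0; have ctn : cos t != 0 by rewrite gt_eqF.
rewrite /tan => h; have h1 : c * c = cos t * cos t.
  have := cos2Dsin2 t => h2; rewrite -[RHS]mul1r -h.
  have -> : c * c * (1 + sin t / cos t * (sin t / cos t)) * (cos t * cos t) =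
      c * c * (cos t ^+ 2 + sin t ^+ 2) by field.
  by rewrite h2 mulr1.
by apply/eqP; rewrite -(eqrXn2 (n := 2)) // ?ltW // !expr2 h1.
Qed.

(** The curvature is [s] times a second derivative of [w] in the direction [s^-1 *: b], so the net
    factor is [1 / cos t]. Clearing it turns the affine function of [tan t] into a sinusoid. *)
Lemma graph_curvature (c t H r0 r1 : R) : c != 0 -> cos t = c ->
  H * (r0 + r1 * tan t) = 1 ->
  c * (1 * (c^-1 * c^-1 * H)) * (r0 * cos t + r1 * sin t) = 1.
Proof. by move=> c0 ct; rewrite /tan ct => h; rewrite -[RHS]h; field. Qed.

Lemma derive2_scale n (Z : set 'rV[R]_n) (w : 'rV[R]_n -> R) z p k :
  open Z -> smooth_on Z w -> Z z ->
  'D_(k *: p) ('D_(k *: p) w) z = k * k * 'D_p ('D_p w) z.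
Proof.
move=> oZ sw Zz; rewrite !(derive2_dirE _ _ oZ sw Zz) mulr_sumr.
apply: eq_bigr => i _; rewrite mxE -!mulrA; congr (k * _).
rewrite mulrCA; congr (_ * _); rewrite mulr_sumr; apply: eq_bigr => j _.
by rewrite mxE -!mulrA.
Qed.

Lemma smooth_on_id (V : normedModType R) (U : set V) : open U -> smooth_on U (@id V).
Proof.
move=> oU [|k]; first by split => // x _; exact: cvg_id.
split; first by move=> x _; exact: cvg_id.
move=> v; split=> [x _|]; first exact: derivable_id.
by apply: Ck_on_eq (Ck_on_cst k v oU) => // x _; rewrite derive_id.
Qed.

Lemma smooth_mulmxr n m k (U : set 'rV[R]_n) (phi : 'rV[R]_n -> 'rV[R]_m)
    (L : 'M[R]_(m, k)) i :
  open U -> smooth_on U phi -> smooth_on U (fun x => (phi x *m L) 0 i : R).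
Proof.
move=> oU sphi.
have h : smooth_on U (fun x => \sum_j phi x 0 j * L j i : R).
  apply: (@smooth_on_sum _ _ R) => // j; apply: smooth_onM => //.
    exact: smooth_on_coord.
  exact: (@smooth_on_cst _ _ R).
by apply: smooth_on_eq h => // x _; rewrite mxE.
Qed.

Lemma is_derive_mulmxr n m k (phi : 'rV[R]_n -> 'rV[R]_m) (L : 'M[R]_(m, k)) u v i :
  derivable phi u v ->
  is_derive u v (fun x => (phi x *m L) 0 i : R) (('D_v phi u *m L) 0 i).
Proof.
move=> d.
have h : is_derive u v (fun x => \sum_j phi x 0 j * L j i : R) (('D_v phi u *m L) 0 i).
  rewrite mxE; apply: is_derive_bigsum => j.
  have dj : derivable (fun x => phi x 0 j) u v by have /derivable_mxP := d; exact.
  have h := is_deriveM (derivableP dj) (is_derive_cst (L j i) u v).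
  by apply: is_derive_eq h _; rewrite /GRing.scale /= mulr0 add0r (derive_coord j d) mulrC.
by move: h; congr (is_derive _ _ _ _); apply/funext => x; rewrite mxE.
Qed.

Lemma is_derive_affine n m (c : 'rV[R]_m) (J : 'M[R]_(n, m)) z d :
  is_derive z d (fun z => c + z *m J) (d *m J).
Proof.
have h i := is_derive_mulmxr J i (@derivable_id R 'rV[R]_n z d).
have d1 : derivable (fun z => z *m J) z d.
  by apply/derivable_mxP => i j; rewrite ord1; have [] := h j.
have h1 : is_derive z d (fun z => z *m J) (d *m J).
  split=> //; apply/rowP => i; rewrite -(derive_coord i d1).
  by have [_ ->] := h i; rewrite derive_id.
by have := is_deriveD (is_derive_cst c z d) h1; rewrite add0r.
Qed.

Context (n : nat) (U : set 'rV[R]_n) (phi : 'rV[R]_n -> 'rV[R]_n.+2).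
Context (u0 : 'rV[R]_n) (nu : 'rV[R]_n.+2) (L : 'M[R]_(n.+2, n)).
Hypothesis patch : spherical_patch U phi.
Hypothesis Uu0 : U u0.
Hypothesis nu1 : dot nu nu = 1.
Hypothesis nun : normal_to phi u0 nu.
Local Notation x0 := (phi u0).
Local Notation J := (jacobian_at phi u0).
Hypothesis JL : J *m L = 1%:M.
Hypothesis xL : x0 *m L = 0.
Hypothesis nuL : nu *m L = 0.
Hypothesis decomposition :
  forall z, z = dot z x0 *: x0 + 'D_(z *m L) phi u0 + dot z nu *: nu.

Let oU : open U. Proof. by have [] := patch. Qed.
Let sphi : smooth_on U phi. Proof. by have [] := patch. Qed.
Let nphi u : U u -> dot (phi u) (phi u) = 1. Proof. by have [_ _ _ h] := patch; exact: h. Qed.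
Let dphi u v : U u -> derivable phi u v.
Proof. by move=> Uu; exact: smooth_on_derivable sphi Uu. Qed.
Let DJ v : 'D_v phi u0 = v *m J. Proof. exact: jacobian_atE oU (sphi 1%N) Uu0. Qed.

(** Central projection from the origin onto the hyperplane tangent to the sphere at [x0]: the
    projected point has coordinates [y u] along the tangent space of the hypersurface and height
    [W u] along [nu]. *)
Let s u := dot (phi u) x0.
Let y u := (s u)^-1 *: (phi u *m L).
Let W u := (s u)^-1 * dot (phi u) nu.
Let U1 := [set u | U u /\ 0 < s u].

Let ss : smooth_on U s. Proof. exact: smooth_on_dot. Qed.

Let oU1 : open U1.
Proof.
apply: (@open_preimage_in _ _ U [set t : R | 0 < t] s oU (@open_gt _ 0)).
by move=> u Uu; exact: smooth_on_continuous ss Uu.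
Qed.

Let sU1 u : U1 u -> s u != 0. Proof. by move=> [_ h]; rewrite gt_eqF. Qed.
Let U1U : U1 `<=` U. Proof. by move=> u []. Qed.
Let s1 : s u0 = 1. Proof. exact: nphi. Qed.
Let U1u0 : U1 u0. Proof. by split=> //; rewrite /= s1. Qed.

Let sV : smooth_on U1 (fun u => (s u)^-1 : R).
Proof. by apply: smooth_onV => //; exact: smooth_on_sub ss. Qed.

Let sy : smooth_on U1 y.
Proof.
apply: smooth_on_rows => // i.
have h : smooth_on U1 (fun u => (s u)^-1 * (phi u *m L) 0 i : R).
  by apply: smooth_onM => //; apply: smooth_mulmxr => //; exact: smooth_on_sub sphi.
by apply: smooth_on_eq h => // u _; rewrite /y [RHS]mxE.
Qed.

Let sW : smooth_on U1 W.
Proof.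
by apply: smooth_onM => //; apply: smooth_on_dot => //; exact: smooth_on_sub sphi.
Qed.

Let Dy u v : U1 u -> 'D_v y u = (s u)^-1 *: ('D_v phi u *m L) -
   ((s u)^-1 ^+ 2 * dot ('D_v phi u) x0) *: (phi u *m L).
Proof.
move=> U1u; have Uu := U1U U1u; have su := sU1 U1u.
apply/rowP => i.
have dy := smooth_on_derivable (v := v) sy U1u.
rewrite -(derive_coord i dy).
have dv : derivable phi u v by exact: dphi.
have h := is_deriveM (is_derive_inv su (is_derive_dot x0 dv)) (is_derive_mulmxr L i dv).
have -> : (fun u => y u 0 i) = (fun u => (s u)^-1 * (phi u *m L) 0 i).
  by apply/funext => z; rewrite /y [LHS]mxE.
have [_ E] := h; rewrite [LHS]E !mxE /GRing.scale /=.
ring.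
Qed.

Let y0 : y u0 = 0. Proof. by rewrite /y xL scaler0. Qed.

Let Dy0 v : 'D_v y u0 = v.
Proof. by rewrite (Dy _ U1u0) s1 xL scaler0 subr0 invr1 scale1r DJ -mulmxA JL mulmx1. Qed.

Let phiE u : U1 u -> phi u = s u *: (x0 + y u *m J + W u *: nu).
Proof.
move=> U1u; have su := sU1 U1u.
rewrite {1}(decomposition (phi u)) DJ -/(s u) !scalerDr.
rewrite /y /W -scalemxAl !scalerA mulrA !divff // scale1r mul1r.
by [].
Qed.

Lemma gnomonic_chart : exists (s : 'rV[R]_n -> R) (y : 'rV[R]_n -> 'rV[R]_n) U1,
  [/\ [/\ open U1, U1 u0, U1 `<=` U & forall u, s u = dot (phi u) x0],
      smooth_on U1 s /\ smooth_on U1 y,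
      forall u, U1 u -> 0 < s u,
      y u0 = 0 /\ (forall v, 'D_v y u0 = v) &
      forall u, U1 u ->
        phi u = s u *: (x0 + y u *m J + ((s u)^-1 * dot (phi u) nu) *: nu) /\
        (forall v, 'D_v y u = (s u)^-1 *: ('D_v phi u *m L) -
            ((s u)^-1 ^+ 2 * dot ('D_v phi u) x0) *: (phi u *m L))].
Proof.
exists s, y, U1; split => //.
- by split=> //; exact: smooth_on_sub ss.
- by move=> u [].
- by move=> u U1u; split; [exact: phiE|move=> v; exact: Dy].
Qed.

End Gnomonic.

(** * The null curve as a straight segment in gnomonic coordinates *)

Section NullityGeodesic.
Context (R : realType) (n : nat) (U : set 'rV[R]_n) (phi : 'rV[R]_n -> 'rV[R]_n.+2).
Context (u0 : 'rV[R]_n) (nu : 'rV[R]_n.+2).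
Hypothesis patch : spherical_patch U phi.
Hypothesis Uu0 : U u0.
Hypothesis nu1 : dot nu nu = 1.
Hypothesis nun : normal_to phi u0 nu.
Local Notation x0 := (phi u0).
Local Notation J := (jacobian_at phi u0).

(** The inverse function theorem presents the patch as the graph of [w] over the tangent space, and
    [monge_ampere_axis] on the line spanned by [a] supplies [A] and [B]. The parameter on that line
    is [tan t] because the ray through [x0 + tan t *: e] meets the sphere at angle [t] from [x0]. *)
Lemma nullity_geodesic (a b : 'rV[R]_n) :
  rank_le1 U phi ->
  dot ('D_a phi u0) ('D_a phi u0) = 1 ->
  hess phi nu u0 a a = 0 -> hess phi nu u0 b b != 0 ->
  exists2 d : R, 0 < d & exists A B : R, exists eta : R -> 'rV[R]_n,
    [/\ eta 0 = u0, Ck_on 1 [set t | `|t| < d] eta &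
      forall t, `|t| < d ->
      [/\ U (eta t), phi (eta t) = cos t *: x0 + sin t *: 'D_a phi u0 &
        nullity_data phi (eta t) (- sin t *: x0 + cos t *: 'D_a phi u0)
          ('D_b phi u0) nu (A * cos t + B * sin t)]].
Proof.
move=> rank e1 haa hbb.
have [oU sphi imm nphi] := patch.
have [L [JL xL nuL decomposition]] := tangent_projection patch Uu0 nu1 nun.
have DJ v : 'D_v phi u0 = v *m J := jacobian_atE v oU (sphi 1%N) Uu0.
have [s [y [U1 [[oU1 U1u0 U1U sE] [ss sy] spos1 [y0 Dy0] hU1]]]] :=
  gnomonic_chart patch Uu0 JL xL decomposition.
pose W u := (s u)^-1 * dot (phi u) nu.
have sW : smooth_on U1 W.
  apply: smooth_onM => //.
    by apply: smooth_onV => // u /spos1 /gt_eqF ->.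
  by apply: smooth_on_dot => //; exact: smooth_on_sub sphi.
have [r [rho [g [[r0 rho0] [rU1 inj] gB gD gS]]]] := inverse_function oU1 sy U1u0 Dy0.
rewrite y0 in gB gD gS.
pose Z := [set z : 'rV[R]_n | `|0 - z| < rho].
have oZ : open Z by have := ball_open (0 : 'rV[R]_n) rho; rewrite -ball_normE.
have Z0 : Z 0 by rewrite /Z /= subrr normr0.
pose U2 := [set u | `|u0 - u| < r /\ Z (y u)].
have oU2 : open U2.
  apply: (@open_preimage_in _ _ [set u | `|u0 - u| < r] Z y _ oZ).
    by have := ball_open u0 r; rewrite -ball_normE.
  by move=> u /rU1 U1u; exact: smooth_on_continuous sy U1u.
have U2U1 : U2 `<=` U1 by move=> u [/rU1].
have gK u : U2 u -> g (y u) = u.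
  move=> [ur Zy]; have [g1 g2] := gB _ Zy.
  have := inj _ _ g1 ur; rewrite g2 subrr normr0 mulr0 normr_le0.
  by rewrite subr_eq0 => /eqP.
have gU2 z : Z z -> U2 (g z) by move=> Zz; have [g1 g2] := gB _ Zz; split=> //; rewrite g2.
have yg z : Z z -> y (g z) = z by move=> /gB[].
pose w : 'rV[R]_n -> R := W \o g.
have sw : smooth_on Z w by exact: gS.
have wy u : U2 u -> w (y u) = W u by move=> U2u; rewrite /w /= gK.
clearbody w.
(* On the patch, [dot (phi u) N = s u * l N (y u)]. *)
pose l N (z : 'rV[R]_n) : R := dot (x0 + z *m J) N + dot nu N * w z.
have sJ : smooth_on Z (fun z => x0 + z *m J).
  apply: smooth_onD => //; first exact: smooth_on_cst.
  by apply: smooth_on_rows => // i; apply: (@smooth_mulmxr R n n _ Z id) => //; exact: smooth_on_id.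
have sl N : smooth_on Z (l N).
  apply: smooth_onD => //; first exact: smooth_on_dot.
  by apply: smooth_onM => //; exact: (@smooth_on_cst _ _ R).
have dl N z d : Z z -> 'D_d (l N) z = dot (d *m J) N + dot nu N * 'D_d w z.
  move=> Zz; have [dA EA] := is_derive_affine x0 J z d.
  have h1 := is_derive_dot N dA; rewrite EA in h1.
  have h2 := is_deriveZ (dot nu N) (derivableP (smooth_on_derivable (v := d) sw Zz)).
  by have [_ ->] := is_deriveD h1 h2.
have ddl N z d d' : Z z -> 'D_d ('D_d' (l N)) z = dot nu N * 'D_d ('D_d' w) z.
  move=> Zz.
  have E x : Z x -> 'D_d' (l N) x = dot (d' *m J) N + dot nu N * 'D_d' w x by exact: dl.
  rewrite (near_eq_derive d (open_near_eq oZ E Zz)).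
  have h := derivableP (smooth_on_derivable (v := d) (smooth_on_derive d' sw) Zz).
  have [_ ->] := is_deriveD (is_derive_cst (dot (d' *m J) N) z d) (is_deriveZ (dot nu N) h).
  by rewrite add0r.
have slE N u : U2 u -> dot (phi u) N = s u * l N (y u).
  move=> U2u; have [E _] := hU1 _ (U2U1 _ U2u).
  have -> : dot (phi u) N = s u * dot (x0 + y u *m J + W u *: nu) N by rewrite -dotZl -E.
  by congr (_ * _); rewrite /l wy // dotDl dotZl [W u * _]mulrC.
have spos u : U2 u -> 0 < s u by move=> /U2U1 /spos1.
have sn0 u : U2 u -> s u != 0 by move=> /spos /gt_eqF ->.
have Dysurj u d : U2 u -> exists v, 'D_v y u = d.
  move=> U2u; have [_ Zy] := U2u; have [v _ hv] := gD _ d Zy.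
  by exists v; rewrite gK in hv.
have Dslice N u v : U2 u -> dot ('D_v phi u) N =
    s u * 'D_('D_v y u) (l N) (y u) + l N (y u) * 'D_v s u.
  move=> U2u; have U1u := U2U1 _ U2u; have [_ Zy] := U2u.
  have dv : derivable phi u v := smooth_on_derivable sphi (U1U _ U1u).
  have [_ <-] := is_derive_dot N dv.
  rewrite (near_eq_derive v (open_near_eq oU2 (slE N) U2u)).
  have dy := derivableP (smooth_on_derivable (v := v) sy U1u).
  have h := is_derive_comp_C1 oZ (sl N 1%N) Zy dy.
  have hs := derivableP (smooth_on_derivable (v := v) ss U1u).
  have [_ ->] := is_deriveM hs h.
  by rewrite -(derive_dirE _ oZ (sl N 1%N) Zy).
(* For [N] normal at [u], [l N] vanishes to first order at [y u]. This makes the Hessian of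
   [s u * l N (y u)] tensorial, and since the rest of [l N] is affine, it is a multiple of the
   Hessian of [w]. *)
have crit0 N u : U2 u -> normal_to phi u N -> l N (y u) = 0.
  move=> U2u [N1 _]; have := slE N u U2u; rewrite dotC N1 => /esym/eqP.
  by rewrite mulf_eq0 (negbTE (sn0 _ U2u)) => /eqP.
have crit1 N u : U2 u -> normal_to phi u N -> forall d, 'D_d (l N) (y u) = 0.
  move=> U2u Nn d; have [N1 N2] := Nn.
  have [v hv] := Dysurj _ d U2u.
  have := Dslice N u v U2u; rewrite hv crit0 // mul0r addr0 dotC N2 => /esym/eqP.
  by rewrite mulf_eq0 (negbTE (sn0 _ U2u)) => /eqP.
have hessE N u p q : U2 u -> normal_to phi u N ->
    hess phi N u p q = s u * (dot nu N * 'D_('D_p y u) ('D_('D_q y u) w) (y u)).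
  move=> U2u Nn; have [_ Zy] := U2u.
  rewrite (hess_dot _ _ _ oU sphi (U1U _ (U2U1 _ U2u))) -ddl //.
  have U2Z x : U2 x -> Z (y x) by case.
  have <- := @critical_hessian R n n U2 Z s y (l N) u p q oU2 oZ U2Z
    (smooth_on_sub U2U1 ss) (smooth_on_sub U2U1 sy) (sl N) U2u (crit0 _ _ U2u Nn)
    (crit1 _ _ U2u Nn).
  have E x : U2 x -> 'D_q (fun x => dot (phi x) N) x = 'D_q (fun x => s x * l N (y x)) x.
    by move=> U2x; exact: near_eq_derive q (open_near_eq oU2 (slE N) U2x).
  exact: near_eq_derive p (open_near_eq oU2 E U2u).
have rankw z d1 d2 : Z z ->
    'D_d1 ('D_d1 w) z * 'D_d2 ('D_d2 w) z = 'D_d1 ('D_d2 w) z * 'D_d1 ('D_d2 w) z.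
  move=> Zz; have U2u := gU2 _ Zz; have Uu := U1U _ (U2U1 _ U2u).
  have [N N1 Nn] := unit_normal_exists patch Uu.
  have [p hp] := Dysurj _ d1 U2u; have [q hq] := Dysurj _ d2 U2u.
  have hE p' q' := hessE N (g z) p' q' U2u Nn.
  have := rank _ _ p q Uu N1 Nn; rewrite (hE p p) (hE q q) (hE p q) hp hq (yg _ Zz).
  (* If [N] were orthogonal to [nu], [l N] would be affine and vanish to first order at a point,
     hence identically; [N] would then be orthogonal to everything. *)
  have k0 : dot nu N != 0.
    apply/eqP => k0.
    have h1 := crit0 _ _ U2u Nn; have h2 := crit1 _ _ U2u Nn.
    rewrite yg // in h1 h2; rewrite /l k0 mul0r addr0 in h1.
    have h3 d : dot (d *m J) N = 0 by rewrite -(h2 d) dl // k0 mul0r addr0.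
    rewrite dotDl h3 addr0 in h1.
    have : dot N N = 0.
      rewrite {1}(decomposition N) !dotDl !dotZl h1 DJ h3 k0; ring.
    by rewrite N1 => /eqP; rewrite oner_eq0.
  exact: minor_scale (sn0 _ U2u) k0.
have U2u0 : U2 u0 by split; rewrite ?subrr ?normr0 ?y0.
have x0nu : dot x0 nu = 0 by have [h _] := nun; rewrite dotC.
have Jnu d : dot (d *m J) nu = 0 by have [_ h] := nun; rewrite -DJ dotC.
have lnu z : l nu z = w z by rewrite /l dotDl x0nu Jnu nu1 mul1r !add0r.
have dlnu z d : Z z -> 'D_d (l nu) z = 'D_d w z.
  by move=> Zz; rewrite dl // Jnu nu1 mul1r add0r.
have w0 : w 0 = 0 by rewrite -lnu -y0; exact: crit0.
have dw0 d : 'D_d w 0 = 0 by rewrite -dlnu // -y0; exact: crit1.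
have s1 : s u0 = 1 by rewrite sE nphi.
have hess0 p q : hess phi nu u0 p q = 'D_p ('D_q w) 0.
  by rewrite hessE // s1 nu1 !mul1r !Dy0 y0.
have DK z : Z z -> 'D_a ('D_a ('D_b w)) z = 'D_b ('D_a ('D_a w)) z.
  move=> Zz; have E x : Z x -> 'D_a ('D_b w) x = 'D_b ('D_a w) x.
    by move=> Zx; exact: (derive_comm a b oZ (sw 2%N) Zx).
  exact: (etrans (near_eq_derive a (open_near_eq oZ E Zz))
    (derive_comm a b oZ (smooth_on_derive a sw 2%N) Zz)).
have DH z : Z z -> 'D_a ('D_b ('D_b w)) z = 'D_b ('D_a ('D_b w)) z.
  by move=> Zz; exact: (derive_comm a b oZ (smooth_on_derive b sw 2%N) Zz).
have sw2 p q : smooth_on Z ('D_p ('D_q w)) by do 2 apply: smooth_on_derive.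
rewrite hess0 in haa; rewrite hess0 in hbb.
have [d d0 [r0' [r1' axis]]] := @monge_ampere_axis R _ Z _ _ _ a b oZ Z0
  (sw2 a a) (sw2 b b) (sw2 a b) (fun z Zz => rankw z a b Zz) DK DH haa hbb.
(* The equation for the pair [a], [q] gives [w_aq = 0] wherever [w_aa = 0], for every direction [q]
   and not only for [b]. *)
have dwa q t : `|t| < d -> 'D_q w (t *: a) = 0.
  move=> td; rewrite -(dw0 q) -(scale0r a).
  apply: (@zero_derive_cst R (fun t => 'D_q w (t *: a)) d t td) => t' t'd.
  have [Zt At _ _] := axis _ t'd.
  have h := is_derive_ray (smooth_on_derivable (v := a) (smooth_on_derive q sw) Zt).
  apply: is_derive_eq h _; have := rankw _ a q Zt; rewrite At mul0r => /esym/eqP.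
  by rewrite mulf_eq0 orbb => /eqP.
have wa t : `|t| < d -> w (t *: a) = 0.
  move=> td; rewrite -w0 -[in RHS](scale0r a).
  apply: (@zero_derive_cst R (fun t => w (t *: a)) d t td) => t' t'd.
  have [Zt _ _ _] := axis _ t'd.
  have h := is_derive_ray (smooth_on_derivable (v := a) sw Zt).
  by apply: is_derive_eq h _; exact: dwa.
have ctan : {for 0, continuous (@tan R)} by apply: continuous_tan; rewrite cos0 oner_neq0.
have [d1 d10 hd1] := continuous_ballP ctan d0.
(* The bound 1 lies below [pi / 2] and keeps [cos] positive. *)
pose d' := Num.min d1 1.
have tand t : `|t| < d' -> `|tan t| < d.
  rewrite lt_min => /andP[h _]; have := hd1 t; rewrite sub0r normrN tan0 sub0r normrN.
  exact.
have cospos t : `|t| < d' -> 0 < cos t.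
  by rewrite lt_min => /andP[_]; exact: cos_gt0_lt1.
exists d'; first by rewrite lt_min d10 ltr01.
exists r0', r1', (fun t => g (tan t *: a)); split.
- by rewrite tan0 scale0r -y0 gK.
- have oO : open [set t : R | `|t| < d'].
    have := ball_open (0 : R) d'; rewrite -ball_normE /ball_ /=.
    by under eq_set do rewrite sub0r normrN.
  have OZ t : `|t| < d' -> Z (tan t *: a).
    by move=> /tand td; have [Zt _ _ _] := axis _ td.
  have cg : Ck_on 1 Z g.
    apply: Ck_on_rows => // i.
    have sid := smooth_on_coord i oU1 (smooth_on_id oU1).
    exact: (gS _ sid 1%N).
  have ct : Ck_on 1 [set t : R | `|t| < d'] (fun t => tan t *: a).
    by apply: C1_tan => // t /cospos /gt_eqF ->.
  exact: (@C1_comp R R n n [set t | `|t| < d'] Z (fun t => tan t *: a) g oO oZ OZ ct cg).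
move=> t td'.
have ct := cospos _ td'; have ctn : cos t != 0 by rewrite gt_eqF.
have td := tand _ td'; have [Zt At _ Ht] := axis _ td.
set z := tan t *: a in Zt At Ht *.
have U2u := gU2 _ Zt; have U1u := U2U1 _ U2u; have Uu := U1U _ U1u.
have yz := yg _ Zt.
have wz : w z = 0 by exact: wa.
have dwz q : 'D_q w z = 0 by exact: dwa.
set u := g z in U2u U1u Uu yz *.
have [phE DyE] := hU1 _ U1u.
set e := 'D_a phi u0 in e1 *.
have x0e : dot x0 e = 0 by apply: (patch_derivative_orth patch).
have aJ : a *m J = e by rewrite -DJ.
have {}phE : phi u = s u *: (x0 + tan t *: e).
  by rewrite {1}phE yz /z -scalemxAl aJ -/(W u) -wy // yz wz scale0r addr0.
(* The direction of [phi u] is known, so its unit length determines [s u]. *)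
have su : s u = cos t.
  apply: eq_cos_tan => //; first exact: spos.
  have := nphi _ Uu; rewrite phE dotZl dotZr dotDl !dotDr !dotZl !dotZr e1 (dotC e) x0e nphi //.
  by move=> h; rewrite -[RHS]h; ring.
have phE2 : phi u = cos t *: x0 + sin t *: e.
  by rewrite phE su scalerDr scalerA /tan mulrC divfK.
have nue : dot nu e = 0 by have [_ h] := nun; exact: h.
have nux0 : dot nu x0 = 0 by rewrite dotC.
have nunu : normal_to phi u nu.
  split; first by rewrite phE2 dotDr !dotZr nux0 nue !mulr0 addr0.
  by move=> v; rewrite dotC Dslice // yz lnu wz mul0r addr0 dlnu // dwz mulr0.
have phL : phi u *m L = sin t *: a.
  by rewrite phE2 mulmxDl -!scalemxAl xL scaler0 add0r -aJ -mulmxA JL mulmx1.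
split => //; split => //.
  move=> a' ha'.
  (* The tangent of the circle projects to a multiple of [a]; which one is irrelevant, as [w_aa]
     vanishes here. *)
  have [k hk] : exists k, 'D_a' y u = k *: a.
    eexists; rewrite DyE ha' phL mulmxDl -!scalemxAl xL scaler0 add0r -aJ -mulmxA JL mulmx1.
    by rewrite !scalerA -scalerBl.
  by rewrite hessE // hk yz nu1 (derive2_scale _ _ oZ sw Zt) At !mulr0.
move=> b' hb'.
(* [E] is orthogonal to [x0], so the derivative of the factor [s] drops out and only a scaling
   remains. *)
have hk : 'D_b' y u = (s u)^-1 *: b.
  have x0b : dot ('D_b phi u0) x0 = 0 by rewrite dotC; apply: (patch_derivative_orth patch).
  rewrite DyE hb' x0b mulr0 scale0r subr0 DJ.
  by rewrite -mulmxA JL mulmx1.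
rewrite hessE // hk yz nu1 (derive2_scale _ _ oZ sw Zt) su.
exact: graph_curvature.
Qed.

End NullityGeodesic.

(** * Curves and lengths *)

Section Curves.
Context (R : realType).

Lemma is_derive_affine_arg (W : normedModType R) (g : R -> W) (k m t : R) :
  derivable g (k * t + m) k ->
  is_derive t (1 : R) (fun t => g (k * t + m)) ('D_k g (k * t + m)).
Proof.
move=> dg.
have E : (fun h : R => h^-1 *: (((fun t => g (k * t + m)) \o shift t)
    (h *: (1 : R)) - g (k * t + m))) =
  (fun h : R => h^-1 *: ((g \o shift (k * t + m)) (h *: k) - g (k * t + m))).
  apply/funext => h /=; congr (_ *: (g _ - _)).
  by rewrite /GRing.scale /= mulr1; ring.
by split; [rewrite /derivable E|rewrite /derive E].
Qed.

Lemma continuous_affine_arg (T : topologicalType) (g : R -> T) (k m t : R) :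
  {for k * t + m, continuous g} -> {for t, continuous (fun t => g (k * t + m))}.
Proof.
move=> cg; apply: (@continuous_comp _ _ _ (fun t : R => k * t + m) g t) => //.
apply: continuousD; last exact: cst_continuous.
by apply: continuousM; [exact: cst_continuous|exact: cvg_id].
Qed.

Lemma C1_affine_arg (W : normedModType R) (O : set R) (g : R -> W) (k m : R) :
  open [set t | O (k * t + m)] -> Ck_on 1 O g ->
  Ck_on 1 [set t | O (k * t + m)] (fun t => g (k * t + m)).
Proof.
move=> oO [_ dg]; have [d1 [d2 _]] := dg k.
apply: (@C1_real R W _ _ (fun t => 'D_k g (k * t + m))) => //.
  by move=> t Ot; apply: is_derive_affine_arg; exact: d1.
by move=> t Ot; apply: (@continuous_affine_arg W ('D_k g)); exact: d2.
Qed.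

Lemma open_affine_arg (O : set R) (k m : R) : open O -> open [set t | O (k * t + m)].
Proof.
move=> oO; have := @open_preimage_in R R setT O (fun t => k * t + m) openT oO.
have -> : [set u : R | setT u /\ O (k * u + m)] = [set t | O (k * t + m)].
  by apply/seteqP; split => t /=; [case|].
apply => t _; apply: (@continuous_affine_arg R id); exact: cvg_id.
Qed.

Lemma enorm_ge0 n (u : 'rV[R]_n) : 0 <= enorm u.
Proof. exact: sqrtr_ge0. Qed.

Lemma coord_le_enorm n (u : 'rV[R]_n) i : `|u 0 i| <= enorm u.
Proof.
rewrite -sqrtr_sqr ler_sqrt ?dot_ge0 // /dot (bigD1 i) //= expr2 lerDl.
by apply: sumr_ge0 => j _; rewrite -expr2 sqr_ge0.
Qed.

(** The norm on the left is the sup norm, so the fundamental theorem of calculus in each coordinate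
    suffices. Displacement is measured from the end [b] because [pw_C1_path] adds its pieces in
    front. *)
Lemma displacement_le_length n (O : set R) (F : R -> 'rV[R]_n) (a b s : R) :
  open O -> (forall t, a <= t <= b -> O t) ->
  (forall t, O t -> derivable F t 1) ->
  (forall t, O t -> {for t, continuous ('D_1 F)}) ->
  a <= s <= b ->
  (`|F s - F b|%:E <= \int[lebesgue_measure]_(t in `[a, b]) (enorm (derive1 F t))%:E)%E.
Proof.
move=> oO abO dF cF /andP[as_ sb].
have dF1 t i : O t -> is_derive t (1 : R) (fun x => F x 0 i) (('D_1 F t) 0 i).
  move=> Ot; have d := dF _ Ot; rewrite -(derive_coord i d).
  by apply: derivableP; have /derivable_mxP := d; exact.
have cF1 t i : O t -> {for t, continuous (fun x => ('D_1 F x) 0 i)}.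
  move=> Ot; apply: (@continuous_comp _ _ _ ('D_1 F) (fun M : 'rV[R]_n => M 0 i) t (cF _ Ot)).
  exact: coord_continuous.
have cE t : O t -> {for t, continuous (fun x => enorm (derive1 F x))}.
  move=> Ot.
  have -> : (fun x => enorm (derive1 F x)) = (fun x => enorm ('D_1 F x)).
    by apply/funext => x; rewrite derive1E.
  rewrite /enorm.
  apply: (@continuous_comp _ _ _ (fun x => dot ('D_1 F x) ('D_1 F x)) (@Num.sqrt R) t);
    last exact: sqrt_continuous.
  by apply: continuous_sum_for => i; apply: continuousM; exact: cF1.
have wc (h : R -> R) c d : (forall t, O t -> {for t, continuous h}) -> a <= c -> d <= b ->
    {within `[c, d], continuous h}.
  move=> ch ac db; apply: continuous_in_subspaceT => t.
  rewrite inE /= in_itv /= => /andP[ct td]; apply: ch; apply: abO.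
  by rewrite (le_trans ac ct) (le_trans td db).
have mE c d : a <= c -> d <= b ->
    measurable_fun `[c, d] (EFin \o (fun x => enorm (derive1 F x))).
  move=> ac db; apply/measurable_EFinP; apply: subspace_continuous_measurable_fun => //.
  exact: wc.
have mono : (\int[lebesgue_measure]_(t in `[s, b]) (enorm (derive1 F t))%:E <=
    \int[lebesgue_measure]_(t in `[a, b]) (enorm (derive1 F t))%:E)%E.
  apply: ge0_subset_integral => //.
  - exact: mE.
  - by move=> t _; rewrite lee_fin enorm_ge0.
  - by move=> t /=; rewrite !in_itv /= => /andP[h1 h2]; rewrite h2 (le_trans as_ h1).
have len0 : (0 <= \int[lebesgue_measure]_(t in `[a, b]) (enorm (derive1 F t))%:E)%E.
  by apply: integral_ge0 => t _; rewrite lee_fin enorm_ge0.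
have [->|sbn] := eqVneq s b; first by rewrite subrr normr0.
have slb : s < b by rewrite lt_neqAle sbn.
apply: le_trans mono.
set I := integral _ _ _.
have main i : (`|F s 0 i - F b 0 i|%:E <= I)%E.
  have FTC := @continuous_FTC2 R (fun x => ('D_1 F x) 0 i) (fun x => F x 0 i) s b slb.
  have sO t : s <= t <= b -> O t.
    by move=> /andP[h1 h2]; apply: abO; rewrite h2 (le_trans as_ h1).
  have mD : measurable_fun `[s, b] (EFin \o (fun x => ('D_1 F x) 0 i)).
    apply/measurable_EFinP; apply: subspace_continuous_measurable_fun => //.
    by apply: wc => // t; exact: cF1.
  rewrite distrC -[`|_|%:E]/(`|(F b 0 i - F s 0 i)%:E|%E) EFinB -FTC.
  - apply: le_trans (le_abse_integral _ _ _) _ => //.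
    apply: ge0_le_integral => //.
    + exact: measurableT_comp.
    + exact: mE.
    + move=> t _; rewrite lee_fin derive1E; exact: coord_le_enorm.
  - by apply: wc => // t; exact: cF1.
  - have cF0 t : s <= t <= b -> {for t, continuous (fun x => F x 0 i)}.
      move=> tsb; have [d _] := dF1 t i (sO _ tsb).
      by apply: differentiable_continuous; apply/derivable1_diffP.
    split.
    + by move=> t; rewrite in_itv /= => /andP[/ltW h1 /ltW h2];
        have [] := dF1 t i (sO _ (introT andP (conj h1 h2))).
    + by apply: cvg_at_right_filter; apply: cF0; rewrite lexx.
    + by apply: cvg_at_left_filter; apply: cF0; rewrite lexx andbT.
  - move=> t; rewrite in_itv /= => /andP[/ltW h1 /ltW h2]; rewrite derive1E.
    by have [_ ->] := dF1 t i (sO _ (introT andP (conj h1 h2))).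
have I0 : (0 <= I)%E by apply: integral_ge0 => t _; rewrite lee_fin enorm_ge0.
(* Finiteness of the length is not established, so the kinds of extended reals are treated
   separately. *)
move: main I0; move: I => [l h l0|_ _|_ //]; last by rewrite leey.
rewrite lee_fin; apply/rV_norm_leP => // i.
by have := h i; rewrite lee_fin !mxE.
Qed.

Lemma unit_speed_length n (F : R -> 'rV[R]_n) (a b : R) : a <= b ->
  (forall t, a <= t <= b -> enorm (derive1 F t) = 1) ->
  (\int[lebesgue_measure]_(t in `[a, b]) (enorm (derive1 F t))%:E = (b - a)%:E)%E.
Proof.
move=> ab h.
rewrite (eq_integral (cst 1%E)); last first.
  by move=> t; rewrite inE /= in_itv /= => /h ->.
rewrite integral_cst // mul1e.
apply: etrans (lebesgue_measure_itv `[a, b]) _; rewrite /= lte_fin.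
by move: ab; rewrite le_eqVlt => /predU1P[->|ab]; rewrite ?ltxx ?subrr // ab EFinB.
Qed.

End Curves.

(** * Charts of the hypersurface and the Riemannian distance *)

Section Manifold.
Context (R : realType) (n : nat) (M : smooth_manifold R n) (f : M -> 'rV[R]_n.+2).
Hypothesis hf : immersed_in_sphere f.

Lemma chart_patch c : atlas c -> spherical_patch (cimg c) (param f c).
Proof.
move=> ac; have [[sf imm] nf] := hf; have [_ oi _ _ _] := atlas_chart ac.
by split=> //; [exact: sf|move=> u v uc; exact: imm|move=> u _; exact: nf].
Qed.

Lemma cimgP (c : chart R n M) u : atlas c -> cimg c u -> cdom c (cinv c u) /\ cmap c (cinv c u) = u.
Proof.
by move=> ac [p cp <-]; have [_ _ h _ _] := atlas_chart ac; rewrite h.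
Qed.

Lemma cimg_cmap (c : chart R n M) q : cdom c q -> cimg c (cmap c q).
Proof. by exists q. Qed.

Lemma cmapK (c : chart R n M) q : atlas c -> cdom c q -> cinv c (cmap c q) = q.
Proof. by move=> ac; have [_ _ h _ _] := atlas_chart ac; exact: h. Qed.

Lemma transition_domain (c c' : chart R n M) : atlas c ->
  cmap c @` (cdom c `&` cdom c') = [set u | cimg c u /\ cdom c' (cinv c u)].
Proof.
move=> ac; apply/seteqP; split=> u /=.
  by move=> [p [pc pc'] <-]; rewrite cmapK //; split=> //; exact: cimg_cmap.
move=> [uc uc']; have [h1 h2] := cimgP ac uc.
by exists (cinv c u).
Qed.

Lemma transition_domain_open (c c' : chart R n M) : atlas c -> atlas c' ->
  open (cmap c @` (cdom c `&` cdom c')).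
Proof.
move=> ac ac'; rewrite transition_domain //.
have [_ oi _ _ cinvc] := atlas_chart ac; have [oc' _ _ _ _] := atlas_chart ac'.
exact: open_preimage_in.
Qed.

Lemma nullity_data_chart c c' q e E nu rho : atlas c -> atlas c' ->
  cdom c q -> cdom c' q ->
  nullity_data (param f c') (cmap c' q) e E nu rho ->
  nullity_data (param f c) (cmap c q) e E nu rho.
Proof.
move=> ac ac' cq c'q.
have oW := transition_domain_open ac ac'.
have [oU' sphi' _ _] := chart_patch ac'; have [_ sphi _ _] := chart_patch ac.
have sW := atlas_smooth ac ac'.
have WU : cmap c @` (cdom c `&` cdom c') `<=` cimg c by move=> u [p [pc _] <-]; exists p.
have Wq : (cmap c @` (cdom c `&` cdom c')) (cmap c q) by exists q.
have {1}-> : cmap c' q = (cmap c' \o cinv c) (cmap c q) by rewrite /= cmapK.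
apply: (@nullity_data_reparam R n n n.+2 (cmap c @` (cdom c `&` cdom c')) (cimg c')) => //.
- exact: smooth_on_sub sphi.
- by move=> u [p [pc pc'] <-] /=; rewrite cmapK //; exact: cimg_cmap.
- by move=> u [p [pc pc'] <-] /=; rewrite /param /= !cmapK.
Qed.

Lemma chart_curve_derivable (O : set R) (g : R -> M) : open O ->
  (forall t, O t -> {for t, continuous g}) ->
  (forall c, atlas c -> Ck_on 1 (O `&` g @^-1` cdom c) (cmap c \o g)) ->
  forall t, O t -> derivable (f \o g) t 1 /\ {for t, continuous ('D_1 (f \o g))}.
Proof.
move=> oO cg hg t Ot; have [c ac gc] := atlas_cover (g t).
have [oc _ _ _ _] := atlas_chart ac; have [oU sphi _ _] := chart_patch ac.
have oO' : open (O `&` g @^-1` cdom c) by exact: (@open_preimage_in _ _ O (cdom c) g).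
have h : Ck_on 1 (O `&` g @^-1` cdom c) (f \o g).
  have GU x : (O `&` g @^-1` cdom c) x -> cimg c ((cmap c \o g) x).
    by move=> [_ gx]; exact: cimg_cmap.
  have h1 := C1_comp oO' oU GU (hg _ ac) (sphi 1%N).
  apply: (Ck_on_eq oO' _ h1) => x [_ gx].
  by rewrite /= /param /= cmapK.
have [_ /(_ 1)[h1 [h2 _]]] := h.
by split; [exact: h1|exact: h2].
Qed.

Lemma C1_curve_reflect (a b : R) (g : R -> M) :
  C1_curve a b g -> C1_curve (- b) (- a) (fun t => g (- t)).
Proof.
have mE (t : R) : -1 * t + 0 = - t by rewrite mulN1r addr0.
move=> [] O [oO abO cO hO]; exists [set t | O (-1 * t + 0)]; split.
- exact: open_affine_arg.
- by move=> t /andP[t1 t2]; rewrite /= mE; apply: abO; apply/andP; split; lra.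
- move=> t Ot; have -> : (fun t => g (- t)) = (fun t => g (-1 * t + 0)).
    by apply/funext => s; rewrite mE.
  by apply: continuous_affine_arg; exact: cO.
move=> c ac.
have oO' : open (O `&` g @^-1` cdom c).
  by have [oc _ _ _ _] := atlas_chart ac; exact: (@open_preimage_in _ _ O (cdom c) g).
have := C1_affine_arg (open_affine_arg (k := -1) (m := 0) oO') (hO _ ac).
have -> : [set t : R | (O `&` g @^-1` cdom c) (-1 * t + 0)] =
    [set t | O (-1 * t + 0)] `&` (fun t => g (- t)) @^-1` cdom c.
  by apply/seteqP; split=> t /=; rewrite mE.
by congr (Ck_on _ _ _); apply/funext => t /=; rewrite mE.
Qed.

Lemma curve_length_ge0 (a b : R) (g : R -> M) : (0 <= curve_length f a b g)%E.
Proof. by apply: integral_ge0 => t _; rewrite lee_fin enorm_ge0. Qed.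

(* A path of length less than the lower bound [m * r] on the distortion of [f]
   cannot leave the coordinate ball of radius [r] around its end point. *)
Lemma short_path_in_chart c p (m r : R) : atlas c -> cdom c p -> 0 < m -> 0 < r ->
  (forall x, `|cmap c p - x| <= r -> cimg c x) ->
  (forall x, `|cmap c p - x| <= r -> m * `|x - cmap c p| <= `|param f c x - f p|) ->
  forall q p' l, pw_C1_path f q p' l -> p' = p -> (l < (m * r)%:E)%E ->
  [/\ cdom c q, `|cmap c p - cmap c q| < r & (`|f q - f p|%:E <= l)%E].
Proof.
move=> ac cp m0 r0 rU low q p' l hp; elim: hp => {q p' l}.
  by move=> q -> _; split; rewrite ?subrr ?normr0.
move=> a b g q l ab [] O [oO abO cO hO] hp IH qp lt.
have len0 := curve_length_ge0 a b g.
have lle : (l <= curve_length f a b g + l)%E by exact: leeDr.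
have [gb1 gb2 gb3] := IH qp (le_lt_trans lle lt).
have [oc oi _ ccont cinvcont] := atlas_chart ac.
pose V := [set x | cdom c x /\ `|cmap c p - cmap c x| < r].
have oV : open V.
  apply: (@open_preimage_in _ _ (cdom c) [set u | `|cmap c p - u| < r] (cmap c)) => //.
  by have := ball_open (cmap c p) r; rewrite -ball_normE.
(* [K] is compact and the manifold Hausdorff, so [K] is closed in the whole manifold, not only in
   the chart domain. Along the curve it agrees with the open set [V], since the bound on the length
   makes the inequality for the radius strict. *)
pose K := cinv c @` [set u | `|cmap c p - u| <= r].
have cK : closed K.
  apply: compact_closed; first exact: manifold_hausdorff.
  apply: continuous_compact; last exact: compact_closed_ball.
  by apply: continuous_in_subspaceT => u; rewrite inE => /rU; exact: cinvcont.
have KP x : K x -> cdom c x /\ `|cmap c p - cmap c x| <= r.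
  by move=> [u ur <-]; have [h1 h2] := cimgP ac (rU _ ur); rewrite h2.
have disp s : a <= s <= b -> (`|f (g s) - f p|%:E <= curve_length f a b g + l)%E.
  move=> sab.
  have dg t Ot := chart_curve_derivable oO cO hO (t := t) Ot.
  have h := @displacement_le_length R _ O (f \o g) a b s oO abO
    (fun t Ot => (dg t Ot).1) (fun t Ot => (dg t Ot).2) sab.
  apply: (@le_trans _ _ (`|f (g s) - f (g b)| + `|f (g b) - f p|)%:E).
    by rewrite lee_fin -(subrKA (f (g b))); exact: ler_normD.
  by rewrite EFinD; apply: leeD.
have KV s : a <= s <= b -> K (g s) -> V (g s).
  move=> sab /KP[h1 h2]; split=> //.
  have := low _ h2; rewrite /param /= cmapK // => h3.
  have := le_lt_trans (disp _ sab) lt; rewrite lte_fin => h4.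
  by rewrite distrC -(ltr_pM2l m0); exact: le_lt_trans h3 h4.
have VK x : V x -> K x.
  by move=> [h1 h2]; exists (cmap c x); [exact: ltW|exact: cmapK].
(* The times spent inside are relatively open through [V], closed through [K], and include [b] by
   induction; connectedness of the interval yields all of it. *)
pose B := [set s | s \in `[a, b] /\ V (g s)].
have BE : B = `[a, b]%classic.
  apply: segment_connected.
  - by exists b; split=> //; rewrite in_itv /= ab lexx.
  - exists [set s | O s /\ V (g s)]; first exact: open_preimage_in.
    apply/seteqP; split=> s /=; first by move=> [sab Vs];
      split=> //; split=> //; apply: abO; rewrite in_itv in sab.
    by move=> [sab [_ Vs]].
  - exists (~` [set s | O s /\ (~` K) (g s)]).
      apply: open_closedC; apply: open_preimage_in => //; exact: closed_openC.
    apply/seteqP; split=> s /=.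
      by move=> [sab Vs]; split=> // -[_]; apply; exact: VK.
    move=> [sab nK]; split=> //; apply: KV; first by rewrite in_itv in sab.
    apply: contrapT => nKs; apply: nK; split=> //; apply: abO.
    by rewrite in_itv in sab.
have [_ [ga1 ga2]] : B a by rewrite BE /= in_itv /= lexx.
by split=> //; apply: disp; rewrite lexx.
Qed.

Lemma distance_controls_chart c p (e : R) : atlas c -> cdom c p -> 0 < e ->
  exists2 d : R, 0 < d & forall q, (riemannian_distance f q p < d%:E)%E ->
    cdom c q /\ `|cmap c p - cmap c q| < e.
Proof.
move=> ac cp e0.
have [m [r [m0 r0 rU low _]]] := patch_lower_bound (chart_patch ac) (cimg_cmap cp).
pose r' := Num.min (r / 2) e.
have r'0 : 0 < r' by rewrite lt_min e0 divr_gt0.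
have r'r x : `|cmap c p - x| <= r' -> `|cmap c p - x| < r.
  move=> h; apply: (@le_lt_trans _ _ (r / 2)); last by lra.
  by apply: le_trans h _; rewrite ge_min lexx.
have h1 x : `|cmap c p - x| <= r' -> cimg c x by move=> /r'r; exact: rU.
have h2 x : `|cmap c p - x| <= r' -> m * `|x - cmap c p| <= `|param f c x - f p|.
  move=> /r'r xr.
  have -> : f p = param f c (cmap c p) by rewrite /param /= cmapK.
  by apply: low => //; rewrite subrr normr0.
exists (m * r'); first by rewrite mulr_gt0.
move=> q /ereal_inf_lt[l /= hl ld].
have [cq cqr _] := short_path_in_chart ac cp m0 r'0 h1 h2 hl erefl ld.
by split=> //; apply: lt_le_trans cqr _; rewrite ge_min lexx orbT.
Qed.

End Manifold.

(** * Uniqueness and zeros of sinusoids *)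

Section Sinusoids.
Context (R : realType).

Lemma sinusoid_shift (A B t s : R) : A * cos s + B * sin s =
  (A * cos t - B * sin t) * cos (t + s) + (A * sin t + B * cos t) * sin (t + s).
Proof.
have h := cos2Dsin2 t; rewrite cosD sinD.
by transitivity ((A * cos s + B * sin s) * (cos t ^+ 2 + sin t ^+ 2)); [rewrite h mulr1|ring].
Qed.

(** The determinant of the two evaluations is [sin (s - t)], which is nonzero here. *)
Lemma sinusoid_unique (A B A' B' t s : R) : 0 < s - t < pi ->
  A * cos t + B * sin t = A' * cos t + B' * sin t ->
  A * cos s + B * sin s = A' * cos s + B' * sin s -> A = A' /\ B = B'.
Proof.
move=> /sin_gt0_pi sn e1 e2; rewrite sinB in sn.
have h1 : (A - A') * (sin s * cos t - cos s * sin t) = 0.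
  transitivity (sin s * ((A * cos t + B * sin t) - (A' * cos t + B' * sin t)) -
    sin t * ((A * cos s + B * sin s) - (A' * cos s + B' * sin s))); first by ring.
  by rewrite e1 e2; ring.
have h2 : (B - B') * (sin s * cos t - cos s * sin t) = 0.
  transitivity (cos t * ((A * cos s + B * sin s) - (A' * cos s + B' * sin s)) -
    cos s * ((A * cos t + B * sin t) - (A' * cos t + B' * sin t))); first by ring.
  by rewrite e1 e2; ring.
by move/eqP: h1; move/eqP: h2; rewrite !mulf_eq0 !(gt_eqF sn) !orbF !subr_eq0 => /eqP -> /eqP ->.
Qed.

(** The values at 0 and [pi] are opposite, so the intermediate value theorem applies; [A != 0]
    excludes the parameter 0. *)
Lemma sinusoid_zero (A B : R) : A != 0 -> exists2 t, 0 < t & A * cos t + B * sin t = 0.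
Proof.
move=> A0; pose r (t : R) := A * cos t + B * sin t.
have r0 : r 0 = A by rewrite /r cos0 sin0 mulr1 mulr0 addr0.
have rpi : r pi = - A by rewrite /r cospi sinpi mulrN1 mulr0 addr0.
have cr : {within `[0, pi], continuous r}.
  apply: continuous_subspaceT => t; apply: cvgD; apply: cvgM; try exact: cvg_cst.
    exact: continuous_cos.
  exact: continuous_sin.
have h0 : Num.min (r 0) (r pi) <= 0 <= Num.max (r 0) (r pi).
  rewrite r0 rpi ge_min le_max oppr_le0 oppr_ge0 orbC.
  by rewrite andbb le_total.
have [t tpi rt] := IVT (pi_ge0 R) cr h0; exists t => //.
rewrite in_itv /= in tpi; have /andP[t0 _] := tpi; rewrite lt_neqAle t0 andbT.
by apply: contra_neq A0 => tE; rewrite -r0 -[RHS]rt -tE.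
Qed.

Lemma sinusoid_continuous (A B : R) (tk : nat -> R) (T : R) : tk k @[k --> \oo] --> T ->
  A * cos (tk k) + B * sin (tk k) @[k --> \oo] --> A * cos T + B * sin T.
Proof.
move=> h; apply: cvgD; apply: cvgM; try exact: cvg_cst.
  by apply: (cvg_comp _ _ h); exact: continuous_cos.
by apply: (cvg_comp _ _ h); exact: continuous_sin.
Qed.

End Sinusoids.

(** * Leaves of the relative nullity foliation *)

Section Leaves.
Context (R : realType) (n : nat) (M : smooth_manifold R n) (f : M -> 'rV[R]_n.+2).
Hypothesis hf : immersed_in_sphere f.

Lemma second_fundamental_formE c u nu v w : dot nu (param f c u) = 0 ->
  second_fundamental_form f c u nu v w = hess (param f c) nu u v w.
Proof.
move=> h; rewrite /second_fundamental_form /sphere_connection dotBl dotZl.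
by rewrite (dotC _ nu) (dotC (param f c u)) h mulr0 subr0 dotC.
Qed.

Lemma hess_matrix m (U : set 'rV[R]_n) (phi : 'rV[R]_n -> 'rV[R]_m) nu u :
  open U -> smooth_on U phi -> U u ->
  exists2 S : 'M[R]_n, S^T = S & forall a b, hess phi nu u a b = dot (a *m S) b.
Proof.
move=> oU sphi Uu; have sl := smooth_on_dot nu oU sphi.
exists (\matrix_(j, i) 'D_('e_j) ('D_('e_i) (fun x => dot (phi x) nu)) u).
  apply/matrixP => i j; rewrite !mxE.
  exact: (derive_comm _ _ oU (sl 2%N) Uu).
move=> a b; rewrite (hess_dot _ _ _ oU sphi Uu) (derive2_dirE _ _ oU sl Uu).
apply: eq_bigr => i _; rewrite mulrC mxE; congr (_ * _).
by apply: eq_bigr => j _; rewrite mxE.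
Qed.

Section RankOne.
Hypothesis hn : (1 < n)%N.
Hypothesis hzero : forall p : M, zero_principal_curvatures_at_least f (n - 1) p.

(** [E] passes from orthonormal coordinates to chart coordinates and [T] back. The matrix of the
    form in this frame is an [h_matrix], to which the multiplicity hypothesis and
    [symmetric_rank_one] apply. *)
Lemma curvature_form c u nu : atlas c -> cimg c u -> dot nu nu = 1 ->
  normal_to (param f c) u nu ->
  exists (E T : 'M[R]_n) (mu : R) (k : 'rV[R]_n),
  [/\ E *m T = 1%:M,
      (forall a b, dot ('D_(a *m E) (param f c) u) ('D_(b *m E) (param f c) u) = dot a b) &
      forall a b, hess (param f c) nu u a b = mu * dot (a *m T) k * dot (b *m T) k].
Proof.
move=> ac uc nu1 nun; have [oU sphi imm nphi] := chart_patch hf ac.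
have DE v := jacobian_atE v oU (sphi 1%N) uc.
set J := jacobian_at _ _ in DE.
have [E hE] : exists E : 'M[R]_n, (E *m J) *m (E *m J)^T = 1%:M.
  by apply: orthonormal_rows => v; rewrite -DE; exact: imm.
pose T := J *m (E *m J)^T.
have ET : E *m T = 1%:M by rewrite mulmxA.
have TE : T *m E = 1%:M by exact: mulmx1C.
have metric a b : dot ('D_(a *m E) (param f c) u) ('D_(b *m E) (param f c) u) = dot a b.
  rewrite !DE dotE -(mulmxA a E J) -(mulmxA b E J) trmx_mul.
  by rewrite [a *m (E *m J) *m (_ *m _)]mulmxA -(mulmxA a (E *m J)) hE mulmx1 -dotE.
have [S sS hS] := hess_matrix nu oU sphi uc.
have [u1 u2] := cimgP ac uc.
pose H := \matrix_(i, j) second_fundamental_form f c u nu (row i E) (row j E).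
have HE : H = E *m S *m E^T.
  apply/matrixP => i j; rewrite mxE second_fundamental_formE; last by have [] := nun.
  rewrite hS -row_mul [RHS]mxE; apply: eq_bigr => l _.
  by rewrite [row i _ 0 l]mxE [row j _ 0 l]mxE [E^T l j]mxE.
have hH : h_matrix f (cinv c u) H.
  exists c, (fun i => row i E), nu; rewrite u2; split=> //.
    move=> i j; rewrite /induced_metric !rowE metric dotE.
    by rewrite -rowE !mxE eqxx.
  by have [n1 n2] := nun.
have sH : H^T = H by rewrite HE !trmx_mul trmxK sS mulmxA.
have [mu [k hk]] := symmetric_rank_one sH hn (hzero hH).
exists E, T, mu, k; split=> // a b.
have -> : hess (param f c) nu u a b = dot (a *m T *m H) (b *m T).
  rewrite hS HE !dotE trmx_mul; congr (fun_of_matrix _ 0 0).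
  rewrite -(mulmxA a T) (mulmxA T) (mulmxA T E) TE mul1mx -!mulmxA.
  by rewrite (mulmxA E^T T^T b^T) -trmx_mul TE trmx1 mul1mx.
have -> : a *m T *m H = (mu * dot (a *m T) k) *: k.
  apply/rowP => j; rewrite [LHS]mxE [RHS]mxE /dot mulr_sumr mulr_suml.
  by apply: eq_bigr => i _; rewrite hk; ring.
by rewrite dotZl (dotC k).
Qed.

Lemma chart_rank_le1 c : atlas c -> rank_le1 (cimg c) (param f c).
Proof.
move=> ac u nu a b uc nu1 nun.
have [E [T [mu [k [_ _ h]]]]] := curvature_form ac uc nu1 nun.
by rewrite !h; ring.
Qed.

(** * Leaves over one fixed great circle *)

Section GreatCircle.
Context (x e E nu : 'rV[R]_n.+2).
Hypotheses (xx : dot x x = 1) (ee : dot e e = 1) (xe : dot x e = 0).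
Hypotheses (Ex : dot E x = 0) (Ee : dot E e = 0).
Hypotheses (nn : dot nu nu = 1) (nx : dot nu x = 0) (ne : dot nu e = 0) (nE : dot nu E = 0).

Definition circle (t : R) := cos t *: x + sin t *: e.
Definition circle' (t : R) := - sin t *: x + cos t *: e.

Lemma circleD (t s : R) : circle (t + s) = cos s *: circle t + sin s *: circle' t.
Proof.
by rewrite /circle /circle' cosD sinD; apply/rowP => i; rewrite !mxE; ring.
Qed.

Lemma circle'D (t s : R) : circle' (t + s) = - sin s *: circle t + cos s *: circle' t.
Proof.
by rewrite /circle /circle' cosD sinD; apply/rowP => i; rewrite !mxE; ring.
Qed.

Lemma dot_circle' t : dot (circle' t) (circle' t) = 1.
Proof.
rewrite /circle' !dotDl !dotDr !dotZl !dotZr xx ee (dotC e) xe.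
by have := cos2Dsin2 t => h; rewrite -[RHS]h; ring.
Qed.

Lemma circle'_orth t : dot (circle' t) (circle t) = 0.
Proof. by rewrite /circle' /circle !dotDl !dotDr !dotZl !dotZr xx ee (dotC e) xe; ring. Qed.

Lemma circle'_nu t : dot (circle' t) nu = 0.
Proof. by rewrite dotDl !dotZl (dotC x) (dotC e) nx ne !mulr0 addr0. Qed.

Lemma E_circle t : dot E (circle t) = 0.
Proof. by rewrite dotDr !dotZr Ex Ee !mulr0 addr0. Qed.

Lemma is_derive_circle t : is_derive t (1 : R) circle (circle' t).
Proof.
have h i : is_derive t (1 : R) (fun t => circle t 0 i) (circle' t 0 i).
  have h1 := is_deriveM (is_derive_cos t) (is_derive_cst (x 0 i) t 1).
  have h2 := is_deriveM (is_derive_sin t) (is_derive_cst (e 0 i) t 1).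
  have h := is_deriveD h1 h2.
  have -> : (fun t => circle t 0 i) = (fun t => cos t * x 0 i + sin t * e 0 i).
    by apply/funext => s; rewrite !mxE.
  by apply: is_derive_eq h _; rewrite /circle' !mxE /GRing.scale /=; ring.
have d : derivable circle t 1.
  by apply/derivable_mxP => i j; rewrite ord1; have [] := h j.
split=> //; apply/rowP => i; rewrite -(derive_coord i d).
by have [_ ->] := h i.
Qed.

(** One chart suffices, as [nullity_data_chart] carries the condition to every other chart of the
    atlas around [q]. *)
Definition on_leaf (A B : R) q t := f q = circle t /\
  exists c, [/\ atlas c, cdom c q &
    nullity_data (param f c) (cmap c q) (circle' t) E nu (A * cos t + B * sin t)].

Definition leaf_curve (A B lo hi : R) (g : R -> M) :=
  [/\ forall t, lo < t < hi -> on_leaf A B (g t) t,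
      forall t, lo < t < hi -> {for t, continuous g} &
      forall c, atlas c ->
        Ck_on 1 ([set t | lo < t < hi] `&` g @^-1` cdom c) (cmap c \o g)].

Lemma open_itv_set (lo hi : R) : open [set t : R | lo < t < hi].
Proof.
have -> : [set t : R | lo < t < hi] = [set t | t \in `]lo, hi[].
  by apply/seteqP; split=> t /=; rewrite in_itv.
exact: interval_open.
Qed.

Lemma E_tangent c q t rho : atlas c -> cdom c q -> f q = circle t ->
  nullity_data (param f c) (cmap c q) (circle' t) E nu rho ->
  exists b, 'D_b (param f c) (cmap c q) = E.
Proof.
move=> ac cq fq [nun _ _].
have h : dot E (param f c (cmap c q)) = 0 by rewrite /param /= cmapK // fq E_circle.
have En : dot E nu = 0 by rewrite dotC.
have tv := tangent_vector (chart_patch hf ac) (cimg_cmap cq) nn nun h En.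
exact: tv.
Qed.

(** Both values are inverse to the same nonzero curvature in the direction [E]. Overlapping leaves
    are recognized in this way as having the same sinusoid. *)
Lemma on_leaf_rho_unique A B A' B' q t : on_leaf A B q t -> on_leaf A' B' q t ->
  A * cos t + B * sin t = A' * cos t + B' * sin t.
Proof.
move=> [fq [c [ac cq h]]] [_ [c' [ac' c'q h']]].
have h2 := nullity_data_chart hf ac ac' cq c'q h'.
have [b hb] := E_tangent ac cq fq h.
have [_ _ /(_ b hb) e1] := h; have [_ _ /(_ b hb) e2] := h2.
have hn0 : hess (param f c) nu (cmap c q) b b != 0.
  by apply: contra_eq_neq e1 => ->; rewrite mul0r eq_sym oner_eq0.
by apply: (mulfI hn0); rewrite e1 e2.
Qed.

Lemma on_leaf_rho_neq0 A B q t : on_leaf A B q t -> A * cos t + B * sin t != 0.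
Proof.
move=> [fq [c [ac cq h]]]; have [b hb] := E_tangent ac cq fq h.
have [_ _ /(_ b hb) e1] := h.
by apply: contra_eq_neq e1 => ->; rewrite mulr0 eq_sym oner_eq0.
Qed.

Lemma leaf_extension c q t0 rho : atlas c -> cdom c q -> f q = circle t0 ->
  nullity_data (param f c) (cmap c q) (circle' t0) E nu rho ->
  exists (d A B : R) (g : R -> M),
    [/\ 0 < d, g t0 = q, leaf_curve A B (t0 - d) (t0 + d) g &
       forall t, t0 - d < t < t0 + d -> cdom c (g t)].
Proof.
move=> ac cq fq hnull; have patch := chart_patch hf ac.
have [oU sphi imm nphi] := patch.
have [nun hnull1 hnull2] := hnull.
set u := cmap c q in hnull nun hnull1 hnull2.
have uc : cimg c u := cimg_cmap cq.
have phiu : param f c u = circle t0 by rewrite /param /= cmapK.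
have [b hb] := E_tangent ac cq fq hnull.
have [a ha] : exists a, 'D_a (param f c) u = circle' t0.
  have h : dot (circle' t0) (param f c u) = 0 by rewrite phiu circle'_orth.
  have tv := tangent_vector patch uc nn nun h (circle'_nu t0).
  exact: tv.
have hbn : hess (param f c) nu u b b != 0.
  by apply: contra_eq_neq (hnull2 _ hb) => ->; rewrite mul0r eq_sym oner_eq0.
have a1 : dot ('D_a (param f c) u) ('D_a (param f c) u) = 1 by rewrite ha dot_circle'.
have [d d0 [A [B [eta [eta0 ceta heta]]]]] :=
  nullity_geodesic patch uc nn nun (chart_rank_le1 ac) a1 (hnull1 _ ha) hbn.
pose g t := cinv c (eta (1 * t + - t0)).
have tE (t : R) : 1 * t + - t0 = t - t0 by rewrite mul1r.
have itvP t : t0 - d < t < t0 + d -> `|1 * t + - t0| < d.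
  by rewrite tE => /andP[h1 h2]; rewrite ltr_norml; apply/andP; split; lra.
have gU t : t0 - d < t < t0 + d -> cdom c (g t) /\ cmap c (g t) = eta (1 * t + - t0).
  by move=> /itvP /heta[h _ _]; exact: cimgP.
have gc t : t0 - d < t < t0 + d -> {for t, continuous g}.
  move=> tI; have [cc _ _ _ cinvc] := atlas_chart ac.
  have [h1 _ _] := heta _ (itvP _ tI).
  have ce : {for 1 * t + - t0, continuous eta} by exact: (ceta.1 _ (itvP _ tI)).
  have ca := continuous_affine_arg ce.
  exact: continuous_comp ca (cinvc _ h1).
(* The local sinusoid is centred at [t0]; [sinusoid_shift] gives these coefficients in the global
   parameter. *)
exists d, (A * cos t0 - B * sin t0), (A * sin t0 + B * cos t0), g; split; first exact: d0.
- by rewrite /g mul1r subrr eta0 cmapK.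
- split.
  + move=> t tI; have [h1 h2 h3] := heta _ (itvP _ tI); have [gt1 gt2] := gU _ tI.
    have tt : t = t0 + (1 * t + - t0) by rewrite mul1r addrC subrK.
    split.
      by rewrite -[f (g t)]/(param f c (eta (1 * t + - t0))) h2 phiu ha -circleD -tt.
    exists c; split; [exact: ac|exact: gt1|rewrite gt2].
    move: h3; rewrite phiu ha hb -circle'D -tt.
    congr (nullity_data _ _ _ _ _ _); rewrite [in RHS]tt.
    exact: sinusoid_shift.
  + exact: gc.
  + move=> c' ac'; have [oc' _ _ _ _] := atlas_chart ac'.
    have oB : open ([set t | t0 - d < t < t0 + d] `&` g @^-1` cdom c').
      by apply: (@open_preimage_in _ _ [set t | t0 - d < t < t0 + d] (cdom c') g) => //;
        exact: open_itv_set.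
    have od : open [set t : R | `|t| < d].
      by have := ball_open (0 : R) d; rewrite -ball_normE /ball_ /=;
        congr open; apply/seteqP; split=> t /=; rewrite sub0r normrN.
    have h1 := C1_affine_arg (open_affine_arg (k := 1) (m := - t0) od) ceta.
    have h2 : Ck_on 1 ([set t | t0 - d < t < t0 + d] `&` g @^-1` cdom c')
        (fun t => eta (1 * t + - t0)).
      by apply: (Ck_on_sub _ h1) => t [tI _]; exact: itvP.
    apply: (C1_comp oB (transition_domain_open ac ac') _ h2 (atlas_smooth ac ac' 1%N)).
    move=> t [tI gt]; rewrite transition_domain //; split; last exact: gt.
    by have [h _ _] := heta _ (itvP _ tI).
- by move=> t /gU[].
Qed.

(** The strict bounds [lo < t] and [t' < hi] leave room for differentiability at both ends. The
    degenerate case [leaf_step A B t q t q] says that some leaf passes through [q] at time [t]. *)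
Definition leaf_step (A B t : R) (q : M) (t' : R) (q' : M) :=
  exists (lo hi : R) (g : R -> M),
    [/\ lo < t, t <= t', t' < hi, leaf_curve A B lo hi g & g t = q /\ g t' = q'].

Lemma leaf_step_on_leaf A B t q t' q' : leaf_step A B t q t' q' ->
  on_leaf A B q t /\ on_leaf A B q' t'.
Proof.
move=> [lo [hi [g [lot tt' t'hi [h _ _] [<- <-]]]]]; split; apply: h.
  by rewrite lot (le_lt_trans tt' t'hi).
by rewrite t'hi (lt_le_trans lot tt').
Qed.

Lemma leaf_step_refl A B t q t' q' : leaf_step A B t q t' q' ->
  leaf_step A B t' q' t' q'.
Proof.
move=> [lo [hi [g [lot tt' t'hi h [_ g2]]]]]; exists lo, hi, g; split=> //.
exact: lt_le_trans lot tt'.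
Qed.

Lemma derive_circle_opp t : 'D_(-1) circle t = - circle' t.
Proof.
have [d1 d2] := is_derive_circle t; have df := (derivable1_diffP circle t).1 d1.
by rewrite deriveE // raddfN /= -deriveE // d2.
Qed.

Lemma leaf_curve_length A B lo hi g a b : leaf_curve A B lo hi g ->
  lo < a -> a <= b -> b < hi ->
  C1_curve a b g /\ curve_length f a b g = (b - a)%:E.
Proof.
move=> [h1 h2 h3] loa ab bhi.
have abI t : a <= t <= b -> lo < t < hi.
  by move=> /andP[at_ tb]; rewrite (lt_le_trans loa at_) (le_lt_trans tb bhi).
split; first by exists [set t | lo < t < hi]; split => //; exact: open_itv_set.
apply: unit_speed_length => // t /abI tI; rewrite derive1E.
have E1 s : [set t | lo < t < hi] s -> (f \o g) s = circle s.
  by move=> /= /h1[].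
have -> : 'D_1 (f \o g) t = circle' t.
  have [_ <-] := is_derive_circle t; apply: near_eq_derive.
  by apply: (@open_near_eq _ _ [set t | lo < t < hi]) => //; exact: open_itv_set.
by rewrite /enorm dot_circle' sqrtr1.
Qed.

Lemma leaf_curve_length_reflect A B lo hi g a b : leaf_curve A B lo hi g ->
  lo < a -> a <= b -> b < hi ->
  curve_length f (- b) (- a) (fun t => g (- t)) = (b - a)%:E.
Proof.
move=> [h1 h2 h3] loa ab bhi.
have ba : - b <= - a by rewrite lerN2.
have -> : b - a = - a - - b by rewrite opprK addrC.
apply: unit_speed_length => // t /andP[t1 t2]; rewrite derive1E.
have tI : [set s | lo < -1 * s + 0 < hi] t by rewrite /= mulN1r addr0; apply/andP; split; lra.
have oI := @open_affine_arg _ [set s : R | lo < s < hi] (-1) 0 (@open_itv_set lo hi).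
have E1 s : [set s | lo < -1 * s + 0 < hi] s ->
    (f \o (fun t => g (- t))) s = circle (-1 * s + 0).
  by move=> /= /h1[]; rewrite mulN1r addr0.
have -> : 'D_1 (f \o (fun t => g (- t))) t = 'D_(-1) circle (-1 * t + 0).
  have dc : derivable circle (-1 * t + 0) (-1).
    have [d1 _] := is_derive_circle (-1 * t + 0).
    by apply: diff_derivable; apply/derivable1_diffP.
  have [_ <-] := is_derive_affine_arg dc; apply: near_eq_derive.
  by apply: (open_near_eq oI).
by rewrite derive_circle_opp /enorm dotNl dotNr opprK dot_circle' sqrtr1.
Qed.

(** Both directions are needed: [riemannian_distance] uses paths in a given order, while
    completeness quantifies over all pairs of indices. Going back along a leaf prepends the
    reflected curve, which has the same length. *)
Lemma leaf_step_path A B t q t' q' : leaf_step A B t q t' q' -> forall z l,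
  (pw_C1_path f q' z l -> pw_C1_path f q z ((t' - t)%:E + l)%E) /\
  (pw_C1_path f q z l -> pw_C1_path f q' z ((t' - t)%:E + l)%E).
Proof.
move=> [lo [hi [g [lot tt' t'hi hg [<- <-]]]]] z l.
have [h1 <-] := leaf_curve_length hg lot tt' t'hi.
have tN : - t' <= - t by rewrite lerN2.
split=> [hp|hp]; first exact: PathCons.
rewrite (_ : curve_length f t t' g = curve_length f (- t') (- t) (fun t => g (- t))).
  have h := @PathCons _ _ _ _ f _ _ (fun t => g (- t)) z l tN (C1_curve_reflect h1).
  by move: h; rewrite /= !opprK; apply.
rewrite (leaf_curve_length_reflect hg lot tt' t'hi).
by have [_ ->] := leaf_curve_length hg lot tt' t'hi.
Qed.

Section Sequence.
Context (A B : R) (tk : nat -> R) (qk : nat -> M).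
Hypothesis steps : forall k, leaf_step A B (tk k) (qk k) (tk k.+1) (qk k.+1).

Lemma leaf_sequence_path k j :
  pw_C1_path f (qk k) (qk (k + j)) (tk (k + j) - tk k)%:E /\
  pw_C1_path f (qk (k + j)) (qk k) (tk (k + j) - tk k)%:E.
Proof.
split.
  elim: j k => [|j IH] k; first by rewrite addn0 subrr; exact: PathNil.
  have [h _] := leaf_step_path (steps k) (qk (k + j.+1)) (tk (k + j.+1) - tk k.+1)%:E.
  have -> : tk (k + j.+1) - tk k = (tk k.+1 - tk k) + (tk (k + j.+1) - tk k.+1) by ring.
  by rewrite EFinD; apply: h; rewrite addnS -addSn; exact: IH.
elim: j => [|j IH]; first by rewrite addn0 subrr; exact: PathNil.
have [_ h] := leaf_step_path (steps (k + j)) (qk k) (tk (k + j) - tk k)%:E.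
have -> : tk (k + j.+1) - tk k = (tk (k + j).+1 - tk (k + j)) + (tk (k + j) - tk k).
  by rewrite addnS; ring.
by rewrite EFinD addnS; exact: h.
Qed.

Lemma leaf_sequence_nondecreasing : {homo tk : k l / (k <= l)%N >-> k <= l}.
Proof.
by apply/nondecreasing_seqP => k; have [lo [hi [g []]]] := steps k.
Qed.

Lemma leaf_sequence_distance k l :
  (riemannian_distance f (qk k) (qk l) <= `|tk k - tk l|%:E)%E.
Proof.
apply: ereal_inf_lbound => /=; case/orP: (leq_total k l) => kl.
  rewrite distrC ger0_norm ?subr_ge0 ?leaf_sequence_nondecreasing //.
  by have [] := leaf_sequence_path k (l - k); rewrite subnKC.
rewrite ger0_norm ?subr_ge0 ?leaf_sequence_nondecreasing //.
by have [] := leaf_sequence_path l (k - l); rewrite subnKC.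
Qed.

End Sequence.

(** Admissible end times are bounded by the zero [ts], since a leaf defined at [ts] would have a
    product equal to 1 with a zero factor. Their supremum need not be attained, so the step covers
    only half of the distance to it. *)
Lemma greedy_step A B ts t q : leaf_step A B t q t q -> t < ts ->
  A * cos ts + B * sin ts = 0 ->
  exists t' q', [/\ t < t' < ts, leaf_step A B t q t' q' &
    forall t'' q'', leaf_step A B t q t'' q'' -> t'' - t <= 2 * (t' - t)].
Proof.
move=> [lo [hi [g [lot _ thi hg [gt _]]]]] tts ts0.
have below t' q' : leaf_step A B t q t' q' -> t' < ts.
  move=> [lo' [hi' [g' [lot' tt' t'hi [hg' _ _] _]]]]; rewrite ltNge; apply/negP => tst'.
  have /hg'/on_leaf_rho_neq0 : lo' < ts < hi'.
    by rewrite (lt_trans lot' tts) (le_lt_trans tst' t'hi).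
  by rewrite ts0 eqxx.
pose S := [set t' | exists q', leaf_step A B t q t' q'].
have St : S t by exists q, lo, hi, g; split.
(* This admissible time puts the supremum beyond [t], so the step makes progress. *)
have Sm : S ((t + hi) / 2).
  by exists (g ((t + hi) / 2)), lo, hi, g; split=> //; lra.
have hS : has_sup S.
  split; first by exists t.
  by exists ts => t' [q' /below /ltW].
have supm : t < sup S.
  by apply: (@lt_le_trans _ _ ((t + hi) / 2)); [lra|exact: sup_upper_bound].
have e0 : 0 < (sup S - t) / 2 by rewrite divr_gt0 // subr_gt0.
have [t' [q' hq'] t'S] := sup_adherent e0 hS.
exists t', q'; split=> //; first by rewrite (below _ _ hq') andbT; lra.
move=> t'' q'' hq''; have : t'' <= sup S by apply: sup_upper_bound => //; exists q''.
by lra.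
Qed.

Lemma greedy_sequence A B ts t q : leaf_step A B t q t q -> t < ts ->
  A * cos ts + B * sin ts = 0 ->
  exists (tk : nat -> R) (qk : nat -> M),
   [/\ forall k, tk k < tk k.+1 < ts,
     forall k, leaf_step A B (tk k) (qk k) (tk k.+1) (qk k.+1) &
     forall k t'' q'', leaf_step A B (tk k) (qk k) t'' q'' ->
       t'' - tk k <= 2 * (tk k.+1 - tk k)].
Proof.
move=> tq tts ts0.
(* The invariant is carried in a subtype, so that the successor becomes a total function that can be
   iterated. *)
pose S := {s : R * M | leaf_step A B s.1 s.2 s.1 s.2 /\ s.1 < ts}.
have nextP (s : S) : exists s' : S, [/\ (sval s).1 < (sval s').1 < ts,
    leaf_step A B (sval s).1 (sval s).2 (sval s').1 (sval s').2 &
    forall t'' q'', leaf_step A B (sval s).1 (sval s).2 t'' q'' ->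
      t'' - (sval s).1 <= 2 * ((sval s').1 - (sval s).1)].
  case: s => -[t1 q1] /= [s1 s2].
  have [t' [q' [/andP[h1 h2] h3 h4]]] := greedy_step s1 s2 ts0.
  have hS : leaf_step A B t' q' t' q' /\ t' < ts by split=> //; exact: leaf_step_refl h3.
  by exists (exist _ (t', q') hS); rewrite /= h1 h2.
have [next hnext] := choice nextP.
have s0 : leaf_step A B t q t q /\ t < ts by [].
pose s k : S := iter k next (exist _ (t, q) s0).
exists (fun k => (sval (s k)).1), (fun k => (sval (s k)).2).
by split=> k; have [] := hnext (s k).
Qed.

Lemma circle_continuous (tk : nat -> R) (T : R) :
  tk k @[k --> \oo] --> T -> circle (tk k) @[k --> \oo] --> circle T.
Proof.
move=> h; have [d _] := is_derive_circle T.
apply: (cvg_comp _ _ h); apply: differentiable_continuous.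
exact/derivable1_diffP.
Qed.

Lemma circle'_continuous (tk : nat -> R) (T : R) :
  tk k @[k --> \oo] --> T -> circle' (tk k) @[k --> \oo] --> circle' T.
Proof.
move=> h; apply: cvgD.
  apply: cvgZr_tmp; apply: cvgN; apply: (cvg_comp _ _ h); exact: continuous_sin.
by apply: cvgZr_tmp; apply: (cvg_comp _ _ h); exact: continuous_cos.
Qed.

(** * The limit of a sequence of steps and the contradiction *)

Section LimitPoint.
Context (A B : R) (tk : nat -> R) (qk : nat -> M) (T : R).
Hypothesis steps : forall k, leaf_step A B (tk k) (qk k) (tk k.+1) (qk k.+1).
Hypothesis cT : tk k @[k --> \oo] --> T.
Hypothesis hcomplete : riemannian_complete f.

Lemma leaf_sequence_on_leaf k : on_leaf A B (qk k) (tk k).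
Proof. by have [] := leaf_step_on_leaf (steps k). Qed.

Lemma leaf_sequence_limit : exists p : M,
  forall d : R, 0 < d -> exists k0 : nat, forall k, (k0 <= k)%N ->
    (riemannian_distance f (qk k) p < d%:E)%E.
Proof.
apply: hcomplete => d d0.
have d2 : 0 < d / 2 by rewrite divr_gt0.
have [k0 hk0] := (cvg_seqP _ _).1 cT _ d2.
exists k0 => k l /hk0 kT /hk0 lT; apply: le_lt_trans (leaf_sequence_distance steps k l) _.
rewrite lte_fin -(subrKA T); apply: le_lt_trans (ler_normD _ _) _.
by rewrite (distrC (tk k)); lra.
Qed.

Lemma limit_chart p c : atlas c -> cdom c p ->
  (forall d : R, 0 < d -> exists k0 : nat, forall k, (k0 <= k)%N ->
    (riemannian_distance f (qk k) p < d%:E)%E) ->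
  forall d : R, 0 < d -> exists k0 : nat, forall k, (k0 <= k)%N ->
    cdom c (qk k) /\ `|cmap c p - cmap c (qk k)| < d.
Proof.
move=> ac cp hp d d0; have [d' d'0 h] := distance_controls_chart hf ac cp d0.
by have [k0 hk0] := hp _ d'0; exists k0 => k /hk0; exact: h.
Qed.

Lemma limit_on_leaf p c : atlas c -> cdom c p ->
  (forall d : R, 0 < d -> exists k0 : nat, forall k, (k0 <= k)%N ->
    cdom c (qk k) /\ `|cmap c p - cmap c (qk k)| < d) ->
  f p = circle T /\
  nullity_data (param f c) (cmap c p) (circle' T) E nu (A * cos T + B * sin T).
Proof.
move=> ac cp hp; have [k0 hk0] := hp 1 ltr01.
have patch := chart_patch hf ac; have [oU sphi _ _] := patch.
(* The first [k0] terms may lie outside the chart and are dropped. *)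
pose uk k := cmap c (qk (k + k0)); pose sk k := tk (k + k0).
have cq k : cdom c (qk (k + k0)) by have [] := hk0 _ (leq_addl k k0).
have cs : sk k @[k --> \oo] --> T.
  apply/(cvg_seqP (V := R)) => d d0; have [k1 hk1] := (cvg_seqP _ _).1 cT _ d0; exists k1 => k k1k.
  exact: (hk1 (k + k0)%N (leq_trans k1k (leq_addr _ _))).
have cu : uk k @[k --> \oo] --> cmap c p.
  apply/cvg_seqP => d d0; have [k1 hk1] := hp _ d0; exists k1 => k k1k.
  by have [] := hk1 (k + k0)%N (leq_trans k1k (leq_addr _ _)).
have phik k : param f c (uk k) = circle (sk k).
  by rewrite /param /= cmapK //; have [] := leaf_sequence_on_leaf (k + k0).
have pc := cimg_cmap cp.
split.
  have h1 : param f c (uk k) @[k --> \oo] --> param f c (cmap c p).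
    by apply: (cvg_comp _ _ cu); exact: (smooth_on_continuous sphi pc).
  have h2 : param f c (uk k) @[k --> \oo] --> circle T.
    under eq_fun do rewrite phik; exact: circle_continuous.
  have -> : f p = param f c (cmap c p) by rewrite /param /= cmapK.
  by apply: (cvg_unique _ h1 h2); exact: norm_hausdorff.
apply: (@nullity_data_limit R n (cimg c) (param f c) (cmap c p) (circle' T) E nu
  (A * cos T + B * sin T) uk (fun k => circle' (sk k))
  (fun k => A * cos (sk k) + B * sin (sk k)) patch pc _ nn cu).
- by move=> k; exact: cimg_cmap.
- exact: circle'_continuous cs.
- exact: sinusoid_continuous cs.
- move=> k; have [_ [ck [ack ckq hk]]] := leaf_sequence_on_leaf (k + k0).
  exact: (nullity_data_chart hf ac ack (cq k) ckq hk).
- by move=> k; rewrite phik circle'_orth circle'_nu.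
- by move=> k; rewrite phik E_circle.
- by rewrite dotC.
Qed.

(* [f] is injective near [p], so that the two leaves through nearby points, having the
   same image, coincide. *)
Lemma limit_leaf_agrees p c A' B' d g : atlas c -> cdom c p -> 0 < d ->
  (forall d : R, 0 < d -> exists k0 : nat, forall k, (k0 <= k)%N ->
    cdom c (qk k) /\ `|cmap c p - cmap c (qk k)| < d) ->
  g T = p -> leaf_curve A' B' (T - d) (T + d) g ->
  (forall t, T - d < t < T + d -> cdom c (g t)) ->
  exists k0 : nat, forall k, (k0 <= k)%N ->
    `|T - tk k| < d /\ qk k = g (tk k).
Proof.
move=> ac cp d0 hp gT [hg cg _] gc.
have [m [r [m0 r0 rU low _]]] := patch_lower_bound (chart_patch hf ac) (cimg_cmap cp).
have [k0 hk0] := hp _ r0.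
have [k1 hk1] := (cvg_seqP _ _).1 cT _ d0.
have cmg : (fun t => cmap c (g t)) (tk k) @[k --> \oo] --> cmap c p.
  have TI : T - d < T < T + d by apply/andP; split; lra.
  have cgT : {for T, continuous (cmap c \o g)}.
    apply: continuous_comp; first exact: cg.
    by rewrite gT; have [_ _ _ h _] := atlas_chart ac; exact: h.
  by move: (cvg_comp _ _ cT cgT); rewrite /= gT.
have [k2 hk2] := (cvg_seqP _ _).1 cmg _ r0.
exists (maxn k0 (maxn k1 k2)) => k; rewrite !geq_max => /and3P[/hk0[cq uq] /hk1 kT /hk2 ug].
split=> //.
have kI : T - d < tk k < T + d.
  by move: kT; rewrite ltr_norml => /andP[h1 h2]; apply/andP; split; lra.
have cgk := gc _ kI.
have := low _ _ uq ug; rewrite /param /= !cmapK //.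
have [-> _] := leaf_sequence_on_leaf k; have [-> _] := hg _ kI.
rewrite subrr normr0 pmulr_rle0 // normr_le0 subr_eq0 => /eqP uE.
by rewrite -(cmapK ac cq) uE cmapK.
Qed.

End LimitPoint.

(** Let [T] be the limit of the greedy times. The leaf through the limit point offers, from a time
    [tk k] within [d / 2] of [T], a step of length [(T - tk k) + d / 2], more than [2 * (T - tk k)].
    The greedy choice bounds every step by twice an advance that stays below [T]. *)
Lemma no_complete_leaf A B ts t q : riemannian_complete f ->
  leaf_step A B t q t q -> t < ts -> A * cos ts + B * sin ts = 0 -> False.
Proof.
move=> hcomplete tq tts ts0.
have [tk [qk [tk1 steps greedy]]] := greedy_sequence tq tts ts0.
have nd := leaf_sequence_nondecreasing steps.
have cT : tk k @[k --> \oo] --> sup (range tk).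
  apply: nondecreasing_cvgn => //; exists ts => _ [k _ <-].
  by have /andP[h1 h2] := tk1 k; exact: ltW (lt_trans h1 h2).
set T := sup _ in cT.
have tkT k : tk k < T.
  have /andP[h _] := tk1 k; apply: lt_le_trans h _.
  have <- : limn tk = T by exact: cvg_lim cT.
  by apply: nondecreasing_cvgn_le => //; apply/cvg_ex; exists T.
have [p hp] := leaf_sequence_limit steps cT hcomplete.
have [c ac cp] := atlas_cover p.
have hpc := limit_chart ac cp hp.
have [fp hnull] := limit_on_leaf steps cT ac cp hpc.
have [d [A' [B' [g [d0 gT hg gc]]]]] := leaf_extension ac cp fp hnull.
have [k0 hk0] := limit_leaf_agrees steps cT ac cp d0 hpc gT hg gc.
(* [d / 2] serves the final inequality; the bound 1 keeps two consecutive times less than [pi]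
   apart, so that their values determine the sinusoid. *)
have dd : 0 < Num.min (d / 2) 1 by rewrite lt_min divr_gt0 // ltr01.
have [k1 hk1] := (cvg_seqP _ _).1 cT _ dd.
pose k := maxn k0 k1.
have [kd qE] := hk0 k (leq_maxl _ _).
have [kd' qE'] := hk0 k.+1 (leq_trans (leq_maxl _ _) (leqnSn _)).
have := hk1 k (leq_maxr _ _).
have tT := tkT k; have tT' := tkT k.+1; have /andP[tt _] := tk1 k.
rewrite gtr0_norm ?subr_gt0 // lt_min => /andP[Td T1].
have gI s : tk k <= s < T + d -> T - d < s < T + d.
  by move=> /andP[s1 s2]; apply/andP; split => //; lra.
have [hg1 _ _] := hg.
have l1 : on_leaf A' B' (qk k) (tk k) by rewrite qE; apply: hg1; apply: gI; apply/andP; split; lra.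
have l2 : on_leaf A' B' (qk k.+1) (tk k.+1).
  by rewrite qE'; apply: hg1; apply: gI; apply/andP; split; lra.
have tpi : 0 < tk k.+1 - tk k < pi by have := pi_ge2 R => h; apply/andP; split; lra.
have [AE BE] := sinusoid_unique tpi (on_leaf_rho_unique (leaf_sequence_on_leaf steps k) l1)
  (on_leaf_rho_unique (leaf_sequence_on_leaf steps k.+1) l2).
have step : leaf_step A B (tk k) (qk k) (T + d / 2) (g (T + d / 2)).
  exists (T - d), (T + d), g; rewrite AE BE qE; split=> //; lra.
by have := greedy _ _ _ step; lra.
Qed.

Lemma no_nullity_data c q rho : riemannian_complete f -> atlas c -> cdom c q ->
  f q = circle 0 -> nullity_data (param f c) (cmap c q) (circle' 0) E nu rho -> False.
Proof.
move=> hcomplete ac cq fq hnull.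
have [d [A [B [g [d0 g0 hg _]]]]] := leaf_extension ac cq fq hnull.
have step : leaf_step A B 0 q 0 q by exists (0 - d), (0 + d), g; split => //; lra.
have [/on_leaf_rho_neq0 A0 _] := leaf_step_on_leaf step.
rewrite cos0 sin0 mulr1 mulr0 addr0 in A0.
have [ts ts0 tsE] := sinusoid_zero B A0.
exact: no_complete_leaf hcomplete step ts0 tsE.
Qed.

End GreatCircle.

Lemma complete_totally_geodesic : riemannian_complete f -> totally_geodesic f.
Proof.
move=> hcomplete p H [c [fr [nu [[ac cp] _ [n1 n2 n3] ->]]]].
apply/matrixP => i j; rewrite mxE [RHS]mxE second_fundamental_formE //.
have patch := chart_patch hf ac; have [oU sphi imm nphi] := patch.
have uc := cimg_cmap cp; set u := cmap c p in uc n2 n3 *.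
have nun : normal_to (param f c) u nu by [].
have [E [T [mu [k [ET metric hE]]]]] := curvature_form ac uc n1 nun.
have [//|h0] := eqVneq (hess (param f c) nu u (fr i) (fr j)) 0; exfalso.
have mu0 : mu != 0 by apply: contra_neq h0 => mu0; rewrite hE mu0 !mul0r.
have k0 : k != 0.
  by apply: contra_neq h0 => k0; rewrite hE k0 /dot [X in _ * X]big1 ?mulr0 // => l _;
    rewrite [X in _ * X]mxE mulr0.
(* In orthonormal coordinates the form is [mu] times a product of pairings with [k]: it is nonzero
   on the unit vector [b] along [k] and vanishes on a unit vector [a] orthogonal to [k], available
   because [1 < n]. Their images are the initial data [e] and [E] of the great circle. *)
have [al al0 alk] := unit_multiple k0.
have [v v0 vk] := kernel_vector k^T hn.
have [be _ bev] := unit_multiple v0.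
set a := be *: v in bev; set b := al *: k in alk.
have ak : dot a k = 0 by rewrite dotE -scalemxAl vk scaler0 mxE.
have ab : dot a b = 0 by rewrite dotZr ak mulr0.
have bk : dot b k != 0.
  by rewrite dotZl mulf_neq0 ?gt_eqF // dot_gt0.
have inj v1 v2 : 'D_v1 (param f c) u = 'D_v2 (param f c) u -> v1 = v2.
  rewrite !(jacobian_atE _ oU (sphi 1%N) uc) => e; apply/eqP; rewrite -subr_eq0; apply/eqP.
  by apply: (imm _ _ uc); rewrite (jacobian_atE _ oU (sphi 1%N) uc) mulmxBl e subrr.
have haa : hess (param f c) nu u (a *m E) (a *m E) = 0.
  by rewrite hE -mulmxA ET mulmx1 ak mulr0.
have hbb : hess (param f c) nu u (b *m E) (b *m E) != 0.
  by rewrite hE -mulmxA ET mulmx1 !mulf_neq0.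
have orth w := patch_derivative_orth patch w uc.
have fp : param f c u = f p by rewrite /param /= cmapK.
have sf : dot (f p) (f p) = 1 by exact: hf.2.
have c0 (y z : 'rV[R]_n.+2) : circle y z 0 = y.
  by rewrite /circle cos0 sin0 scale1r scale0r addr0.
have c0' (y z : 'rV[R]_n.+2) : circle' y z 0 = z.
  by rewrite /circle' cos0 sin0 oppr0 scale1r scale0r add0r.
set ea := 'D_(a *m E) (param f c) u; set eb := 'D_(b *m E) (param f c) u.
have ee : dot ea ea = 1 by rewrite metric.
have ex : dot (f p) ea = 0 by rewrite -fp; exact: orth.
have Ex : dot eb (f p) = 0 by rewrite dotC -fp; exact: orth.
have Ee : dot eb ea = 0 by rewrite metric dotC.
have nx : dot nu (f p) = 0 by rewrite -fp.
apply: (@no_nullity_data (f p) ea eb nu sf ee ex Ex Ee n1 nx (n3 _) (n3 _) c p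
  (hess (param f c) nu u (b *m E) (b *m E))^-1 hcomplete ac cp (esym (c0 _ _))).
rewrite c0'; split; first exact: nun.
  by move=> a' ha; rewrite (inj _ _ ha).
by move=> b' hb; rewrite (inj _ _ hb) mulfV.
Qed.

End RankOne.
End Leaves.

(** For [n = 1] the condition on the curvatures is empty, and a small circle of the two-sphere is
    complete without being a great circle; hence [1 < n]. *)
Theorem proposition1p1 (R : realType) (n : nat) (hn : (1 < n)%N)
    (M : smooth_manifold R n) (f : M -> 'rV[R]_n.+2)
    (hf : immersed_in_sphere f)
    (hcomplete : riemannian_complete f)
    (hzero : forall p : M, zero_principal_curvatures_at_least f (n - 1) p) :
  totally_geodesic f.
Proof. exact: (complete_totally_geodesic hf hn hzero hcomplete). Qed.
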